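(* Let $n\ge 1$ and let $G$ be a Zariski dense subgroup of $\mathrm{Sp}(n,1)$ (Zariski dense in the sense defined in the context). (1) Let $g\in \mathrm{Sp}(n,1)$ be a regular elliptic element such that $\delta(g)<1$. If $\langle g, hgh^{-1}\rangle$ is discrete for every loxodromic element $h\in G$, then $G$ is discrete. (2) Let $g\in \mathrm{Sp}(n,1)$ be a loxodromic element such that $M_g<1$. If $\langle g, hgh^{-1}\rangle$ is discrete for every loxodromic element $h\in G$, then $G$ is discrete. (3) Let $g\in \mathrm{Sp}(n,1)$ be a Heisenberg translation, of the form $T_{s,\zeta}$ up to conjugacy in $\mathrm{Sp}(n,1)$, such that $|\zeta|<\frac12$. If $\langle g, hgh^{-1}\rangle$ is discrete for every loxodromic element $h\in G$, then $G$ is discrete. In each part $g$ is not required to belong to $G$.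
   Context: Let $\mathbb H$ be the division ring of Hamilton's quaternions, and let $\mathbb H^{n,1}$ be the right $\mathbb H$-vector space $\mathbb H^{n+1}$ with a Hermitian form $\langle z,w\rangle = z^*Jw$ of signature $(n,1)$, where $J$ is either of the two equivalent matrices $$J_1=\begin{pmatrix}-1&0\\0&I_n\end{pmatrix},\qquad J_2=\begin{pmatrix}0&-1&0\\-1&0&0\\0&0&I_{n-1}\end{pmatrix}$$ (the two models are identified by a change of basis). $\mathrm{Sp}(n,1)=\{A\in \mathrm{GL}(n+1,\mathbb H): A^*JA=J\}$, with its usual Lie group topology; ''discrete'' means discrete as a subgroup of $\mathrm{Sp}(n,1)$. Quaternionic hyperbolic space $\mathbf H^n_{\mathbb H}$ is the image in the (right) projective space $\mathbb H\mathbb P^n$ of the negative vectors ($\langle z,z\rangle<0$), and its boundary $\partial \mathbf H^n_{\mathbb H}$ is the image of the nonzero null vectors ($\langle z,z\rangle=0$). $\mathrm{Sp}(n,1)$ acts on $\mathbf H^n_{\mathbb H}\cup\partial\mathbf H^n_{\mathbb H}$, by isometries on $\mathbf H^n_{\mathbb H}$. A subgroup $G$ of $\mathrm{Sp}(n,1)$ is called Zariski dense if it does not fix a point of $\mathbf H^n_{\mathbb H}\cup\partial \mathbf H^n_{\mathbb H}$ and does not preserve a proper totally geodesic subspace of $\mathbf H^n_{\mathbb H}$. An element $g$ is elliptic if it has a fixed point in $\mathbf H^n_{\mathbb H}$; a non-elliptic element is parabolic (resp. loxodromic) if it has a unique fixed point (resp. exactly two fixed points) on $\partial\mathbf H^n_{\mathbb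 H}$. Eigenvalues are right eigenvalues; they occur in similarity classes $\{\mu\lambda\mu^{-1}:\mu\in\mathbb H\setminus\{0\}\}$. Elliptic case: in the model $J_1$, an elliptic $g$ is conjugate in $\mathrm{Sp}(n,1)$ to $\mathrm{diag}(\lambda_1,\ldots,\lambda_{n+1})$ with all $|\lambda_i|=1$, where the eigenvector for $\lambda_1$ has negative Hermitian length and all the other eigenvectors have positive Hermitian length. $g$ is regular elliptic if the similarity classes of $\lambda_1,\dots,\lambda_{n+1}$ are mutually disjoint. Put $$\delta(g)=\max\{|\lambda_1-1|+|\lambda_i-1| : i=2,\ldots,n+1\}.$$ Loxodromic case: in the model $J_2$, a loxodromic $g$ is conjugate in $\mathrm{Sp}(n,1)$ to $\mathrm{diag}(\lambda_1,\bar\lambda_1^{-1},\lambda_3,\ldots,\lambda_{n+1})$ with $|\lambda_1|>1$ and $|\lambda_i|=1$ for $i\ge3$. Put $$\delta_{cp}(g)=\max\{|\lambda_i-1| : i=3,\ldots,n+1\},\qquad M_g=2\delta_{cp}(g)+|\lambda_1-1|+|\bar\lambda_1^{-1}-1|$$ (with $\delta_{cp}(g)=0$ if $n=1$). Heisenberg translation: a unipotent parabolic element, i.e. a parabolic element all of whose eigenvalues are $1$. In the model $J_2$, up to conjugacy in $\mathrm{Sp}(n,1)$ it has the form $$T_{s,\zeta}=\begin{pmatrix}1&0&0\\ s&1&\zeta^*\\ \zeta&0&I_{n-1}\end{pmatrix},\qquad s\in\mathbb H,\ \zeta\in\mathbb H^{n-1},\ \mathrm{Re}(s)=\tfrac12|\zeta|^2.$$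 *)

(* Defs.v *)
From HB Require Import structures.
From mathcomp Require Import all_boot all_order all_algebra.
From mathcomp Require Import all_classical all_reals all_analysis.
From mathcomp Require Import ring.

Set Implicit Arguments.
Unset Strict Implicit.
Unset Printing Implicit Defensive.

Import Order.TTheory GRing.Theory Num.Theory.
Import numFieldNormedType.Exports.

Local Open Scope classical_set_scope.
Local Open Scope ring_scope.

Record quat (R : realType) := Quat { qre : R; qi : R; qj : R; qk : R }.

Section QuatRing.
Variable R : realType.
Local Notation H := (quat R).
Implicit Types x y z : H.

Definition quat_tuple x : R * R * (R * R) := ((qre x, qi x), (qj x, qk x)).
Definition tuple_quat (t : R * R * (R * R)) : H :=
  Quat t.1.1 t.1.2 t.2.1 t.2.2.

Lemma quat_tupleK : cancel quat_tuple tuple_quat.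
Proof. by case. Qed.

HB.instance Definition _ := Choice.copy H (can_type quat_tupleK).

(* The Euclidean topology of R^4. *)
HB.instance Definition _ := Topological.copy H (initial_topology quat_tuple).

Definition qadd x y :=
  Quat (qre x + qre y) (qi x + qi y) (qj x + qj y) (qk x + qk y).
Definition qopp x := Quat (- qre x) (- qi x) (- qj x) (- qk x).
Definition qreal (r : R) : H := Quat r 0 0 0.
Definition qmul x y :=
  let: Quat a b c d := x in let: Quat a' b' c' d' := y in
  Quat (a * a' - b * b' - c * c' - d * d')
       (a * b' + b * a' + c * d' - d * c')
       (a * c' - b * d' + c * a' + d * b')
       (a * d' + b * c' - c * b' + d * a').

Lemma qaddA : associative qadd.
Proof. by case=> ????[????][????]; congr Quat; rewrite /= addrA. Qed.
Lemma qaddC : commutative qadd.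
Proof. by case=> ????[????]; congr Quat; rewrite /= addrC. Qed.
Lemma qadd0 : left_id (qreal 0) qadd.
Proof. by case=> ????; congr Quat; rewrite /= add0r. Qed.
Lemma qaddN : left_inverse (qreal 0) qopp qadd.
Proof. by case=> ????; congr Quat; rewrite /= addNr. Qed.

HB.instance Definition _ := GRing.isZmodule.Build H qaddA qaddC qadd0 qaddN.

Lemma qmulA : associative qmul.
Proof. by case=> ????[????][????]; congr Quat => /=; ring. Qed.
Lemma qmul1 : left_id (qreal 1) qmul.
Proof. by case=> ????; congr Quat => /=; ring. Qed.
Lemma qmulr1 : right_id (qreal 1) qmul.
Proof. by case=> ????; congr Quat => /=; ring. Qed.
Lemma qmulDl : left_distributive qmul +%R.
Proof. by case=> ????[????][????]; congr Quat => /=; ring. Qed.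
Lemma qmulDr : right_distributive qmul +%R.
Proof. by case=> ????[????][????]; congr Quat => /=; ring. Qed.
Lemma qone_neq0 : qreal 1 != 0.
Proof. by apply/eqP => -[]; apply/eqP; rewrite oner_eq0. Qed.

HB.instance Definition _ := GRing.Zmodule_isNzRing.Build H
  qmulA qmul1 qmulr1 qmulDl qmulDr qone_neq0.

Definition qconj x := Quat (qre x) (- qi x) (- qj x) (- qk x).
Definition qnorm2 x : R := qre x ^+ 2 + qi x ^+ 2 + qj x ^+ 2 + qk x ^+ 2.
Definition qabs x : R := Num.sqrt (qnorm2 x).
Definition qinv x : H := qreal (qnorm2 x)^-1 * qconj x.

Lemma qnorm2_eq0 x : (qnorm2 x == 0) = (x == 0).
Proof.
case: x => a b c d; rewrite /qnorm2 /=.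
rewrite !paddr_eq0 ?addr_ge0 ?sqr_ge0 // !sqrf_eq0.
apply/idP/eqP => [/andP[/andP[/andP[/eqP-> /eqP->] /eqP->] /eqP->]//|].
by case=> -> -> -> ->; rewrite eqxx.
Qed.

Lemma qmulV : {in [pred x : H | x != 0], left_inverse 1 qinv *%R}.
Proof.
move=> x; rewrite inE -qnorm2_eq0; case: x => a b c d /= nz.
by rewrite /qinv /qnorm2 /= in nz *; congr Quat => /=; field.
Qed.
Lemma qdivrr : {in [pred x : H | x != 0], right_inverse 1 qinv *%R}.
Proof.
move=> x; rewrite inE -qnorm2_eq0; case: x => a b c d /= nz.
by rewrite /qinv /qnorm2 /= in nz *; congr Quat => /=; field.
Qed.
Lemma qunitP x y : y * x = 1 /\ x * y = 1 -> x != 0.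
Proof.
case=> yx _; apply/eqP => x0; move: yx; rewrite x0 mulr0 => /esym/eqP.
by rewrite oner_eq0.
Qed.
Lemma qinv_out : {in [predC [pred x : H | x != 0]], qinv =1 id}.
Proof.
move=> x; rewrite !inE negbK => /eqP ->.
by rewrite /qinv; congr Quat => /=; ring.
Qed.

HB.instance Definition _ := GRing.NzRing_hasMulInverse.Build H
  qmulV qdivrr qunitP qinv_out.

Definition sim_class x : set H := [set u * x * u^-1 | u in [set u | u != 0]].

End QuatRing.

Section Sp.
Variable R : realType.
Local Notation H := (quat R).

Definition adjmx m n (A : 'M[H]_(m, n)) : 'M[H]_(n, m) := (map_mx (@qconj R) A)^T.

Definition GLH n (A : 'M[H]_n) : Prop :=
  exists B : 'M[H]_n, A *m B = 1%:M /\ B *m A = 1%:M.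

(* MathComp's [unitmx] and [invmx] need a commutative ring of coefficients. *)
Definition mxinv n (A : 'M[H]_n) : 'M[H]_n :=
  xget 1%:M [set B | A *m B = 1%:M /\ B *m A = 1%:M].

Lemma mxinvP n (A : 'M[H]_n) :
  GLH A -> A *m mxinv A = 1%:M /\ mxinv A *m A = 1%:M.
Proof.
move=> [B AB].
exact: (xgetPex 1%:M (ex_intro [set B | A *m B = 1%:M /\ B *m A = 1%:M] B AB)).
Qed.

(* C is an isometry from (H^n, J') onto (H^n, J). *)
Definition isometry n (J' J C : 'M[H]_n) : Prop :=
  GLH C /\ adjmx C *m J *m C = J'.

Definition Sp n (J : 'M[H]_n) : set 'M[H]_n := [set A | isometry J J A].

(* g is conjugate to d after identifying the models J' and J; when J' = J this
   is conjugacy in [Sp J]. *)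
Definition conj_to n (J g J' d : 'M[H]_n) : Prop :=
  exists2 C, isometry J' J C & mxinv C *m g *m C = d.

Definition subgroup n (J : 'M[H]_n) (K : set 'M[H]_n) : Prop :=
  [/\ K `<=` Sp J, K 1%:M,
      forall a b, K a -> K b -> K (a *m b) &
      forall a, K a -> K (mxinv a)].

Definition generated n (J : 'M[H]_n) (A : set 'M[H]_n) : set 'M[H]_n :=
  smallest (subgroup J) A.

(* Every point of K is isolated in K, for the topology of the space of
   matrices, which induces the Lie group topology of Sp(n,1). *)
Definition discrete n (K : set 'M[H]_n) : Prop := K `<=` isolated K.

End Sp.

Section Hyperbolic.
Variables (R : realType) (n : nat) (J : 'M[quat R]_n).
Local Notation H := (quat R).
Local Notation V := 'cV[H]_n.
Implicit Types (z w : V) (p q : set V) (g : 'M[H]_n) (G : set 'M[H]_n).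

Definition form z w : H := (adjmx z *m J *m w) 0 0.

(* [form z z] is a real quaternion since J is Hermitian. *)
Definition negative z : Prop := qre (form z z) < 0.
Definition null z : Prop := z != 0 /\ form z z = 0.

(* The point of the right projective space: the right line z H. *)
Definition pt z : set V := [set z *m a%:M | a in [set: H]].

Definition HH : set (set V) := [set pt z | z in negative].
Definition bdHH : set (set V) := [set pt z | z in null].

Definition act g p : set V := mulmx g @` p.

Definition elliptic g : Prop := exists2 p, HH p & act g p = p.

Definition fix_bd g : set (set V) := [set p | bdHH p /\ act g p = p].

Definition parabolic g : Prop := ~ elliptic g /\ exists p, fix_bd g = [set p].

Definition loxodromic g : Prop :=
  ~ elliptic g /\ exists p q, p <> q /\ fix_bd g = [set p; q].

Definition right_eigenvalue g (a : H) : Prop :=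
  exists2 z : V, z != 0 & g *m z = z *m a%:M.

Definition arcosh (x : R) : R := ln (x + Num.sqrt (x ^+ 2 - 1)).

(* Distance between [pt z] and [pt w] for negative z and w:
   cosh^2 (d / 2) = <z,w> <w,z> / (<z,z> <w,w>). *)
Definition hdist z w : R :=
  2 * arcosh (qabs (form z w) /
              Num.sqrt (qre (form z z) * qre (form w w))).

(* Lift to negative vectors of a bi-infinite unit speed geodesic. *)
Definition geodesic (c : R -> V) : Prop :=
  (forall t, negative (c t)) /\ (forall s t, hdist (c s) (c t) = `|s - t|).

(* Complete connected totally geodesic submanifolds: in a Hadamard manifold
   these are the nonempty closed subsets containing the whole geodesic through
   any two of their points. *)
Definition totally_geodesic (S : set (set V)) : Prop :=
  [/\ S `<=` HH, S !=set0,
      forall z, negative z ->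
        (forall e : R, 0 < e ->
           exists w, [/\ negative w, S (pt w) & hdist z w < e]) -> S (pt z) &
      forall c s t, geodesic c -> s != t -> S (pt (c s)) -> S (pt (c t)) ->
        forall u, S (pt (c u))].

Definition Zariski_dense G : Prop :=
  ~ (exists2 p, (HH `|` bdHH) p & forall g, G g -> act g p = p) /\
  ~ (exists S, [/\ totally_geodesic S, S <> HH &
       forall g, G g -> act g @` S = S]).

End Hyperbolic.

(* The hyperbolic dimension is n.+1, hence arbitrary >= 1. *)
Section Models.
Variables (R : realType) (n : nat).
Local Notation H := (quat R).
Implicit Types (J g : 'M[H]_n.+2).

Definition J1 : 'M[H]_n.+2 := (block_mx (-1)%:M 0 0 1%:M : 'M[H]_(1 + n.+1)).

Definition J2 : 'M[H]_n.+2 :=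
  (block_mx (block_mx 0 (-1)%:M (-1)%:M 0) 0 0 1%:M : 'M[H]_(1 + 1 + n)).

(* In the model J1 the first basis vector is negative, the other ones positive. *)
Definition elliptic_form J g (lam : 'rV[H]_n.+2) : Prop :=
  (forall i, qabs (lam 0 i) = 1) /\ conj_to J g J1 (diag_mx lam).

Definition regular (lam : 'rV[H]_n.+2) : Prop :=
  trivIset [set: 'I_n.+2] (fun i => sim_class (lam 0 i)).

(* [delta] and [M_lox] take the normal form as argument: their values do not
   depend on the normal form chosen for g. *)
Definition delta (lam : 'rV[H]_n.+2) : R :=
  \big[Num.max/0]_(i < n.+1)
    (qabs (lam 0 ord0 - 1) + qabs (lam 0 (lift ord0 i) - 1)).

(* [mu] lists lambda_3, lambda_4, ... *)
Definition loxodromic_form J g (l1 : H) (mu : 'rV[H]_n) : Prop :=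
  [/\ 1 < qabs l1, forall i, qabs (mu 0 i) = 1 &
      conj_to J g J2
        (diag_mx (row_mx (row_mx l1%:M ((qconj l1)^-1)%:M) mu : 'rV[H]_(1 + 1 + n)))].

Definition delta_cp (mu : 'rV[H]_n) : R :=
  \big[Num.max/0]_(i < n) qabs (mu 0 i - 1).

Definition M_lox (l1 : H) (mu : 'rV[H]_n) : R :=
  2 * delta_cp mu + qabs (l1 - 1) + qabs ((qconj l1)^-1 - 1).

Definition heisenberg_translation J g : Prop :=
  parabolic J g /\ forall a, right_eigenvalue g a -> a = 1.

Definition vnorm (zeta : 'cV[H]_n) : R := Num.sqrt (\sum_i qabs (zeta i 0) ^+ 2).

Definition heis (s : H) (zeta : 'cV[H]_n) : 'M[H]_n.+2 :=
  (block_mx (block_mx 1%:M 0 s%:M 1%:M) (col_mx 0 (adjmx zeta))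
            (row_mx zeta 0) 1%:M : 'M[H]_(1 + 1 + n)).

Definition heisenberg_form J g (s : H) (zeta : 'cV[H]_n) : Prop :=
  qre s = vnorm zeta ^+ 2 / 2 /\ conj_to J g J2 (heis s zeta).

End Models.

(* Main.v *)
From HB Require Import structures.
Require Import Defs.
From mathcomp Require Import all_boot all_order all_algebra.
From mathcomp Require Import all_classical all_reals all_analysis.
From mathcomp Require Import complex ring lra.
Set Implicit Arguments.
Unset Strict Implicit.
Unset Printing Implicit Defensive.
Import Order.TTheory GRing.Theory Num.Theory.
Import numFieldNormedType.Exports.

(* Suppose that G is Zariski dense and not discrete.  Let T be the Lie algebra
   of the closure of G, that is, the set of limits of (A - 1) / t with A in G and
   t tending to 0; it is not 0.

   First, G contains loxodromic elements arbitrarily close to 1.  It is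
   unbounded, hence contains a loxodromic A: an element whose trace has a large
   real part has an eigenvalue off the unit circle.  If no loxodromic element of
   G were close to 1, then Re tr X^2 <= 0 on T, so that an X in T with
   Re tr X^2 = 0 is orthogonal to T for the trace form.  This excludes nilpotent
   root elements from T, by brackets with their conjugates.  But such an element
   is a limit of rescaled conjugates of X by the powers of A unless X fixes both
   ends of the axis of A.  So the negative z with X z in z H for all X in T
   form a totally geodesic subspace preserved by G.  It is not empty, hence it is
   everything, and X = 0 follows.

   Secondly, there are even loxodromic h in G near 1 that move a prescribed point
   of the closed ball.  In the normal form of g, a sequence built as in
   Jorgensen's inequality then contradicts the discreteness of <g, h g h^-1>:
   - g elliptic: f_(k+1) = f_k g f_k^-1 stays bounded, hence repeats, while the
     distance from f_k(0) to 0 decreases strictly, because delta(g) < 1;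
   - g loxodromic: f_(k+1) = [f_k, g], conjugated by a dilation D commuting with
     g.  This tends to 1, M_g < 1 being the contraction factor, but f_k never
     fixes the ends of the axis of g;
   - g a Heisenberg translation: a dilation conjugates g into a neighbourhood of
     1, where f_(k+1) = [f_k, g] tends to 1 without ever fixing the fixed point
     of g. *)

(** The hypothesis concerns loxodromic [h] only, whereas the elements near 1 of a nondiscrete [G]
    might all be elliptic or parabolic; this is why the Lie algebra is needed at all. The bridge is
    the real trace: it exceeds the size [m] of the matrices only on loxodromic elements, and its
    second order term at 1 is Re tr X^2. The isotropic vectors of a semidefinite form lie in its
    radical, and from this alone, with brackets, conjugation and limits, all of T is shown to
    vanish; no exponential map and no structure theory occur. Both models are treated at once
    through [J = 1 - 2 e e^*] with a unit vector [e]; the signature enters through the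
    Cauchy-Schwarz inequality. In the loxodromic case the dilation D lies outside <g, h g h^-1>. It
    has parameter sqrt |lambda_1|, so D^2 and g differ by unit factors on the diagonal, and
    conjugation by D^(2k) can be replaced by conjugation by g^k without changing norms. *)

Local Open Scope classical_set_scope.
Local Open Scope ring_scope.

(** * Quaternions: conjugation, absolute value, real part *)

Section QuatFacts.
Variable R : realType.
Local Notation H := (quat R).
Implicit Types (x y z : H) (r : R).

Lemma quatP x y : qre x = qre y -> qi x = qi y -> qj x = qj y ->
  qk x = qk y -> x = y.
Proof. by case: x => ????; case: y => ???? /= -> -> -> ->. Qed.

Lemma qreD x y : qre (x + y) = qre x + qre y. Proof. by []. Qed.
Lemma qiD x y : qi (x + y) = qi x + qi y. Proof. by []. Qed.
Lemma qjD x y : qj (x + y) = qj x + qj y. Proof. by []. Qed.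
Lemma qkD x y : qk (x + y) = qk x + qk y. Proof. by []. Qed.
Lemma qreN x : qre (- x) = - qre x. Proof. by []. Qed.
Lemma qiN x : qi (- x) = - qi x. Proof. by []. Qed.
Lemma qjN x : qj (- x) = - qj x. Proof. by []. Qed.
Lemma qkN x : qk (- x) = - qk x. Proof. by []. Qed.
Lemma qreM x y : qre (x * y) =
  qre x * qre y - qi x * qi y - qj x * qj y - qk x * qk y.
Proof. by case: x => ????; case: y. Qed.
Lemma qiM x y : qi (x * y) =
  qre x * qi y + qi x * qre y + qj x * qk y - qk x * qj y.
Proof. by case: x => ????; case: y. Qed.
Lemma qjM x y : qj (x * y) =
  qre x * qj y - qi x * qk y + qj x * qre y + qk x * qi y.
Proof. by case: x => ????; case: y. Qed.
Lemma qkM x y : qk (x * y) =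
  qre x * qk y + qi x * qj y - qj x * qi y + qk x * qre y.
Proof. by case: x => ????; case: y. Qed.

Definition qcE := (qreD, qiD, qjD, qkD, qreN, qiN, qjN, qkN,
  qreM, qiM, qjM, qkM).

Lemma qre_zmod_morphism : zmod_morphism (@qre R). Proof. by []. Qed.
HB.instance Definition _ :=
  GRing.isZmodMorphism.Build H R (@qre R) qre_zmod_morphism.

Lemma qconj_zmod_morphism : zmod_morphism (@qconj R).
Proof. by move=> x y; apply: quatP; rewrite /= ?qcE /=; ring. Qed.
HB.instance Definition _ :=
  GRing.isZmodMorphism.Build H H (@qconj R) qconj_zmod_morphism.

Lemma qreal_zmod_morphism : zmod_morphism (@qreal R).
Proof. by move=> x y; apply: quatP; rewrite /= ?qcE /=; ring. Qed.
HB.instance Definition _ :=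
  GRing.isZmodMorphism.Build R H (@qreal R) qreal_zmod_morphism.

Lemma qconjK : involutive (@qconj R).
Proof. by move=> x; apply: quatP => /=; rewrite ?opprK. Qed.

Lemma qconjM x y : qconj (x * y) = qconj y * qconj x.
Proof. by apply: quatP; rewrite /= ?qcE /=; ring. Qed.

Lemma qrealM r s : qreal (r * s) = qreal r * qreal s.
Proof. by apply: quatP; rewrite ?qcE /=; ring. Qed.

Lemma qreal1 : qreal 1 = 1 :> H. Proof. by []. Qed.
Lemma qreal0 : qreal 0 = 0 :> H. Proof. by []. Qed.

Lemma qrealC r x : qreal r * x = x * qreal r.
Proof. by apply: quatP; rewrite ?qcE /=; ring. Qed.

Lemma qconj_real r : qconj (qreal r) = qreal r.
Proof. by apply: quatP; rewrite //= oppr0. Qed.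

Lemma qconj1 : qconj 1 = 1 :> H. Proof. exact: qconj_real. Qed.

Lemma qre_realM r x : qre (qreal r * x) = r * qre x.
Proof. by rewrite qreM /=; ring. Qed.

Lemma qreMC x y : qre (x * y) = qre (y * x).
Proof. by rewrite !qreM; ring. Qed.

Lemma qre_conj x : qre (qconj x) = qre x. Proof. by []. Qed.

Lemma qmulC x : x * qconj x = qreal (qnorm2 x).
Proof. by apply: quatP; rewrite ?qcE /qnorm2 /=; ring. Qed.

Lemma qCmul x : qconj x * x = qreal (qnorm2 x).
Proof. by apply: quatP; rewrite ?qcE /qnorm2 /=; ring. Qed.

Lemma qnorm2_ge0 x : 0 <= qnorm2 x.
Proof. by rewrite /qnorm2 !addr_ge0 ?sqr_ge0. Qed.

Lemma qnorm2M x y : qnorm2 (x * y) = qnorm2 x * qnorm2 y.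
Proof. by rewrite /qnorm2 !qcE; ring. Qed.

Lemma qabs_ge0 x : 0 <= qabs x. Proof. exact: sqrtr_ge0. Qed.

Lemma sqr_qabs x : qabs x ^+ 2 = qnorm2 x.
Proof. by rewrite sqr_sqrtr ?qnorm2_ge0. Qed.

Lemma qabsM x y : qabs (x * y) = qabs x * qabs y.
Proof. by rewrite /qabs qnorm2M sqrtrM ?qnorm2_ge0. Qed.

Lemma qabs_eq0 x : (qabs x == 0) = (x == 0).
Proof. by rewrite -qnorm2_eq0 -sqr_qabs sqrf_eq0. Qed.

Lemma qabs0 : qabs (0 : H) = 0.
Proof. by apply/eqP; rewrite qabs_eq0. Qed.

Lemma qabs_gt0 x : (0 < qabs x) = (x != 0).
Proof. by rewrite lt_def qabs_ge0 andbT qabs_eq0. Qed.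

Lemma qabsN x : qabs (- x) = qabs x.
Proof. by rewrite /qabs /qnorm2 !qcE !sqrrN. Qed.

Lemma qabs_conj x : qabs (qconj x) = qabs x.
Proof. by rewrite /qabs /qnorm2 /= !sqrrN. Qed.

Lemma qabs_real r : qabs (qreal r) = `|r|.
Proof. by rewrite /qabs /qnorm2 /= !expr0n !addr0 sqrtr_sqr. Qed.

Lemma qabs1 : qabs (1 : H) = 1.
Proof. by rewrite -qreal1 qabs_real normr1. Qed.

Lemma qcomp_le_qabs x : [/\ `|qre x| <= qabs x, `|qi x| <= qabs x,
  `|qj x| <= qabs x & `|qk x| <= qabs x].
Proof.
have le r : r ^+ 2 <= qnorm2 x -> `|r| <= qabs x.
  by move=> h; rewrite -sqrtr_sqr ler_sqrt ?qnorm2_ge0.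
have s r := sqr_ge0 (r : R).
have := (s (qre x), s (qi x), s (qj x), s (qk x)); rewrite /qnorm2 in le *.
by case=> -[[? ?] ?] ?; split; apply: le; lra.
Qed.

Lemma qre_le_qabs x : qre x <= qabs x.
Proof. by case: (qcomp_le_qabs x) => h _ _ _; exact: le_trans (ler_norm _) h. Qed.

Lemma qabsD x y : qabs (x + y) <= qabs x + qabs y.
Proof.
rewrite -(@ler_pXn2r _ 2) ?nnegrE ?addr_ge0 ?qabs_ge0 // sqrrD !sqr_qabs.
have -> : qnorm2 (x + y) = qnorm2 x + qre (x * qconj y) *+ 2 + qnorm2 y.
  by rewrite /qnorm2 !qcE /=; ring.
rewrite lerD2r lerD2l lerMn2r /=.
by rewrite -(qabs_conj y) -qabsM qre_le_qabs.
Qed.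

Lemma qabsB x y : qabs (x - y) <= qabs x + qabs y.
Proof. by rewrite -(qabsN y); exact: qabsD. Qed.

Lemma qabs_distC x y : qabs (x - y) = qabs (y - x).
Proof. by rewrite -qabsN opprB. Qed.

Lemma qabsX x m : qabs (x ^+ m) = qabs x ^+ m.
Proof. by elim: m => [|m IH]; rewrite ?expr0 ?qabs1 // !exprS qabsM IH. Qed.

Lemma qabs_le_comp x : qabs x <= `|qre x| + `|qi x| + `|qj x| + `|qk x|.
Proof.
have -> : x = qreal (qre x) + Quat 0 (qi x) 0 0 + Quat 0 0 (qj x) 0
   + Quat 0 0 0 (qk x) by apply: quatP; rewrite /= !(add0r, addr0).
apply: le_trans (qabsD _ _) _; apply: lerD; last first.
  by rewrite /qabs /qnorm2 /= !expr0n /= !add0r sqrtr_sqr.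
apply: le_trans (qabsD _ _) _; apply: lerD; last first.
  by rewrite /qabs /qnorm2 /= !expr0n /= !(add0r,addr0) sqrtr_sqr.
apply: le_trans (qabsD _ _) _; apply: lerD.
  by rewrite qabs_real /= !addr0.
by rewrite /qabs /qnorm2 /= !expr0n /= !(add0r,addr0) sqrtr_sqr.
Qed.

Lemma qmulVx x : x != 0 -> x^-1 * x = 1.
Proof. exact: qmulV. Qed.
Lemma qmulxV x : x != 0 -> x * x^-1 = 1.
Proof. exact: qdivrr. Qed.

Lemma qabsV x : x != 0 -> qabs x^-1 = (qabs x)^-1.
Proof.
move=> x0; apply: (@mulIf _ (qabs x)); first by rewrite qabs_eq0.
by rewrite -qabsM qmulVx // qabs1 mulVf ?qabs_eq0.
Qed.

Lemma qmul_eq0 x y : (x * y == 0) = (x == 0) || (y == 0).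
Proof. by rewrite -!qabs_eq0 qabsM mulf_eq0. Qed.

Lemma qconj_eq0 x : (qconj x == 0) = (x == 0).
Proof. by rewrite -!qabs_eq0 qabs_conj. Qed.

Lemma qinv_neq0 x : x != 0 -> x^-1 != 0.
Proof. by move=> x0; rewrite -qabs_eq0 qabsV // invr_eq0 qabs_eq0. Qed.

Lemma qconjV x : x != 0 -> qconj x^-1 = (qconj x)^-1.
Proof.
move=> x0.
have cx0 : qconj x != 0 by rewrite qconj_eq0.
rewrite -[LHS]mulr1 -(qmulxV cx0) mulrA -qconjM qmulxV //.
by rewrite qconj1 mul1r.
Qed.

Lemma qre_sqr0 x : qre x = 0 -> qre (x * x) = 0 -> x = 0.
Proof.
move=> x0; rewrite qreM x0 => h; apply/eqP; rewrite -qnorm2_eq0 /qnorm2 x0.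
by apply/eqP; lra.
Qed.

(** If theta is the angle between [x] and the positive real axis, the k-th power has the sign of cos
    (k theta), and for theta in [0, pi] one of k = 1, 2, 3, 4 is positive. This makes the trace of a
    power of a rank one matrix positive in [exists_lox]. *)
Lemma qre_pow_gt0 x : x != 0 -> exists2 m, (0 < m)%N & 0 < qre (x ^+ m).
Proof.
move=> x0; have N0 : 0 < qnorm2 x by rewrite lt_def qnorm2_eq0 x0 qnorm2_ge0.
have E2 : qre (x ^+ 2) = 2 * qre x ^+ 2 - qnorm2 x.
  by rewrite expr2 !qcE /qnorm2; ring.
have E3 : qre (x ^+ 3) = qre x * (4 * qre x ^+ 2 - 3 * qnorm2 x).
  by rewrite !exprS mulr1 !qcE /qnorm2; ring.
have E4 : qre (x ^+ 4) = 2 * (2 * qre x ^+ 2 - qnorm2 x) ^+ 2 - qnorm2 x ^+ 2.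
  by rewrite !exprS mulr1 !qcE /qnorm2; ring.
have [p|p|p] := ltrgtP 0 (qre x); first by exists 1%N.
  have [q|q] := ltrP 0 (qre (x ^+ 2)); first by exists 2.
  exists 3 => //; rewrite E3 nmulr_rgt0 //; rewrite E2 in q; lra.
exists 4 => //; rewrite E4 -p; nra.
Qed.

End QuatFacts.

(** * Quaternionic matrices: adjoint, real trace, norm *)

Section MatFacts.
Variable R : realType.
Local Notation H := (quat R).

Lemma adjmxE m n (A : 'M[H]_(m, n)) i j : adjmx A i j = qconj (A j i).
Proof. by rewrite /adjmx !mxE. Qed.

Lemma adjmx_zmod_morphism m n : zmod_morphism (@adjmx R m n).
Proof. by move=> A B; apply/matrixP => i j; rewrite !(adjmxE, mxE) raddfB. Qed.
HB.instance Definition _ m n :=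
  GRing.isZmodMorphism.Build 'M[H]_(m, n) 'M[H]_(n, m) (@adjmx R m n)
    (@adjmx_zmod_morphism m n).

Lemma adjmxK m n (A : 'M[H]_(m, n)) : adjmx (adjmx A) = A.
Proof. by apply/matrixP => i j; rewrite !adjmxE qconjK. Qed.

Lemma adjmxM m n p (A : 'M[H]_(m, n)) (B : 'M[H]_(n, p)) :
  adjmx (A *m B) = adjmx B *m adjmx A.
Proof.
apply/matrixP => i j; rewrite !(adjmxE, mxE) raddf_sum /=.
by apply: eq_bigr => k _; rewrite !adjmxE qconjM.
Qed.

Lemma adjmx_scalar n (a : H) : adjmx (a%:M : 'M[H]_n) = (qconj a)%:M.
Proof.
apply/matrixP => i j; rewrite !(adjmxE, mxE) eq_sym.
by case: eqP; rewrite ?raddf0.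
Qed.

Lemma adjmx1 n : adjmx (1%:M : 'M[H]_n) = 1%:M.
Proof. by rewrite adjmx_scalar qconj1. Qed.

Lemma adjmx_real m n (r : R) (A : 'M[H]_(m, n)) :
  adjmx (qreal r *: A) = qreal r *: adjmx A.
Proof.
by apply/matrixP => i j; rewrite !(adjmxE, mxE) qconjM qconj_real qrealC.
Qed.

Lemma mulmx_real m n p (r : R) (A : 'M[H]_(m, n)) (B : 'M[H]_(n, p)) :
  A *m (qreal r *: B) = qreal r *: (A *m B).
Proof.
apply/matrixP => i j; rewrite !mxE big_distrr /=; apply: eq_bigr => k _.
by rewrite !mxE !mulrA qrealC.
Qed.

Lemma scale_real_scalar m n (r : R) (A : 'M[H]_(m, n)) :
  qreal r *: A = A *m (qreal r)%:M.
Proof.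
apply/matrixP => i j; rewrite !mxE (bigD1 j) //= big1 => [|k kj].
  by rewrite !mxE eqxx addr0 qrealC.
by rewrite !mxE (negPf kj) mulr0.
Qed.

(** Over the quaternions the trace itself is neither cyclic nor invariant under conjugation; its
    real part is both. *)
Definition retr n (A : 'M[H]_n) : R := \sum_i qre (A i i).

Lemma retr_zmod_morphism n : zmod_morphism (@retr n).
Proof.
by move=> A B; rewrite /retr -sumrB; apply: eq_bigr => i _; rewrite !mxE.
Qed.
HB.instance Definition _ n :=
  GRing.isZmodMorphism.Build 'M[H]_n R (@retr n) (@retr_zmod_morphism n).

Lemma retrC m n (A : 'M[H]_(m, n)) (B : 'M[H]_(n, m)) :
  retr (A *m B) = retr (B *m A).
Proof.
rewrite /retr; under eq_bigr do rewrite mxE raddf_sum.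
rewrite exchange_big /=; apply: eq_bigr => i _.
by rewrite mxE raddf_sum; apply: eq_bigr => j _; rewrite qreMC.
Qed.

Lemma retr_real n (r : R) (A : 'M[H]_n) : retr (qreal r *: A) = r * retr A.
Proof.
by rewrite /retr big_distrr; apply: eq_bigr => i _; rewrite mxE qre_realM.
Qed.

Lemma retr_adj n (A : 'M[H]_n) : retr (adjmx A) = retr A.
Proof. by apply: eq_bigr => i _; rewrite adjmxE. Qed.

Lemma retr1 n : retr (1%:M : 'M[H]_n) = n%:R.
Proof.
rewrite /retr (eq_bigr (fun _ => 1)) ?sumr_const ?card_ord // => i _.
by rewrite mxE eqxx.
Qed.

(** This norm is submultiplicative, invariant under [adjmx] and estimated entry by entry, as the
    loxodromic case requires. The identity has norm its size, not 1. *)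
Definition nrm m n (A : 'M[H]_(m, n)) : R := \sum_i \sum_j qabs (A i j).

Lemma nrm_ge0 m n (A : 'M[H]_(m, n)) : 0 <= nrm A.
Proof. by do 2![apply: sumr_ge0 => ? _]; exact: qabs_ge0. Qed.

Lemma qabs_le_nrm m n (A : 'M[H]_(m, n)) i j : qabs (A i j) <= nrm A.
Proof.
rewrite /nrm (bigD1 i) //= (bigD1 j) //= -addrA lerDl addr_ge0 //.
  by apply: sumr_ge0 => ? _; exact: qabs_ge0.
by do 2![apply: sumr_ge0 => ? _]; exact: qabs_ge0.
Qed.

Lemma nrm_eq0 m n (A : 'M[H]_(m, n)) : (nrm A == 0) = (A == 0).
Proof.
apply/eqP/eqP => [A0|->]; last first.
  by rewrite /nrm big1 // => i _; rewrite big1 // => j _; rewrite mxE qabs0.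
apply/matrixP => i j; rewrite mxE; apply/eqP; rewrite -qabs_eq0.
by rewrite eq_le qabs_ge0 andbT -A0 qabs_le_nrm.
Qed.

Lemma nrm0 m n : nrm (0 : 'M[H]_(m, n)) = 0.
Proof. by apply/eqP; rewrite nrm_eq0. Qed.

Lemma nrm_gt0 m n (A : 'M[H]_(m, n)) : (0 < nrm A) = (A != 0).
Proof. by rewrite lt_def nrm_ge0 andbT nrm_eq0. Qed.

Lemma nrmD m n (A B : 'M[H]_(m, n)) : nrm (A + B) <= nrm A + nrm B.
Proof.
rewrite -big_split; apply: ler_sum => i _; rewrite -big_split.
by apply: ler_sum => j _; rewrite mxE qabsD.
Qed.

Lemma nrmN m n (A : 'M[H]_(m, n)) : nrm (- A) = nrm A.
Proof. by do 2![apply: eq_bigr => ? _]; rewrite mxE qabsN. Qed.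

Lemma nrmB m n (A B : 'M[H]_(m, n)) : nrm (A - B) <= nrm A + nrm B.
Proof. by rewrite -(nrmN B); exact: nrmD. Qed.

Lemma nrm_distC m n (A B : 'M[H]_(m, n)) : nrm (A - B) = nrm (B - A).
Proof. by rewrite -nrmN opprB. Qed.

Lemma nrm_real m n (r : R) (A : 'M[H]_(m, n)) :
  nrm (qreal r *: A) = `|r| * nrm A.
Proof.
rewrite /nrm big_distrr; apply: eq_bigr => i _; rewrite big_distrr.
by apply: eq_bigr => j _; rewrite mxE qabsM qabs_real.
Qed.

Lemma qabs_sum (I : finType) (P : pred I) (F : I -> H) :
  qabs (\sum_(i | P i) F i) <= \sum_(i | P i) qabs (F i).
Proof.
elim/big_ind2: _ => [|x a y b xa yb|//]; first by rewrite qabs0.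
by apply: le_trans (qabsD _ _) _; exact: lerD.
Qed.

Lemma nrmM m n p (A : 'M[H]_(m, n)) (B : 'M[H]_(n, p)) :
  nrm (A *m B) <= nrm A * nrm B.
Proof.
rewrite /nrm big_distrl; apply: ler_sum => i _ /=.
apply: (@le_trans _ _ (\sum_j \sum_k qabs (A i k) * qabs (B k j))).
  apply: ler_sum => j _; rewrite mxE; apply: le_trans (qabs_sum _ _) _.
  by apply: ler_sum => k _; rewrite qabsM.
rewrite exchange_big big_distrl; apply: ler_sum => k _ /=.
rewrite -big_distrr ler_wpM2l ?qabs_ge0 //.
rewrite [leRHS](bigD1 k) //= lerDl; do 2![apply: sumr_ge0 => ? _].
exact: qabs_ge0.
Qed.

Lemma nrm_adj m n (A : 'M[H]_(m, n)) : nrm (adjmx A) = nrm A.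
Proof.
rewrite /nrm exchange_big; apply: eq_bigr => i _; apply: eq_bigr => j _.
by rewrite adjmxE qabs_conj.
Qed.

Lemma retr_le_nrm n (A : 'M[H]_n) : `|retr A| <= nrm A.
Proof.
apply: le_trans (ler_norm_sum _ _ _) _; apply: ler_sum => i _.
rewrite (bigD1 i) //=; case: (qcomp_le_qabs (A i i)) => h _ _ _.
by rewrite (le_trans h) // lerDl sumr_ge0 // => ? _; exact: qabs_ge0.
Qed.

End MatFacts.

(** * Convergence of matrices along filters and ultrafilters *)

Section Limits.
Variable R : realType.
Local Notation H := (quat R).

(** An arbitrary set system is allowed, because limits are taken along sequences, along ultrafilters
    on the naturals and for a real parameter tending to 0 from the right. *)
Definition mcvg (K : Type) (F : set_system K) m n (f : K -> 'M[H]_(m, n))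
  (L : 'M[H]_(m, n)) := forall e : R, 0 < e -> \forall k \near F, nrm (f k - L) < e.

Section Fixed.
Context (K : Type) (F : set_system K) {FF : ProperFilter F}.

Lemma mcvg_cst m n (L : 'M[H]_(m, n)) : mcvg F (fun=> L) L.
Proof. by move=> e e0; near=> k; rewrite subrr nrm0. Unshelve. all: end_near. Qed.

Lemma mcvg_eq m n (f g : K -> 'M[H]_(m, n)) L :
  (\forall k \near F, f k = g k) -> mcvg F f L -> mcvg F g L.
Proof.
by move=> fg fL e /fL; apply: filterS2 fg => k ->.
Qed.

Lemma mcvg_ext m n (f g : K -> 'M[H]_(m, n)) L : f =1 g -> mcvg F f L -> mcvg F g L.
Proof. by move=> /funext ->. Qed.

Lemma mcvgD m n (f g : K -> 'M[H]_(m, n)) L M :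
  mcvg F f L -> mcvg F g M -> mcvg F (fun k => f k + g k) (L + M).
Proof.
move=> fL gM e e0; have e2 : 0 < e / 2 by rewrite divr_gt0.
apply: filterS2 (fL _ e2) (gM _ e2) => k h1 h2.
by rewrite opprD addrACA (le_lt_trans (nrmD _ _)) // [e]splitr ltrD.
Qed.

Lemma mcvgN m n (f : K -> 'M[H]_(m, n)) L : mcvg F f L -> mcvg F (fun k => - f k) (- L).
Proof.
by move=> fL e /fL; apply: filterS => k; rewrite -opprD nrmN.
Qed.

Lemma mcvgB m n (f g : K -> 'M[H]_(m, n)) L M :
  mcvg F f L -> mcvg F g M -> mcvg F (fun k => f k - g k) (L - M).
Proof. by move=> fL /mcvgN; exact: mcvgD. Qed.

Lemma mcvg_adj m n (f : K -> 'M[H]_(m, n)) L :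
  mcvg F f L -> mcvg F (fun k => adjmx (f k)) (adjmx L).
Proof.
by move=> fL e /fL; apply: filterS => k; rewrite -raddfB nrm_adj.
Qed.

Lemma mcvg_bounded m n (f : K -> 'M[H]_(m, n)) L :
  mcvg F f L -> \forall k \near F, nrm (f k) < nrm L + 1.
Proof.
move=> /(_ 1 ltr01); apply: filterS => k h; rewrite -[f k](subrK L) addrC.
by rewrite addrC (le_lt_trans (nrmD _ _)) // addrC ltrD2l.
Qed.

Lemma mcvg_to0_mul m n p (f : K -> 'M[H]_(m, n)) (g : K -> 'M[H]_(n, p)) (C : R) :
  mcvg F f 0 -> (\forall k \near F, nrm (g k) <= C) ->
  mcvg F (fun k => f k *m g k) 0.
Proof.
move=> f0 gC e e0; have C1 : 0 < `|C| + 1 by rewrite ltr_wpDl.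
have e1 : 0 < e / (`|C| + 1) by rewrite divr_gt0.
apply: filterS2 (f0 _ e1) gC => k; rewrite !subr0 => h1 h2.
apply: le_lt_trans (nrmM _ _) _; rewrite ltr_pdivlMr // in h1.
apply: le_lt_trans h1; rewrite ler_wpM2l ?nrm_ge0 // (le_trans h2) //.
by rewrite (le_trans (ler_norm C)) // lerDl.
Qed.

(** Taking adjoints exchanges the two factors and reduces this to [mcvg_to0_mul]. *)
Lemma mcvg_mul_to0 m n p (f : K -> 'M[H]_(m, n)) (g : K -> 'M[H]_(n, p)) (C : R) :
  (\forall k \near F, nrm (f k) <= C) -> mcvg F g 0 ->
  mcvg F (fun k => f k *m g k) 0.
Proof.
move=> fC g0; have fC' : \forall k \near F, nrm (adjmx (f k)) <= C.
  by apply: filterS fC => k; rewrite nrm_adj.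
have g0' : mcvg F (fun k => adjmx (g k)) 0 by rewrite -[0](raddf0 (@adjmx R n p)); exact: mcvg_adj.
have := mcvg_adj (mcvg_to0_mul g0' fC'); rewrite raddf0.
by apply: mcvg_ext => k; rewrite adjmxM !adjmxK.
Qed.

Lemma mcvg_sub0 m n (f : K -> 'M[H]_(m, n)) L :
  mcvg F f L <-> mcvg F (fun k => f k - L) 0.
Proof.
by split=> h e /h; apply: filterS => k; rewrite subr0.
Qed.

Lemma mcvgM m n p (f : K -> 'M[H]_(m, n)) (g : K -> 'M[H]_(n, p)) L M :
  mcvg F f L -> mcvg F g M -> mcvg F (fun k => f k *m g k) (L *m M).
Proof.
move=> fL gM; apply/mcvg_sub0.
have h1 : mcvg F (fun k => (f k - L) *m g k) 0.
  apply: (@mcvg_to0_mul _ _ _ _ _ (nrm M + 1)); first exact: (mcvg_sub0 f L).1.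
  by apply: filterS (mcvg_bounded gM) => k /ltW.
have h2 : mcvg F (fun k => L *m (g k - M)) 0.
  apply: (@mcvg_mul_to0 _ _ _ _ _ (nrm L)); first exact: nearW.
  exact: (mcvg_sub0 g M).1.
have := mcvgD h1 h2; rewrite addr0; apply: mcvg_ext => k.
by rewrite mulmxBl mulmxBr addrA subrK.
Qed.

Lemma mcvg_unique m n (f : K -> 'M[H]_(m, n)) L M :
  mcvg F f L -> mcvg F f M -> L = M.
Proof.
move=> fL fM; apply/eqP; rewrite -subr_eq0 -nrm_eq0 eq_le nrm_ge0 andbT.
apply/ler_addgt0Pr => e e0; rewrite add0r.
have e2 : 0 < e / 2 by rewrite divr_gt0.
have [k [h1 h2]] := filter_ex (filterI (fL _ e2) (fM _ e2)).
rewrite nrm_distC in h1.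
have -> : L - M = (L - f k) + (f k - M) by rewrite addrA subrK.
by rewrite (le_trans (nrmD _ _)) // [e]splitr lerD // ltW.
Qed.

Lemma mcvg_nrm_le m n (f : K -> 'M[H]_(m, n)) L (C : R) :
  mcvg F f L -> (\forall k \near F, nrm (f k) <= C) -> nrm L <= C.
Proof.
move=> fL fC; apply/ler_addgt0Pr => e e0.
have [k [h1 h2]] := filter_ex (filterI (fL _ e0) fC).
rewrite -(subrK (f k) L) addrC (le_trans (nrmD _ _)) // lerD //.
by rewrite nrm_distC ltW.
Qed.

Lemma mcvg_nrm_ge m n (f : K -> 'M[H]_(m, n)) L (C : R) :
  mcvg F f L -> (\forall k \near F, C <= nrm (f k)) -> C <= nrm L.
Proof.
move=> fL fC; apply/ler_addgt0Pr => e e0.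
have [k [h1 h2]] := filter_ex (filterI (fL _ e0) fC).
rewrite (le_trans h2) // -[in leLHS](subrK L (f k)) addrC (le_trans (nrmD _ _)) //.
by rewrite lerD // ltW.
Qed.

Lemma mcvg_retr_le n (f : K -> 'M[H]_n) L (C : R) :
  mcvg F f L -> (\forall k \near F, retr (f k) <= C) -> retr L <= C.
Proof.
move=> fL fC; apply/ler_addgt0Pr => e e0.
have [k [h1 h2]] := filter_ex (filterI (fL _ e0) fC).
have := retr_le_nrm (f k - L); rewrite raddfB /= => h.
have := le_lt_trans h h1; rewrite ltr_norml => /andP[]; lra.
Qed.

Lemma mcvg_to0 m n (f : K -> 'M[H]_(m, n)) (u : K -> R) :
  (forall e, 0 < e -> \forall k \near F, u k < e) ->
  (\forall k \near F, nrm (f k) <= u k) -> mcvg F f 0.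
Proof.
move=> u0 fu e /u0; apply: filterS2 fu => k; rewrite subr0; exact: le_lt_trans.
Qed.

End Fixed.

Lemma mcvg_comp (K K' : Type) (F : set_system K) (F' : set_system K')
    (h : K' -> K) m n (f : K -> 'M[H]_(m, n)) L :
  (forall A, F A -> F' (h @^-1` A)) -> mcvg F f L -> mcvg F' (f \o h) L.
Proof. by move=> hF fL e /fL /hF. Qed.

Lemma ultra_or (K : Type) (U : set_system K) (A : set K) :
  UltraFilter U -> U A \/ U (~` A).
Proof. by move=> UU; exact: in_ultra_setVsetC. Qed.

(** The image of an ultrafilter is an ultrafilter, and on a compact interval it converges.
    Compactness in this form replaces the extraction of subsequences. *)
Lemma ultra_real (K : Type) (U : set_system K) (f : K -> R) (C : R) :
  UltraFilter U -> (\forall k \near U, `|f k| <= C) ->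
  exists l : R, forall e, 0 < e -> \forall k \near U, `|f k - l| < e.
Proof.
move=> UU fC; have PF := @ultra_proper _ _ UU.
have fU : UltraFilter (f @ U).
  split; first exact: fmap_proper_filter.
  move=> G GP sG; apply/seteqP; split=> [A GA|//].
  have [//|UA] := ultra_or (f @^-1` A) UU.
  have : G (A `&` ~` A) by apply: filterI => //; apply: sG.
  by rewrite setICr => /filter_not_empty.
have := @segment_compact R (- C) C; rewrite compact_ultra => /(_ _ fU).
case=> [|l [_ /= fl]].
  by apply: filterS fC => k /=; rewrite in_itv /= ler_norml.
exists l => e e0; have h : U (f @^-1` ball (l : R) e) by apply: (fl _ (nbhsx_ballx l e e0)).
by apply: filterS h => k /=; rewrite /ball /= distrC.
Qed.

Lemma ultra_cvg (K : Type) (U : set_system K) m n (f : K -> 'M[H]_(m, n)) (C : R) :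
  UltraFilter U -> (\forall k \near U, nrm (f k) <= C) -> exists L, mcvg U f L.
Proof.
move=> UU fC; have PF := @ultra_proper _ _ UU.
have lims (c : H -> R) : (forall x, `|c x| <= qabs x) ->
  forall i j, exists l : R, forall e, 0 < e ->
    \forall k \near U, `|c (f k i j) - l| < e.
  move=> cq i j; apply: (@ultra_real _ _ _ C UU); apply: filterS fC => k h.
  by rewrite (le_trans (cq _)) // (le_trans _ h) // qabs_le_nrm.
have q x := qcomp_le_qabs (x : H).
have /choice[la] : forall ij : 'I_m * 'I_n, exists a, forall e, 0 < e ->
    \forall k \near U, `|qre (f k ij.1 ij.2) - a| < e.
  by move=> ij; apply: lims => x; case: (q x).
have /choice[lb] : forall ij : 'I_m * 'I_n, exists a, forall e, 0 < e ->
    \forall k \near U, `|qi (f k ij.1 ij.2) - a| < e.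
  by move=> ij; apply: lims => x; case: (q x).
have /choice[lc] : forall ij : 'I_m * 'I_n, exists a, forall e, 0 < e ->
    \forall k \near U, `|qj (f k ij.1 ij.2) - a| < e.
  by move=> ij; apply: lims => x; case: (q x).
have /choice[ld] : forall ij : 'I_m * 'I_n, exists a, forall e, 0 < e ->
    \forall k \near U, `|qk (f k ij.1 ij.2) - a| < e.
  by move=> ij; apply: lims => x; case: (q x).
move=> hd hc hb ha.
exists (\matrix_(i, j) Quat (la (i, j)) (lb (i, j)) (lc (i, j)) (ld (i, j))).
(* The error [e] is shared by the four components of all entries; the summand 1 keeps [M] positive
   and the last inequality strict. *)
move=> e e0; pose M : R := (m * n)%:R + 1.
have M0 : 0 < M by rewrite ltr_wpDl.
pose d := e / M / 4; have d0 : 0 < d by rewrite !divr_gt0.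
have near_ij : \forall k \near U, forall ij : 'I_m * 'I_n,
   qabs (f k ij.1 ij.2 - Quat (la ij) (lb ij) (lc ij) (ld ij)) <= e / M.
  apply: filter_forall => -[i j] /=.
  have := filterI (filterI (ha (i, j) _ d0) (hb (i, j) _ d0))
     (filterI (hc (i, j) _ d0) (hd (i, j) _ d0)).
  move=> h; apply: filterS (h _ _ _) => k /= [[h1 h2] [h3 h4]].
  apply: le_trans (qabs_le_comp _) _; rewrite /= ?qcE /=.
  have -> : e / M = d + d + d + d by rewrite /d; field; rewrite gt_eqF.
  by rewrite !lerD // ltW.
apply: filterS near_ij => k h; rewrite /nrm.
apply: (@le_lt_trans _ _ (\sum_(i < m) \sum_(j < n) (e / M))).
  by do 2![apply: ler_sum => ? _]; rewrite !mxE; exact: (h (_, _)).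
rewrite sumr_const card_ord sumr_const card_ord -mulrnA -mulr_natl mulrA.
rewrite ltr_pdivrMr // mulrC ltr_pM2l // mulnC /M; lra.
Qed.

Lemma nat_ultra : exists U : set_system nat, UltraFilter U /\
  forall N, \forall k \near U, (N <= k)%N.
Proof.
have [U [UU sU]] := ultraFilterLemma (eventually_filter).
exists U; split=> // N; apply: sU; exact: nbhs_infty_ge.
Qed.

End Limits.

(** * Eigenvalues of a quaternionic matrix with large real trace *)

Section Eigen.
Variable R : realType.
Local Notation H := (quat R).
Local Notation C := (R[i]).

Lemma eigen_Re_gt m (M : 'M[C]_m) (r : R) : (0 < m)%N ->
  m%:R * r < complex.Re (\tr M) ->
  exists l : C, r < complex.Re l /\ exists2 v : 'rV[C]_m, v != 0 & v *m M = l *: v.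
Proof.
move=> m0 trM; have [rs Ers] := closed_field_poly_normal (char_poly M).
rewrite (monicP (char_poly_monic M)) scale1r in Ers.
have sz : size rs = m.
  by have := size_char_poly M; rewrite Ers size_prod_XsubC => -[].
have tr_rs : \tr M = \sum_(z <- rs) z.
  apply: oppr_inj; rewrite -char_poly_trace // Ers -{1}sz.
  by rewrite coefPn_prod_XsubC // sz -lt0n.
have [l lrs lr] : exists2 l, l \in rs & r < complex.Re l.
  apply: contrapT => h; suff: complex.Re (\tr M) <= m%:R * r by lra.
  have {}h l : l \in rs -> complex.Re l <= r.
    by move=> lrs; rewrite leNgt; apply/negP => ?; apply: h; exists l.
  rewrite tr_rs raddf_sum -sz big_seq (le_trans (ler_sum _ h)) //.
  by rewrite -big_seq big_const_seq count_predT iter_addr_0 mulr_natl.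
exists l; split => //; have : eigenvalue M l.
  by rewrite eigenvalue_root_char Ers root_prod_XsubC.
by case/eigenvalueP => v vM v0; exists v.
Qed.

(* A quaternion is written p + j q with p, q complex; left multiplication by a
   quaternionic matrix is then C-linear for the right action of C. *)
Definition qC (p q : C) : H :=
  Quat (complex.Re p) (complex.Im p) (complex.Re q) (- complex.Im q).
Definition Cp (x : H) : C := Complex (qre x) (qi x).
Definition Cq (x : H) : C := Complex (qj x) (- qk x).

Lemma qC_mul x u w :
  x * qC u w = qC (Cp x * u - conjc (Cq x) * w) (Cq x * u + conjc (Cp x) * w).
Proof.
by case: u w => [a b] [c d]; apply: quatP; rewrite ?qcE /=; ring.
Qed.

Lemma qC_mulr u w l : qC u w * qC l 0 = qC (l * u) (l * w).
Proof.
by case: u w l => [a b] [c d] [e f]; apply: quatP; rewrite ?qcE /=; ring.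
Qed.

Lemma qCD u w u' w' : qC (u + u') (w + w') = qC u w + qC u' w'.
Proof.
case: u w u' w' => [a b] [c d] [a' b'] [c' d'].
by apply: quatP; rewrite ?qcE //=; ring.
Qed.

Lemma qC_eq0 u w : qC u w = 0 -> u = 0 /\ w = 0.
Proof.
case: u w => [a b] [c d]; rewrite /qC /= => -[-> -> -> /eqP].
by rewrite oppr_eq0 => /eqP ->.
Qed.

Lemma qC_sum (I : Type) (s : seq I) (a b : I -> C) :
  \sum_(i <- s) qC (a i) (b i) = qC (\sum_(i <- s) a i) (\sum_(i <- s) b i).
Proof.
elim: s => [|i s IH]; last by rewrite !big_cons IH qCD.
by rewrite !big_nil; apply: quatP => //=; rewrite oppr0.
Qed.

(** Seen as a complex matrix of size [m + m], [A] has a trace of real part [2 * retr A], more than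
    the size; so some eigenvalue has real part, hence modulus, above 1. *)
Lemma retr_eigen m (A : 'M[H]_m) : (0 < m)%N -> m%:R < retr A ->
  exists z : 'cV[H]_m, exists l : H, [/\ z != 0, A *m z = z *m l%:M & 1 < qabs l].
Proof.
move=> m0 trA; pose P := map_mx Cp A; pose Q := map_mx Cq A.
(* The transpose of the complex matrix of [A] in the coordinates of [qC]: [eigenvalueP] provides row
   eigenvectors. *)
pose M : 'M[C]_(m + m) := block_mx P^T Q^T (- (map_mx (@conjc R) Q)^T) (map_mx (@conjc R) P)^T.
have trM : complex.Re (\tr M) = 2 * retr A.
  rewrite mxtrace_block raddfD /= /mxtrace !raddf_sum /retr mulr_natl mulr2n.
  by congr (_ + _); apply: eq_bigr => i _; rewrite !mxE.
have [||l [lr [v v0 vM]]] := @eigen_Re_gt _ M 1; first by rewrite addn_gt0 m0.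
  by rewrite trM mulr1 natrD; lra.
move: v0 vM; rewrite -(hsubmxK v); move: (lsubmx v) (rsubmx v) => u w v0.
rewrite mul_row_block scale_row_mx => vM.
have [/rowP uE /rowP wE] := eq_row_mx vM.
exists (\col_i qC (u 0 i) (w 0 i)), (qC l 0); split.
- apply: contraNneq v0 => /matrixP z0.
  have uw i : u 0 i = 0 /\ w 0 i = 0.
    by have := z0 i 0; rewrite !mxE => /qC_eq0.
  have u0 : u = 0 by apply/rowP => i; rewrite [RHS]mxE; case: (uw i).
  have w0 : w = 0 by apply/rowP => i; rewrite [RHS]mxE; case: (uw i).
  by rewrite u0 w0 row_mx0.
- apply/matrixP => i j; rewrite !mxE big_ord1 !mxE !ord1 eqxx mulr1n qC_mulr.
  have := uE i; have := wE i; rewrite !mxE => <- <-.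
  rewrite (eq_bigr (fun k => qC (Cp (A i k) * u 0 k - conjc (Cq (A i k)) * w 0 k)
     (Cq (A i k) * u 0 k + conjc (Cp (A i k)) * w 0 k))); last first.
    by move=> k _; rewrite !mxE qC_mul.
  rewrite qC_sum; congr qC; rewrite big_split /= ?sumrN; congr (_ + _);
    rewrite -?sumrN; apply: eq_bigr => k _; rewrite !mxE ?mulrN; by rewrite mulrC.
- have := qcomp_le_qabs (qC l 0); case=> h _ _ _.
  by rewrite (lt_le_trans lr) // (le_trans _ h) //= ler_norm.
Qed.

End Eigen.

Notation "z *v a" := (z *m a%:M) (at level 40, left associativity).

Lemma qnorm2N (R : realType) (x : quat R) : qnorm2 (- x) = qnorm2 x.
Proof. by rewrite /qnorm2 !qcE !sqrrN. Qed.

Lemma qnorm2_conj (R : realType) (x : quat R) : qnorm2 (qconj x) = qnorm2 x.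
Proof. by rewrite /qnorm2 /= !sqrrN. Qed.

Lemma form_def (R : realType) m (J : 'M[quat R]_m) z w :
  Defs.form J z w = (adjmx z *m J *m w) 0 0.
Proof. by []. Qed.

(* Unifying two values of the form would otherwise unfold matrix products. *)
Opaque Defs.form.

(** * Hermitian forms on right quaternionic spaces *)

Section Hermitian.
Variables (R : realType) (m : nat) (J : 'M[quat R]_m).
Hypothesis Jherm : adjmx J = J.
Local Notation H := (quat R).
Implicit Types (x y z w : 'cV[H]_m) (a b c : H) (r : R).
Local Notation form := (Defs.form J).

Lemma smulA (z : 'cV[H]_m) a b : z *v a *v b = z *v (a * b).
Proof. by rewrite -mulmxA -scalar_mxM. Qed.

Lemma smulE z a i j : (z *v a) i j = z i j * a.
Proof. by rewrite mxE big_ord1 mxE !ord1 eqxx mulr1n. Qed.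

Lemma smul1 z : z *v 1 = z. Proof. exact: mulmx1. Qed.
Lemma smul0 z : z *v 0 = 0. Proof. by rewrite raddf0 mulmx0. Qed.

Lemma smul_eq0 z a : (z *v a == 0) = (z == 0) || (a == 0).
Proof.
have [->|a0] := eqVneq a 0; first by rewrite smul0 eqxx orbT.
rewrite orbF; apply/eqP/eqP => [h|->]; last exact: mul0mx.
by rewrite -(smul1 z) -(qmulxV a0) -smulA h mul0mx.
Qed.

Lemma smulDr z a b : z *v (a + b) = z *v a + z *v b.
Proof. by rewrite raddfD mulmxDr. Qed.
Lemma smulNr z a : z *v (- a) = - (z *v a).
Proof. by rewrite raddfN mulmxN. Qed.
Lemma smul_cancel z a b : z != 0 -> z *v a = z *v b -> a = b.
Proof.
move=> z0 /eqP; rewrite -subr_eq0 -smulNr -smulDr smul_eq0 (negPf z0) /=.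
by rewrite subr_eq0 => /eqP.
Qed.

Lemma form_mx z w : adjmx z *m J *m w = (form z w)%:M.
Proof. by rewrite form_def; exact: mx11_scalar. Qed.

Lemma formDr z x y : form z (x + y) = form z x + form z y.
Proof. by rewrite !form_def mulmxDr mxE. Qed.
Lemma formNr z x : form z (- x) = - form z x.
Proof. by rewrite !form_def mulmxN mxE. Qed.
Lemma formBr z x y : form z (x - y) = form z x - form z y.
Proof. by rewrite formDr formNr. Qed.
Lemma form0r z : form z 0 = 0.
Proof. by rewrite !form_def mulmx0 mxE. Qed.
Lemma formZr z x a : form z (x *v a) = form z x * a.
Proof. by rewrite !form_def mulmxA mxE big_ord1 [a%:M _ _]mxE eqxx mulr1n. Qed.
Lemma formC z w : form w z = qconj (form z w).
Proof.
rewrite !form_def -[in RHS]Jherm -{2}(adjmxK w) -!adjmxM adjmxE mulmxA.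
by rewrite qconjK.
Qed.
Lemma formDl z x y : form (x + y) z = form x z + form y z.
Proof. by rewrite !form_def raddfD /= !mulmxDl mxE. Qed.
Lemma formNl z x : form (- x) z = - form x z.
Proof. by rewrite !form_def raddfN /= !mulNmx mxE. Qed.
Lemma formBl z x y : form (x - y) z = form x z - form y z.
Proof. by rewrite formDl formNl. Qed.
Lemma form0l z : form 0 z = 0.
Proof. by rewrite formC form0r raddf0. Qed.
Lemma formZl z x a : form (x *v a) z = qconj a * form x z.
Proof. by rewrite formC formZr qconjM -formC. Qed.

Lemma form_eq0C z w : form z w = 0 -> form w z = 0.
Proof. by move=> h; rewrite formC h raddf0. Qed.

Lemma form_diag z : form z z = qreal (qre (form z z)).
Proof.
have := formC z z; case: (form z z) => a b c d [] hb hc hd.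
by apply: quatP => //=; lra.
Qed.

Lemma formZZ z a : qre (form (z *v a) (z *v a)) = qnorm2 a * qre (form z z).
Proof.
by rewrite formZr formZl form_diag -mulrA qrealC mulrA qCmul -qrealM.
Qed.

Lemma form_sqr_sub z y r : qre (form (y - z *v (form z y * qreal r)) (y - z *v (form z y * qreal r))) =
  qre (form y y) - 2 * r * qnorm2 (form z y) + r ^+ 2 * qnorm2 (form z y) * qre (form z z).
Proof.
rewrite formBl !formBr !formZl !formZr; set c := form z y; rewrite (formC z y) -/c qconjM qconj_real.
rewrite [form z z]form_diag; set Z := qre (form z z); set Y := form y y.
have -> : qconj c * (c * qreal r) = qreal (qnorm2 c * r).
  by rewrite mulrA qCmul qrealM.
have -> : qreal r * qconj c * c = qreal (qnorm2 c * r).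
  by rewrite -mulrA qCmul -qrealM mulrC.
have -> : qreal r * qconj c * (qreal Z * (c * qreal r)) = qreal (r ^+ 2 * qnorm2 c * Z).
  rewrite (qrealC Z) -!mulrA (mulrA (qconj c)) qCmul -!qrealM; congr qreal; ring.
by rewrite !raddfB /= raddfN /=; ring.
Qed.

(** Positivity is assumed on the span of [z] and [y] only, because the ambient form is indefinite;
    the lemma is applied to the Euclidean form and inside the complement of a negative vector. *)
Lemma cauchy_schwarz z y :
  (forall a b, 0 <= qre (form (z *v a + y *v b) (z *v a + y *v b))) ->
  qnorm2 (form z y) <= qre (form z z) * qre (form y y).
Proof.
move=> pos; have Z0 : 0 <= qre (form z z).
  by have := pos 1 0; rewrite smul1 smul0 addr0.
have P t : 0 <= qre (form y y) - 2 * t * qnorm2 (form z y) +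
    t ^+ 2 * qnorm2 (form z y) * qre (form z z).
  have := pos (- (form z y * qreal t)) 1; rewrite smul1 smulNr addrC.
  by rewrite form_sqr_sub.
have c0 := qnorm2_ge0 (form z y); have Y0 := P 0.
set c := qnorm2 _ in P c0 Y0 *; set Z := qre (form z z) in P Z0 *.
set Y := qre (form y y) in P Y0 *.
have [Z1|Z1] := eqVneq Z 0; last first.
  have := P Z^-1; have -> : Y - 2 * Z^-1 * c + Z^-1 ^+ 2 * c * Z = (Z * Y - c) / Z.
    by field.
  have Zp : 0 < Z by rewrite lt_def Z1.
  by rewrite pmulr_lge0 ?invr_gt0 // subr_ge0.
(* For a null [z] the quadratic polynomial in [t] degenerates to [Y - 2 * t * c], which is negative
   at this value. *)
rewrite Z1 mul0r leNgt; apply/negP => cp; have := P ((Y + 1) / c).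
rewrite Z1 mulr0 addr0 (_ : _ * c = 2 * (Y + 1)); last by field; rewrite gt_eqF.
lra.
Qed.

End Hermitian.

(** * Lorentzian forms given by reflections *)

Section Lorentz.
Variables (R : realType) (m : nat).
Local Notation H := (quat R).

(** A reflection in a unit vector: the first basis vector for [J1], the normalized sum of the first
    two for [J2]. The form is minus the square along [e] and Euclidean across it. *)
Definition lorentz (J : 'M[H]_m) := exists e : 'cV[H]_m,
  adjmx e *m e = 1%:M /\ J = 1%:M - qreal 2 *: (e *m adjmx e).

Variable J : 'M[H]_m.
Hypothesis HJ : lorentz J.
Implicit Types (x y z w p q : 'cV[H]_m) (a b c : H) (r : R).
Local Notation form := (Defs.form J).

Lemma lorentz_adj : adjmx J = J.
Proof.
case: HJ => e [_ ->]; rewrite raddfB /= adjmx1 adjmx_real.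
by rewrite adjmxM adjmxK.
Qed.

Lemma lorentz_sqr : J *m J = 1%:M.
Proof.
case: HJ => e [ee ->]; set S := qreal 2 *: _.
have SS : S *m S = S + S.
  rewrite /S -scalemxAl mulmx_real mulmxA -(mulmxA e) ee mulmx1 scalerA.
  by rewrite -qrealM (_ : 2 * 2 = 2 + 2) ?[qreal (2 + 2)]raddfD ?scalerDl //; ring.
by rewrite mulmxBr mulmx1 mulmxBl mul1mx SS opprB addrK subrK.
Qed.

Let Jh := lorentz_adj.

Definition vn2 (z : 'cV[H]_m) : R := \sum_i qnorm2 (z i 0).

Lemma form1E z w : Defs.form 1%:M z w = \sum_i qconj (z i 0) * w i 0.
Proof.
by rewrite !form_def mulmx1 mxE; apply: eq_bigr => i _; rewrite adjmxE.
Qed.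

Lemma vn2E z : qre (Defs.form 1%:M z z) = vn2 z.
Proof. by rewrite form1E raddf_sum; apply: eq_bigr => i _; rewrite /= qCmul. Qed.

Lemma vn2_ge0 z : 0 <= vn2 z.
Proof. by apply: sumr_ge0 => i _; exact: qnorm2_ge0. Qed.

Lemma vn2_eq0 z : vn2 z = 0 -> z = 0.
Proof.
move=> /eqP; rewrite psumr_eq0 => [/allP h|i _]; last exact: qnorm2_ge0.
apply/matrixP => i j; rewrite ord1 mxE; apply/eqP; rewrite -qnorm2_eq0.
by apply: (implyP (h i _)) => //; rewrite mem_index_enum.
Qed.

Lemma form_spec : exists e : 'cV[H]_m, [/\ qre (form e e) = -1,
   forall z, form e z = - Defs.form 1%:M e z,
   forall z, qre (form z z) + 2 * qnorm2 (form e z) = vn2 z &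
   forall z w, form z w = Defs.form 1%:M z w - qreal 2 * (qconj (form e z) * form e w)].
Proof.
case: HJ => e [ee EJ]; exists e.
have F z w : form z w = Defs.form 1%:M z w -
   qreal 2 * (qconj (Defs.form 1%:M e z) * Defs.form 1%:M e w).
  rewrite !form_def EJ mulmxBr mulmxBl mulmx_real -scalemxAl !mulmx1.
  have -> : adjmx z *m (e *m adjmx e) *m w = adjmx (adjmx e *m z) *m (adjmx e *m w).
    by rewrite adjmxM adjmxK !mulmxA.
  move: (adjmx e *m z) (adjmx e *m w) => u v.
  rewrite [LHS]mxE; congr (_ + _); rewrite [LHS]mxE; congr (- _).
  by rewrite [LHS]mxE; congr (_ * _); rewrite mxE big_ord1 adjmxE.
have ee1 : Defs.form 1%:M e e = 1 by rewrite !form_def mulmx1 ee mxE eqxx.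
have Fe z : form e z = - Defs.form 1%:M e z.
  have two : qreal 2 = 1 + 1 :> H by rewrite [LHS]raddfD.
  rewrite F ee1 qconj1 mul1r two mulrDl mul1r.
  by rewrite opprD addrA subrr add0r.
split; [by rewrite Fe ee1|exact: Fe| |] => z.
  by rewrite F -vn2E raddfB /= qCmul -qrealM /= Fe qnorm2N subrK.
by move=> w; rewrite F !Fe raddfN mulrNN.
Qed.

(** Let [pr] be the Euclidean projection along [e], so that the square of [y] is
    [vn2 (pr y) - qnorm2 (form e y)]. If [form z y = 0], Cauchy-Schwarz for [pr z] and [pr y] bounds
    the component of [y] along [e] by the one across it. The uniform constant [K] serves the later
    arguments by closedness and boundedness. *)
Lemma negative_orth z : negative J z ->
  exists2 K, 0 < K & forall y, form z y = 0 -> vn2 y <= K * qre (form y y).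
Proof.
move=> nz; have [e [ee Fe Fn Fm]] := form_spec.
have h1 : adjmx (1%:M : 'M[H]_m) = 1%:M by exact: adjmx1.
pose pr x := x + e *v (form e x).
have Ee : Defs.form 1%:M e e = 1 by rewrite -[LHS]opprK -Fe (form_diag Jh) ee raddfN opprK.
have prE x y : Defs.form 1%:M (pr x) (pr y) = Defs.form 1%:M x y - qconj (form e x) * form e y.
  rewrite /pr formDr !formDl !(formZl h1) !formZr Ee mul1r.
  rewrite (formC h1 e x) -[Defs.form 1%:M e x]opprK -Fe raddfN /=.
  rewrite -[Defs.form 1%:M e y]opprK -Fe ?mulrN ?mulNr.
  by rewrite addNr addr0.
have CS x y : qnorm2 (Defs.form 1%:M (pr x) (pr y)) <= vn2 (pr x) * vn2 (pr y).
  rewrite -!vn2E; apply: cauchy_schwarz => // a b; rewrite vn2E; exact: vn2_ge0.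
have vpr x : vn2 (pr x) = qre (form x x) + qnorm2 (form e x).
  by have := Fn x; rewrite -!vn2E prE raddfB qCmul /=; lra.
pose a := qnorm2 (form e z); pose b := vn2 (pr z).
have ab : b < a by rewrite /b /a vpr; move: nz; rewrite /negative; lra.
(* [a] and [b] are the squared lengths of the parts of [z] along and across [e]; thus [a - b] is
   minus the square of [z]. *)
exists (2 * a / (a - b)) => [|y zy].
  by rewrite divr_gt0 ?subr_gt0 // mulr_gt0 // (le_lt_trans (vn2_ge0 _) ab).
have := CS z y; rewrite prE; have := Fm z y; rewrite zy => /esym/eqP.
rewrite subr_eq0 => /eqP ->; rewrite -{2}[qconj _ * _]mul1r -mulrBl -qreal1 -raddfB /=.
rewrite (_ : 2 - 1 = 1) ?qreal1 ?mul1r; last by ring.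
rewrite qnorm2M qnorm2_conj -/a -/b [vn2 (pr y)]vpr -(Fn y).
have := qnorm2_ge0 (form e y); have := vn2_ge0 (pr y); rewrite vpr.
have := vn2_ge0 (pr z); rewrite -/b.
move: (qnorm2 (form e y)) (qre (form y y)) => c d b0 dc0 c0 h.
rewrite mulrAC ler_pdivlMr ?subr_gt0 //.
have : 0 <= (a - b) * (d + c - c).
  have : a * c <= a * (d + c) by apply: le_trans (_ : b * (d + c) <= _); nra.
  by rewrite ler_pM2l; nra.
nra.
Qed.

End Lorentz.

(** * Projective points and their representatives *)

Section Points.
Variables (R : realType) (m : nat).
Local Notation H := (quat R).
Implicit Types (z w : 'cV[H]_m) (g : 'M[H]_m).

(** Equality of projective points when [w] is not 0. Since [w = 0] is allowed, [onl z (X *m z)] also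
    says that an element [X] of the Lie algebra, which may kill [z], fixes the point of [z]. *)
Definition onl z w := exists a, w = z *v a.

Lemma onl_refl z : onl z z.
Proof. by exists 1; rewrite smul1. Qed.

Lemma onl_mx g z w : onl z w -> onl (g *m z) (g *m w).
Proof. by case=> a ->; exists a; rewrite mulmxA. Qed.

Lemma onl_trans z w y : onl z w -> onl w y -> onl z y.
Proof. by case=> a -> [b ->]; exists (a * b); rewrite smulA. Qed.

Lemma onl_sym z w : w != 0 -> onl z w -> onl w z.
Proof.
move=> w0 [a E]; have a0 : a != 0.
  by apply: contraNneq w0 => a0; rewrite E a0 smul0.
by exists a^-1; rewrite E smulA qmulxV // smul1.
Qed.

Lemma onl_pt z w : w != 0 -> onl z w -> pt z = pt w.
Proof.
move=> w0 zw; have wz := onl_sym w0 zw; case: zw wz => a wE [b zE].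
apply/seteqP; split=> x [c _ <-]; first by exists (b * c) => //; rewrite -smulA -zE.
by exists (a * c) => //; rewrite -smulA -wE.
Qed.

Lemma pt_onl z w : pt z = pt w -> onl z w.
Proof.
move=> zw; have : pt w w by exists 1 => //; rewrite smul1.
by rewrite -zw => -[a _ <-]; exists a.
Qed.

Lemma act_pt g z : act g (pt z) = pt (g *m z).
Proof.
apply/seteqP; split=> x.
  by case=> y [a _ <-] <-; exists a => //; rewrite mulmxA.
by case=> a _ <-; exists (z *v a); [exists a|rewrite mulmxA].
Qed.

End Points.

(** * Isometries, their eigenvectors and their fixed points at infinity *)

Section LorentzGeometry.
Variables (R : realType) (m : nat).
Local Notation H := (quat R).
Variable J : 'M[H]_m.
Hypothesis HJ : lorentz J.
Implicit Types (x y z w p q : 'cV[H]_m) (a b c : H) (r : R) (A B f g : 'M[H]_m).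
Local Notation form := (Defs.form J).
Let Jh := lorentz_adj HJ.

Lemma neg_orth_pos z y : negative J z -> form z y = 0 -> y != 0 -> 0 < qre (form y y).
Proof.
move=> nz zy y0; have [K K0 h] := negative_orth HJ nz.
rewrite -(pmulr_rgt0 _ K0); apply: lt_le_trans (h y zy); rewrite lt_def vn2_ge0 andbT.
by apply: contraNneq y0 => /vn2_eq0 ->.
Qed.

Lemma negative_neq0 z : negative J z -> z != 0.
Proof. by apply: contraPneq => ->; rewrite /negative form0r ltxx. Qed.

Lemma neg_form_neq0 z w : negative J z -> w != 0 -> qre (form w w) <= 0 -> form z w != 0.
Proof.
move=> nz w0 ww; apply/eqP => zw; have := neg_orth_pos nz zw w0; lra.
Qed.

Lemma neg_null_neq0 z w : negative J z -> null J w -> form z w != 0.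
Proof. by move=> nz [w0 ww]; apply: neg_form_neq0; rewrite ?ww. Qed.

Lemma neg_neg_neq0 z w : negative J z -> negative J w -> form z w != 0.
Proof. by move=> nz nw; apply: neg_form_neq0; rewrite ?negative_neq0 ?ltW. Qed.

Lemma exists_neg : exists z, negative J z.
Proof. by have [e [ee _ _ _]] := form_spec HJ; exists e; rewrite /negative ee ltrN10. Qed.

Lemma negativeZ z a : a != 0 -> negative J z -> negative J (z *v a).
Proof.
move=> a0; rewrite /negative formZZ // pmulr_rlt0 // lt_def qnorm2_ge0 andbT.
by rewrite qnorm2_eq0.
Qed.

Lemma nullZ z a : a != 0 -> null J z -> null J (z *v a).
Proof.
move=> a0 [z0 zz]; split; first by rewrite smul_eq0 negb_or z0.
by rewrite formZr formZl // zz mulr0 mul0r.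
Qed.

(** Subtracting a multiple of [z] makes [y] orthogonal to a negative vector without changing its
    square, and there the form is positive definite. *)
Lemma null_orth z y : null J z -> form z y = 0 ->
  0 <= qre (form y y) /\ (qre (form y y) = 0 -> onl z y).
Proof.
move=> nz zy; have [e ne] := exists_neg.
have ez := neg_null_neq0 ne nz; case: nz => z0 zz.
pose a := (form e z)^-1 * form e y; pose y' := y - z *v a.
have ey' : form e y' = 0 by rewrite formBr formZr /a mulrA qmulxV // mul1r subrr.
have yy' : form y' y' = form y y.
  rewrite formBl !formBr !formZl // !formZr zz zy (form_eq0C Jh zy).
  by rewrite !(mul0r, mulr0, subr0).
have [y0|y0] := eqVneq y' 0.
  split; first by rewrite -yy' y0 form0r.
  by move=> _; exists a; apply/eqP; rewrite -subr_eq0 -/y' y0.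
have := neg_orth_pos ne ey' y0; rewrite yy' => h; split; lra.
Qed.

Lemma null_null_onl z w : null J z -> null J w -> form z w = 0 -> onl z w.
Proof. by move=> nz [_ ww] zw; apply: (null_orth nz zw).2; rewrite ww. Qed.

Lemma null_onl_form z w : null J z -> onl z w -> form z w = 0.
Proof. by case=> _ zz [a ->]; rewrite formZr zz mul0r. Qed.

Lemma SpP A : Sp J A <-> adjmx A *m J *m A = J /\ A *m (J *m adjmx A *m J) = 1%:M.
Proof.
have JJ := lorentz_sqr HJ; split.
  case=> -[B [AB BA]] AJA; split=> //.
  have BE : J *m adjmx A *m J *m A = 1%:M by rewrite -!mulmxA (mulmxA (adjmx A)) AJA.
  by rewrite -[X in A *m X]mulmx1 -AB (mulmxA _ A B) BE mul1mx.
case=> AJA AB; split => //; exists (J *m adjmx A *m J); split=> //.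
by rewrite -!mulmxA (mulmxA (adjmx A)) AJA.
Qed.

Lemma Sp_inv A : Sp J A -> mxinv A = J *m adjmx A *m J.
Proof.
move=> SA; have [AB BA] := mxinvP SA.1; have [_ AC] := (SpP A).1 SA.
by rewrite -[RHS]mul1mx -BA -mulmxA AC mulmx1.
Qed.

Lemma SpVK A : Sp J A -> mxinv A *m A = 1%:M.
Proof. by move=> SA; have [] := mxinvP SA.1. Qed.
Lemma SpKV A : Sp J A -> A *m mxinv A = 1%:M.
Proof. by move=> SA; have [] := mxinvP SA.1. Qed.

Lemma SpM A B : Sp J A -> Sp J B -> Sp J (A *m B).
Proof.
move=> SA SB; have [a1 a2] := (SpP A).1 SA; have [b1 b2] := (SpP B).1 SB.
apply/SpP; split.
  by rewrite adjmxM -!mulmxA (mulmxA J) (mulmxA (adjmx A)) (mulmxA (adjmx A)) a1 mulmxA.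
rewrite adjmxM -mulmxA [X in A *m X](_ : _ = J *m adjmx A *m J) //.
have -> : J *m (adjmx B *m adjmx A) *m J = (J *m adjmx B *m J) *m (J *m adjmx A *m J).
  by rewrite -!mulmxA (mulmxA J J) lorentz_sqr // mul1mx.
by rewrite mulmxA b2 mul1mx.
Qed.

Lemma form_Sp A z w : Sp J A -> form (A *m z) (A *m w) = form z w.
Proof.
move=> [_ AJA]; rewrite !form_def adjmxM -!mulmxA (mulmxA J) (mulmxA (adjmx A)).
by rewrite (mulmxA (adjmx A)) AJA.
Qed.

Lemma form_SpV A z w : Sp J A -> form (mxinv A *m z) w = form z (A *m w).
Proof. by move=> SA; rewrite -(form_Sp _ _ SA) mulmxA SpKV // mul1mx. Qed.

Lemma SpV A : Sp J A -> Sp J (mxinv A).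
Proof.
move=> SA; split; first by exists A; rewrite SpKV // SpVK.
have [_ AJA] := SA; rewrite -[in LHS]AJA -2!mulmxA SpKV // mulmx1 mulmxA -adjmxM.
by rewrite SpKV // adjmx1 mul1mx.
Qed.

Lemma Sp_mul_neq0 A z : Sp J A -> z != 0 -> A *m z != 0.
Proof.
move=> SA; apply: contraNneq => h.
by rewrite -(mul1mx z) -(SpVK SA) -mulmxA h mulmx0.
Qed.

Lemma negative_Sp A z : Sp J A -> negative J z -> negative J (A *m z).
Proof. by move=> SA; rewrite /negative form_Sp. Qed.

Lemma null_Sp A z : Sp J A -> null J z -> null J (A *m z).
Proof. by move=> SA [z0 zz]; split; rewrite ?Sp_mul_neq0 ?form_Sp. Qed.

Lemma nrm_SpV A : Sp J A -> nrm (mxinv A) <= nrm J ^+ 2 * nrm A.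
Proof.
move=> SA; rewrite Sp_inv // (le_trans (nrmM _ _)) //.
rewrite expr2 mulrAC ler_wpM2r ?nrm_ge0 //.
by rewrite (le_trans (nrmM _ _)) // nrm_adj.
Qed.

(** Invariance of [c = form z w] reads [qconj a * c * b = c]. Eigenvectors that are not orthogonal
    thus have opposite rates of expansion. *)
Lemma eigen_pair A z w a b : Sp J A -> A *m z = z *v a -> A *m w = w *v b ->
  form z w != 0 -> qabs a * qabs b = 1.
Proof.
move=> SA Az Aw zw; have := form_Sp z w SA; rewrite Az Aw formZr formZl // => E.
have := congr1 (@qabs R) E; rewrite !qabsM qabs_conj mulrAC -[RHS]mul1r.
by move/mulIf; apply; rewrite qabs_eq0.
Qed.

Lemma eigen_neg A z a : Sp J A -> negative J z -> A *m z = z *v a -> qabs a = 1.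
Proof.
move=> SA nz Az; have := eigen_pair SA Az Az (neg_neg_neq0 nz nz).
move/eqP; rewrite -expr2 sqrp_eq1 ?qabs_ge0 //; exact/eqP.
Qed.

Lemma eigen_null A z a : Sp J A -> z != 0 -> A *m z = z *v a -> qabs a != 1 ->
  null J z.
Proof.
move=> SA z0 Az a1; split => //; apply/eqP; apply: contraNT a1 => zz.
have := eigen_pair SA Az Az zz.
by move/eqP; rewrite -expr2 sqrp_eq1 ?qabs_ge0.
Qed.

Lemma eigen_inv A z a : Sp J A -> z != 0 -> A *m z = z *v a ->
  a != 0 /\ mxinv A *m z = z *v a^-1.
Proof.
move=> SA z0 Az; have a0 : a != 0.
  by apply: contraTneq (Sp_mul_neq0 SA z0) => a0; rewrite Az a0 smul0 eqxx.
have E : z = mxinv A *m (z *v a) by rewrite -Az mulmxA SpVK // mul1mx.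
by split=> //; rewrite [in RHS]E -!mulmxA -scalar_mxM qmulxV // mulmx1.
Qed.

(* The spectral counterpart of [loxodromic]. *)
Definition loxE f := exists z w a b, [/\ z != 0, w != 0,
  f *m z = z *v a /\ 1 < qabs a & f *m w = w *v b /\ qabs b < 1].

Lemma loxE_conj A f : Sp J A -> loxE f -> loxE (A *m f *m mxinv A).
Proof.
move=> SA [z [w [a [b [z0 w0 [fz a1] [fw b1]]]]]].
have h x c : f *m x = x *v c -> A *m f *m mxinv A *m (A *m x) = A *m x *v c.
  by move=> fx; rewrite -!mulmxA (mulmxA (mxinv A)) SpVK // mul1mx fx mulmxA.
by exists (A *m z), (A *m w), a, b; rewrite !Sp_mul_neq0 // (h _ _ fz) (h _ _ fw).
Qed.

(** The contracting eigenvector comes from the inverse, which has the same real trace since it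
    equals [J *m adjmx f *m J]. *)
Lemma retr_loxE f : (0 < m)%N -> Sp J f -> m%:R < retr f -> loxE f.
Proof.
move=> m0 Sf tf; have [z [a [z0 fz a1]]] := retr_eigen m0 tf.
have tV : m%:R < retr (mxinv f).
  by rewrite Sp_inv // retrC mulmxA lorentz_sqr // mul1mx retr_adj.
have [w [b [w0 fw b1]]] := retr_eigen m0 tV.
have [b0 fw'] := eigen_inv (SpV Sf) w0 fw.
exists z, w, a, b^-1; split=> //; split.
  rewrite -fw'; congr (_ *m _); rewrite -[LHS]mul1mx -(SpVK (SpV Sf)).
  by rewrite -mulmxA SpVK // mulmx1.
by rewrite qabsV // invf_lt1 ?qabs_gt0.
Qed.

(** A third fixed null line is orthogonal to neither [z] nor [w]; by [eigen_pair] its eigenvalue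
    would have modulus both below and above 1. *)
Lemma loxE_fix f z w a b v c : Sp J f -> null J z -> null J w ->
  f *m z = z *v a -> 1 < qabs a -> f *m w = w *v b -> qabs b < 1 ->
  null J v -> f *m v = v *v c -> onl z v \/ onl w v.
Proof.
move=> Sf nz nw fz a1 fw b1 nv fv.
have [zv|zv] := eqVneq (form z v) 0; first by left; exact: null_null_onl.
have [wv|wv] := eqVneq (form w v) 0; first by right; exact: null_null_onl.
have h1 := eigen_pair Sf fz fv zv; have h2 := eigen_pair Sf fw fv wv.
have ac := qabs_ge0 c; exfalso; have := qabs_ge0 b; nra.
Qed.

Lemma loxE_loxodromic f : Sp J f -> loxE f -> loxodromic J f.
Proof.
move=> Sf [z [w [a [b [z0 w0 [fz a1] [fw b1]]]]]].
have nz : null J z by apply: (eigen_null Sf z0 fz); rewrite gt_eqF.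
have nw : null J w by apply: (eigen_null Sf w0 fw); rewrite lt_eqF.
split.
  case=> _ [v nv <-]; rewrite act_pt => /esym/pt_onl[c fv].
  have c1 := eigen_neg Sf nv fv.
  have := eigen_pair Sf fv fz (neg_null_neq0 nv nz); rewrite c1 mul1r; lra.
exists (pt z), (pt w); split.
  move=> /pt_onl [c wE]; have c0 : c != 0.
    by apply: contraNneq w0 => c0; rewrite wE c0 smul0.
  have : z *v (a * c) = z *v (c * b) by rewrite -!smulA -fz -wE -fw wE mulmxA.
  move/(smul_cancel z0)/(congr1 (@qabs R)); rewrite !qabsM [qabs c * _]mulrC.
  by move/mulIf => E; have := E; rewrite qabs_eq0 c0 => /(_ isT); lra.
apply/seteqP; split=> P /=.
  case=> -[v nv <-]; rewrite act_pt => /esym/pt_onl[c fv].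
  by case: (loxE_fix Sf nz nw fz a1 fw b1 nv fv) => h; [left|right]; apply/esym/onl_pt => //; case: nv.
case=> ->; split; [by exists z| |by exists w|]; rewrite act_pt; apply/esym.
  by apply: onl_pt; [exact: Sp_mul_neq0|exists a].
by apply: onl_pt; [exact: Sp_mul_neq0|exists b].
Qed.

End LorentzGeometry.

Section QReal.
Variable R : realType.
Lemma qrealD (r s : R) : qreal (r + s) = qreal r + qreal s. Proof. exact: raddfD. Qed.
Lemma qrealN (r : R) : qreal (- r) = - qreal r. Proof. exact: raddfN. Qed.
Lemma qrealB (r s : R) : qreal (r - s) = qreal r - qreal s. Proof. exact: raddfB. Qed.
Lemma qrealN1 : -1 = qreal (-1) :> quat R. Proof. by rewrite qrealN. Qed.
Lemma qreal_eq0 (r : R) : (qreal r == 0) = (r == 0).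
Proof. by rewrite -qabs_eq0 qabs_real normr_eq0. Qed.
End QReal.

(** * Totally geodesic subspaces cut out by conditions on vectors *)

Section TotallyGeodesic.
Variables (R : realType) (m : nat).
Local Notation H := (quat R).
Variable J : 'M[H]_m.
Hypothesis HJ : lorentz J.
Implicit Types (x y z w p q : 'cV[H]_m) (a b c : H) (r : R).
Local Notation form := (Defs.form J).
Let Jh := lorentz_adj HJ.

Lemma expR_arcosh (x : R) : 1 <= x ->
  expR (arcosh x) = x + Num.sqrt (x ^+ 2 - 1).
Proof.
by move=> x1; rewrite lnK // posrE ltr_wpDr ?sqrtr_ge0 // (lt_le_trans ltr01).
Qed.

Definition ch (x : R) := (expR x + expR (- x)) / 2.
Definition sh (x : R) := (expR x - expR (- x)) / 2.

Lemma cosh_sinh (x : R) : 0 < x -> [/\ 0 < ch x, 0 < sh x & ch x ^+ 2 = 1 + sh x ^+ 2].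
Proof.
move=> x0; have h : expR (- x) < expR x by rewrite ltr_expR gtrN.
have p := expR_gt0 (- x); have : expR x * expR (- x) = 1 by rewrite -expRD subrr expR0.
rewrite /ch /sh; move: (expR x) (expR (- x)) h p => a b h p e.
by split; lra.
Qed.

Lemma cosh_add (x y : R) : ch (x + y) = ch x * ch y + sh x * sh y.
Proof. by rewrite /ch /sh opprD !expRD; field. Qed.

Lemma arcosh_cosh (x t : R) : 1 <= x -> arcosh x = t ->
  x = ch t.
Proof.
move=> x1 xt; have := expR_arcosh x1; rewrite /ch xt expRN.
have s2 : Num.sqrt (x ^+ 2 - 1) ^+ 2 = x ^+ 2 - 1.
  by rewrite sqr_sqrtr // subr_ge0 expr_ge1 // (le_trans ler01).
have := sqrtr_ge0 (x ^+ 2 - 1); move: (Num.sqrt _) s2 => s s2 s0 ->.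
have xs0 : x + s != 0 by rewrite gt_eqF //; lra.
have -> : (x + s)^-1 = x - s.
  by apply: (mulfI xs0); rewrite divff // mulrC -subr_sqr s2; ring.
by field.
Qed.

(** The hyperbolic cosine of half the distance, by the normalization of [hdist]. *)
Definition rho z w : R :=
  qabs (form z w) / Num.sqrt (qre (form z z) * qre (form w w) : R).

Lemma rhoZ z w a b : a != 0 -> b != 0 -> rho (z *v a) (w *v b) = rho z w.
Proof.
move=> a0 b0; rewrite /rho (formZZ Jh z) (formZZ Jh w) formZr (formZl Jh).
move: (form z w) (qre (form z z)) (qre (form w w)) => c Z W.
rewrite !qabsM qabs_conj -!sqr_qabs mulrACA -exprMn.
have ab0 : 0 < qabs a * qabs b by rewrite mulr_gt0 ?qabs_gt0.
rewrite sqrtrM ?sqr_ge0 // sqrtr_sqr gtr0_norm // [qabs a * _ * _]mulrAC.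
by rewrite -mulf_div divff ?mul1r // gt_eqF.
Qed.

(** The reversed Cauchy-Schwarz inequality: the component [y] of [w] orthogonal to the negative [z]
    has nonnegative square. *)
Lemma rho_ge1 z w : negative J z -> negative J w -> 1 <= rho z w.
Proof.
rewrite /rho /negative => nz nw; set s := Num.sqrt _.
have s0 : 0 < s by rewrite sqrtr_gt0 nmulr_rgt0.
rewrite ler_pdivlMr // mul1r -(@ler_pXn2r _ 2) ?nnegrE ?qabs_ge0 ?(ltW s0) //.
rewrite /s sqr_sqrtr ?sqr_qabs; last by rewrite ltW // nmulr_rgt0.
pose a := (form z z)^-1 * form z w; pose y := w - z *v a.
have zz0 := neg_neg_neq0 HJ nz nz.
have zy : form z y = 0 by rewrite formBr formZr /a mulrA qmulxV // mul1r subrr.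
have yy : 0 <= qre (form y y).
  have [->|y0] := eqVneq y 0; first by rewrite form0r.
  by rewrite ltW // (neg_orth_pos HJ nz).
have := form_sqr_sub Jh z w ((qre (form z z))^-1).
have -> : z *v (form z w * qreal (qre (form z z))^-1) = z *v a.
  congr (z *v _); rewrite /a -qrealC; congr (_ * _).
  apply: (can_inj (mulrK _)) (_ : _ * form z z = _ * form z z) => //.
  by rewrite qmulVx // {2}(form_diag Jh) -qrealM mulVf ?ltr0_neq0.
move=> E; rewrite E in yy.
move: nz yy; move: (qre (form z z)) (qre (form w w)) (qnorm2 _) => Z W C Z0.
have -> : W - 2 * Z^-1 * C + Z^-1 ^+ 2 * C * Z = (Z * W - C) / Z.
  by field; rewrite ltr0_neq0.
by rewrite -[_ / Z]opprK -mulrN -invrN oppr_ge0 pmulr_lle0 ?invr_gt0 ?oppr_gt0 // subr_le0.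
Qed.

Definition unitize z := z *v qreal (Num.sqrt (- qre (form z z)))^-1.

Lemma unitize_neq0 z : negative J z ->
  qreal (Num.sqrt (- qre (form z z)))^-1 != 0 :> H.
Proof.
by move=> nz; rewrite -qabs_eq0 qabs_real normr_eq0 invr_eq0 gt_eqF // sqrtr_gt0 oppr_gt0.
Qed.

Lemma form_unitize z : negative J z -> form (unitize z) (unitize z) = -1.
Proof.
move=> nz; rewrite (form_diag Jh) formZZ // -sqr_qabs qabs_real real_normK ?num_real // exprVn.
rewrite sqr_sqrtr ?oppr_ge0 ?ltW // qrealN1; congr qreal.
by rewrite invrN mulNr mulVf ?ltr0_neq0.
Qed.

Lemma rho_unitize z w : negative J z -> negative J w ->
  rho z w = qabs (form (unitize z) (unitize w)).
Proof.
move=> nz nw; rewrite -(rhoZ _ _ (unitize_neq0 nz) (unitize_neq0 nw)).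
by rewrite /rho !form_unitize //= mulrNN mulr1 sqrtr1 divr1.
Qed.

Lemma form_real_comb y w (r s : R) :
  qre (form (y *v qreal r + w *v qreal s) (y *v qreal r + w *v qreal s)) =
  r ^+ 2 * qre (form y y) + 2 * (r * s) * qre (form y w) + s ^+ 2 * qre (form w w).
Proof.
rewrite formDr !formDl !formZr !(formZl Jh) !qconj_real (formC Jh y w).
by move: (form y y) (form y w) (form w w) => a b c; rewrite !qcE /=; ring.
Qed.

(* Equality in the triangle inequality: the middle point of three is a real
   combination of suitable representatives of the two outer ones. *)
Lemma middle_aligned z w1 w3 (c1 s1 c3 s3 : R) :
  form z z = -1 -> form w1 w1 = -1 -> form w3 w3 = -1 ->
  form z w1 = qreal (- c1) -> form z w3 = qreal (- c3) ->
  qabs (form w1 w3) = c1 * c3 + s1 * s3 ->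
  c1 ^+ 2 = 1 + s1 ^+ 2 -> c3 ^+ 2 = 1 + s3 ^+ 2 ->
  0 < c1 -> 0 < s1 -> 0 < c3 -> 0 < s3 ->
  w1 *v qreal s3 + w3 *v qreal s1 = z *v qreal (c1 * s3 + c3 * s1).
Proof.
move=> q g1 g3 f1 f3 h13 e1 e3 c10 s10 c30 s30.
have n2 : negative J z by rewrite /negative q /= ltrN10.
have f1' : form w1 z = qreal (- c1) by rewrite (formC Jh) f1 qconj_real.
have f3' : form w3 z = qreal (- c3) by rewrite (formC Jh) f3 qconj_real.
have [y1 Ey1] : exists y1, y1 = w1 - z *v qreal c1 by exists (w1 - z *v qreal c1).
have [y3 Ey3] : exists y3, y3 = w3 - z *v qreal c3 by exists (w3 - z *v qreal c3).
have zy1 : form z y1 = 0.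
  by rewrite Ey1 formBr formZr f1 q mulN1r opprK -qrealD addNr.
have zy3 : form z y3 = 0.
  by rewrite Ey3 formBr formZr f3 q mulN1r opprK -qrealD addNr.
have zc a b : form z (y1 *v a + y3 *v b) = 0.
  by rewrite formDr !formZr zy1 zy3 !mul0r addr0.
have pos a b : 0 <= qre (form (y1 *v a + y3 *v b) (y1 *v a + y3 *v b)).
  have := zc a b; move: (_ + _) => v zv; have [->|v0] := eqVneq v 0.
    by rewrite form0r.
  exact: ltW (neg_orth_pos HJ n2 zv v0).
have Y1 : form y1 y1 = qreal (s1 ^+ 2).
  rewrite {2}Ey1 formBr formZr (form_eq0C Jh zy1) mul0r subr0 Ey1 formBl.
  rewrite (formZl Jh) f1 g1 qconj_real -qrealM qrealN1 -qrealB.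
  by congr qreal; lra.
have Y3 : form y3 y3 = qreal (s3 ^+ 2).
  rewrite {2}Ey3 formBr formZr (form_eq0C Jh zy3) mul0r subr0 Ey3 formBl.
  rewrite (formZl Jh) f3 g3 qconj_real -qrealM qrealN1 -qrealB.
  by congr qreal; lra.
have Y13 : form w1 w3 = form y1 y3 - qreal (c1 * c3).
  rewrite Ey3 formBr formZr (form_eq0C Jh zy1) mul0r subr0 Ey1 formBl.
  by rewrite (formZl Jh) f3 qconj_real -qrealM mulrN qrealN opprK addrK.
have CS := cauchy_schwarz Jh pos; rewrite Y1 Y3 /= in CS.
have K : qre (form y1 y3) <= - (s1 * s3).
  have := congr1 (fun t : R => t ^+ 2) h13; rewrite /= sqr_qabs Y13.
  have -> : qnorm2 (form y1 y3 - qreal (c1 * c3)) = qnorm2 (form y1 y3)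
    - 2 * (c1 * c3) * qre (form y1 y3) + (c1 * c3) ^+ 2.
    by move: (form y1 y3) => a; rewrite /qnorm2 !qcE /=; ring.
  have cc : 0 < c1 * c3 by rewrite mulr_gt0.
  move: (qre _) (qnorm2 _) CS cc => X N CS cc E.
  by rewrite -(ler_pM2l cc); nra.
have y0 : y1 *v qreal s3 + y3 *v qreal s1 = 0.
  apply/eqP/negPn/negP => v0; have := neg_orth_pos HJ n2 (zc _ _) v0.
  rewrite form_real_comb Y1 Y3 /=; move: (qre _) K s10 s30 => X K s10 s30.
  have : 0 < s3 * s1 by rewrite mulr_gt0.
  nra.
move/eqP: y0; rewrite Ey1 Ey3 !mulmxBl !smulA -!qrealM addrACA -opprD -smulDr -qrealD.
by rewrite subr_eq0 => /eqP.
Qed.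

Lemma align z2 z (c : R) : form z2 z2 = -1 -> form z z = -1 ->
  qabs (form z2 z) = c -> 0 < c ->
  exists2 a, a != 0 & [/\ form z2 (z *v a) = qreal (- c),
    form (z *v a) (z *v a) = -1 & qabs a = 1].
Proof.
move=> q2 qz hz c0; have f0 : form z2 z != 0 by rewrite -qabs_eq0 hz gt_eqF.
have r0 : qreal (- c) != 0 :> H by rewrite qreal_eq0 oppr_eq0 gt_eqF.
have a1 : qabs ((form z2 z)^-1 * qreal (- c)) = 1.
  by rewrite qabsM qabsV // hz qabs_real normrN gtr0_norm // mulVf ?gt_eqF.
exists ((form z2 z)^-1 * qreal (- c)); first by rewrite -qabs_eq0 a1 oner_eq0.
split=> //; first by rewrite formZr mulrA qmulxV // mul1r.
rewrite (form_diag Jh) (formZZ Jh) -sqr_qabs a1 qz expr1n mul1r.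
by rewrite qrealN1.
Qed.

Lemma middle_point z1 z2 z3 (c1 s1 c3 s3 : R) :
  form z1 z1 = -1 -> form z2 z2 = -1 -> form z3 z3 = -1 ->
  qabs (form z1 z2) = c1 -> qabs (form z2 z3) = c3 ->
  qabs (form z1 z3) = c1 * c3 + s1 * s3 ->
  c1 ^+ 2 = 1 + s1 ^+ 2 -> c3 ^+ 2 = 1 + s3 ^+ 2 ->
  0 < c1 -> 0 < s1 -> 0 < c3 -> 0 < s3 ->
  exists a1 a3 : H, exists r : R, [/\ a1 != 0, a3 != 0,
    form z2 (z1 *v a1) = qreal (- c1) /\ form z2 (z3 *v a3) = qreal (- c3),
    form (z1 *v a1) (z3 *v a3) = qreal r &
    z1 *v a1 *v qreal s3 + z3 *v a3 *v qreal s1 = z2 *v qreal (c1 * s3 + c3 * s1)].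
Proof.
move=> q1 q2 q3 h12 h23 h13 e1 e3 c10 s10 c30 s30.
have h21 : qabs (form z2 z1) = c1 by rewrite (formC Jh) qabs_conj.
have [a1 a10 [f1 g1 b1]] := align q2 q1 h21 c10.
have [a3 a30 [f3 g3 b3]] := align q2 q3 h23 c30.
have h13' : qabs (form (z1 *v a1) (z3 *v a3)) = c1 * c3 + s1 * s3.
  by rewrite formZr (formZl Jh) !qabsM qabs_conj b1 b3 mulr1 mul1r.
have E := middle_aligned q2 g1 g3 f1 f3 h13' e1 e3 c10 s10 c30 s30.
exists a1, a3, ((- c1 * (c1 * s3 + c3 * s1) + s3) / s1); split=> //.
have f1' : form (z1 *v a1) z2 = qreal (- c1) by rewrite (formC Jh) f1 qconj_real.
have := congr1 (form (z1 *v a1)) E.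
rewrite formDr (formZr _ _ (z1 *v a1)) (formZr _ _ (z3 *v a3)) (formZr _ _ z2) g1 f1' mulN1r.
move/(congr1 (fun t => (t + qreal s3) * qreal s1^-1)).
rewrite addrAC addNr add0r -mulrA -!qrealM divff ?gt_eqF // qreal1 mulr1 => ->.
by rewrite -qrealD -qrealM.
Qed.

Variable V : 'cV[H]_m -> Prop.
Hypothesis Vscale : forall z a, V z -> V (z *v a).
Hypothesis Vlim : forall (f : nat -> 'cV[H]_m) z, (forall k, V (f k)) ->
  mcvg \oo f z -> V z.
Hypothesis Vcomb : forall z w r (x y : R), V z -> V w -> negative J z -> negative J w ->
  form z w = qreal r -> V (z *v qreal x + w *v qreal y).

(** Closure of [V] is required only under real combinations of vectors with real product: these stay
    on the geodesic through both points. So [V] need not be a quaternionic subspace, and a single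
    geodesic qualifies. *)
Definition ptsof : set (set 'cV[H]_m) := [set pt z | z in [set z | negative J z /\ V z]].

Lemma ptsofP z : z != 0 -> ptsof (pt z) -> V z.
Proof. by move=> z0 [w [_ Vw] /pt_onl[a ->]]; exact: Vscale. Qed.

Lemma V_unscale z a : a != 0 -> V (z *v a) -> V z.
Proof. by move=> a0 /(Vscale (a^-1)); rewrite smulA qmulxV // smul1. Qed.

(** By [middle_point] each of three points in line is, up to a scalar, a real combination of
    suitable multiples of the other two, and these have a real product. *)
Lemma middle_closed z1 z2 z3 (c1 s1 c3 s3 : R) :
  form z1 z1 = -1 -> form z2 z2 = -1 -> form z3 z3 = -1 ->
  qabs (form z1 z2) = c1 -> qabs (form z2 z3) = c3 ->
  qabs (form z1 z3) = c1 * c3 + s1 * s3 ->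
  c1 ^+ 2 = 1 + s1 ^+ 2 -> c3 ^+ 2 = 1 + s3 ^+ 2 ->
  0 < c1 -> 0 < s1 -> 0 < c3 -> 0 < s3 ->
  [/\ V z1 -> V z2 -> V z3, V z1 -> V z3 -> V z2 & V z2 -> V z3 -> V z1].
Proof.
move=> q1 q2 q3 h12 h23 h13 e1 e3 c10 s10 c30 s30.
have [a1 [a3 [r [a10 a30 [f1 f3] f13 E]]]] :=
  middle_point q1 q2 q3 h12 h23 h13 e1 e3 c10 s10 c30 s30.
have neg z : form z z = -1 -> negative J z by rewrite /negative => -> /=; rewrite ltrN10.
have negZ z a : a != 0 -> form z z = -1 -> negative J (z *v a).
  by move=> a0 zz; apply: negativeZ => //; exact: neg.
have sgn (s : R) : 0 < s -> qreal s != 0 :> H.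
  by move=> s0; rewrite -qabs_eq0 qabs_real normr_eq0 gt_eqF.
split=> V1 V2.
- apply: (V_unscale a30); apply: (V_unscale (sgn _ s10)).
  have -> : z3 *v a3 *v qreal s1 = z2 *v qreal (c1 * s3 + c3 * s1) + z1 *v a1 *v qreal (- s3).
    by rewrite -E raddfN /= smulNr addrAC subrr add0r.
  by apply: Vcomb f1 => //; [exact: Vscale|exact: neg|exact: negZ].
- apply: (@V_unscale _ (qreal (c1 * s3 + c3 * s1))); first by apply: sgn; rewrite addr_gt0 ?mulr_gt0.
  by rewrite -E; apply: Vcomb f13; do ?[exact: Vscale|exact: negZ].
- apply: (V_unscale a10); apply: (V_unscale (sgn _ s30)).
  have -> : z1 *v a1 *v qreal s3 = z2 *v qreal (c1 * s3 + c3 * s1) + z3 *v a3 *v qreal (- s1).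
    by rewrite -E raddfN /= smulNr addrK.
  by apply: Vcomb f3 => //; [exact: Vscale|exact: neg|exact: negZ].
Qed.

Lemma geodesic_closed (c : R -> 'cV[H]_m) (s t u : R) : geodesic J c ->
  s < t -> t < u -> [/\ V (c s) -> V (c t) -> V (c u),
    V (c s) -> V (c u) -> V (c t) & V (c t) -> V (c u) -> V (c s)].
Proof.
case=> nc dc st tu.
have st2 : 0 < (t - s) / 2 by rewrite divr_gt0 ?subr_gt0.
have tu2 : 0 < (u - t) / 2 by rewrite divr_gt0 ?subr_gt0.
have rhoE (x y : R) : x < y -> rho (c x) (c y) = ch ((y - x) / 2).
  move=> xy; apply: arcosh_cosh; first exact: rho_ge1.
  have := dc x y; rewrite /hdist -/(rho _ _) distrC gtr0_norm ?subr_gt0 //; lra.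
have U (x : R) : V (c x) <-> V (unitize (c x)).
  by split=> [|h]; [exact: Vscale|apply: V_unscale h; exact: unitize_neq0].
suff [h1 h2 h3] : [/\ V (unitize (c s)) -> V (unitize (c t)) -> V (unitize (c u)),
    V (unitize (c s)) -> V (unitize (c u)) -> V (unitize (c t)) &
    V (unitize (c t)) -> V (unitize (c u)) -> V (unitize (c s))].
  by split=> /U v1 /U v2; apply/U; [exact: h1|exact: h2|exact: h3].
have r1 := rhoE _ _ st; have r2 := rhoE _ _ tu.
have r3 := rhoE _ _ (lt_trans st tu); rewrite (rho_unitize (nc s) (nc t)) in r1; rewrite (rho_unitize (nc t) (nc u)) in r2.
rewrite (rho_unitize (nc s) (nc u)) in r3.
have [p1 p2 p3] := cosh_sinh st2; have [p4 p5 p6] := cosh_sinh tu2.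
rewrite (_ : (u - s) / 2 = (t - s) / 2 + (u - t) / 2) ?cosh_add in r3; last first.
  by rewrite -mulrDl [X in _ = X / _]addrC addrA subrK.
exact: (middle_closed (form_unitize (nc s)) (form_unitize (nc t)) (form_unitize (nc u)) r1 r2 r3).
Qed.

Lemma ptsof_totally_geodesic : (exists2 z, negative J z & V z) ->
  totally_geodesic J ptsof.
Proof.
move=> [z0 nz0 Vz0]; split.
- by move=> _ [z [nz _] <-]; exists z.
- by exists (pt z0), z0.
- move=> z nz zlim; exists z => //; split=> //.
  have [K K0 hK] := negative_orth HJ nz.
  have zz0 := neg_neg_neq0 HJ nz nz.
  pose n := - qre (form z z); have n0 : 0 < n by rewrite oppr_gt0.
  (* A multiple of [w] differs from [z] by a vector [y] orthogonal to [z]. Then the square of [rho]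
     is [n / (n - qre (form y y))], so a distance below [e / (K * n)] forces
     [qre (form y y) < e / K], which [K] turns into a Euclidean bound. *)
  have app (e : R) : 0 < e -> exists w, V w /\ vn2 (w - z) < e.
    move=> e0; have e1 : 0 < e / (K * n) by rewrite divr_gt0 ?mulr_gt0.
    have [w [nw Sw zw]] := zlim _ e1.
    have Vw : V w := ptsofP (negative_neq0 nw) Sw.
    have zw0 := neg_neg_neq0 HJ nz nw.
    pose a := (form z w)^-1 * form z z.
    have a0 : a != 0 by rewrite qmul_eq0 negb_or qinv_neq0.
    exists (w *v a); split; first exact: Vscale.
    have : form z (w *v a - z) = 0 by rewrite formBr formZr /a mulrA qmulxV // mul1r subrr.
    have : w *v a = z + (w *v a - z) by rewrite addrC subrK.
    move: (w *v a - z) => y wE zy.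
    have nwa : negative J (w *v a) by exact: negativeZ.
    have qw : qre (form (w *v a) (w *v a)) = - (n - qre (form y y)).
      by rewrite wE formDr !formDl zy (form_eq0C Jh zy) add0r addr0 qreD opprB addrC /n opprK.
    have Y0 : 0 < n - qre (form y y) by rewrite -oppr_lt0 -qw.
    have r1 := rho_ge1 nz nwa.
    have hw : rho z (w *v a) < expR (e / (K * n) / 2).
      have : arcosh (rho z w) < e / (K * n) / 2 by move: zw; rewrite /hdist -/(rho _ _); lra.
      rewrite -(rhoZ _ _ (oner_neq0 _) a0) smul1 -ltr_expR; apply: le_lt_trans.
      by rewrite expR_arcosh // lerDl sqrtr_ge0.
    have r2 : rho z (w *v a) ^+ 2 = n / (n - qre (form y y)).
      rewrite /rho expr_div_n sqr_qabs qw wE formDr zy addr0 sqr_sqrtr; last first.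
        by rewrite -[qre (form z z)]opprK mulrNN mulr_ge0 ?ltW.
      rewrite -[qre (form z z)]opprK -/n mulrNN (form_diag Jh) -sqr_qabs qabs_real real_normK ?num_real //.
      rewrite -[qre (form z z)]opprK -/n sqrrN expr2 -mulf_div divff ?mul1r ?gt_eqF //.
    apply: le_lt_trans (hK _ zy) _.
    have : n / (n - qre (form y y)) < expR (e / (K * n)).
      rewrite -r2 [X in expR X]splitr expRD -expr2.
      by rewrite ltr_pXn2r // nnegrE ?expR_ge0 // (le_trans ler01).
    rewrite ltr_pdivrMr // mulrC -ltr_pdivrMr ?expR_gt0 // -expRN => h.
    have := expR_ge1Dx (- (e / (K * n))) => h2.
    have : n * (1 - e / (K * n)) < n - qre (form y y).
      by apply: le_lt_trans h; rewrite ler_pM2l.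
    rewrite mulrBr mulr1 ltrD2l ltrN2 (_ : n * _ = e / K); last by field; rewrite !gt_eqF.
    by rewrite ltr_pdivlMr // mulrC.
  have /choice[f hf] : forall k : nat, exists w, V w /\ vn2 (w - z) < (k.+1%:R^-1) ^+ 2.
    by move=> k; apply: app; rewrite exprn_gt0 // invr_gt0.
  apply: (Vlim (f := f)) => [k|e e0]; first by case: (hf k).
  have : \forall k \near \oo, k.+1%:R^-1 < e / m.+1%:R.
    by apply: near_infty_natSinv_lt (PosNum (divr_gt0 e0 (ltr0Sn _ m))).
  apply: filterS => k ke; rewrite /nrm.
  apply: (@le_lt_trans _ _ (\sum_(i < m) k.+1%:R^-1)).
    apply: ler_sum => i _; rewrite big_ord1 -(@ler_pXn2r _ 2) ?nnegrE ?qabs_ge0 ?invr_ge0 //.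
    rewrite sqr_qabs; apply: le_trans (ltW (hf k).2).
    rewrite /vn2 [leRHS](bigD1 i) //= lerDl sumr_ge0 // => ? _; exact: qnorm2_ge0.
  rewrite sumr_const card_ord -(mulr_natl _ m).
  rewrite ltr_pdivlMr // mulrC in ke; apply: le_lt_trans ke.
  by rewrite ler_wpM2r ?invr_ge0 // ler_nat.
- move=> c s t gc st Ss St u.
  have Vs := ptsofP (negative_neq0 (gc.1 s)) Ss.
  have Vt := ptsofP (negative_neq0 (gc.1 t)) St.
  exists (c u) => //; split; first by case: gc.
  wlog lt_st : s t st Ss St Vs Vt / s < t.
    by move=> W; case/lt_total/orP: (st) => h; [apply: (W s t)|apply: (W t s); rewrite // eq_sym].
  have [us|us|->//] := ltrgtP u s; first by case: (geodesic_closed gc us lt_st) => _ _; apply.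
  have [ut|ut|->//] := ltrgtP u t; first by case: (geodesic_closed gc us ut) => _ + _; apply.
  by case: (geodesic_closed gc lt_st ut) => + _ _; apply.
Qed.

End TotallyGeodesic.

(** * Fixed points of bounded groups, and Zariski density in terms of vectors *)

Section Subgroups.
Variables (R : realType) (m : nat).
Local Notation H := (quat R).
Variable J : 'M[H]_m.
Hypothesis HJ : lorentz J.
Implicit Types (x y z w p q : 'cV[H]_m) (a b c : H) (r : R) (A B f g : 'M[H]_m).
Local Notation form := (Defs.form J).
Let Jh := lorentz_adj HJ.

Lemma nrm_scalar1 a : nrm (a%:M : 'M[H]_1) = qabs a.
Proof. by rewrite /nrm !big_ord1 mxE eqxx mulr1n. Qed.

Lemma scalar1_inj a b : (a%:M : 'M[H]_1) = b%:M -> a = b.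
Proof. by move/matrixP => /(_ 0 0); rewrite !mxE eqxx !mulr1n. Qed.

(** Scalars are carried as 1 x 1 matrices, so that [mcvg] applies to them. *)
Lemma mcvg_form (K : Type) (F : set_system K) {FF : ProperFilter F}
    (f g : K -> 'cV[H]_m) z w : mcvg F f z -> mcvg F g w ->
  mcvg F (fun k => (form (f k) (g k))%:M : 'M[H]_1) (form z w)%:M.
Proof.
move=> fz gw; rewrite -form_mx.
apply: mcvg_ext (fun k => form_mx J (f k) (g k)) _.
by apply: mcvgM => //; apply: mcvgM; [exact: mcvg_adj|exact: mcvg_cst].
Qed.

Lemma mcvg_smul (K : Type) (F : set_system K) {FF : ProperFilter F}
    (f : K -> 'cV[H]_m) (g : K -> H) z a : mcvg F f z ->
  mcvg F (fun k => (g k)%:M : 'M[H]_1) a%:M -> mcvg F (fun k => f k *v g k) (z *v a).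
Proof. exact: mcvgM. Qed.

Lemma nrm_vn2 z : nrm z <= m%:R * Num.sqrt (vn2 z).
Proof.
rewrite /nrm; apply: (@le_trans _ _ (\sum_(i < m) Num.sqrt (vn2 z))).
  apply: ler_sum => i _; rewrite big_ord1 /qabs ler_sqrt ?vn2_ge0 //.
  by rewrite /vn2 [leRHS](bigD1 i) //= lerDl sumr_ge0 // => ? _; exact: qnorm2_ge0.
by rewrite sumr_const card_ord mulr_natl.
Qed.

Lemma form_SpVr A z w : Sp J A -> form (A *m z) w = form z (mxinv A *m w).
Proof. by move=> SA; rewrite -[RHS](form_Sp _ _ SA) mulmxA (SpKV SA) mul1mx. Qed.

Variable G : set 'M[H]_m.
Hypothesis HG : subgroup J G.

Lemma subG A : G A -> Sp J A. Proof. by case: HG => h _ _ _; apply: h. Qed.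
Lemma G1 : G 1%:M. Proof. by case: HG. Qed.
Lemma GM A B : G A -> G B -> G (A *m B). Proof. by case: HG => _ _ h _; apply: h. Qed.
Lemma GV A : G A -> G (mxinv A). Proof. by case: HG => _ _ _ h; apply: h. Qed.

(** The component of [w] orthogonal to [z] has square [qnorm2 (form z w) - 1], positive unless it
    vanishes. *)
Lemma strict_cosh z w : form z z = -1 -> form w w = -1 -> ~ onl z w ->
  1 < qabs (form z w).
Proof.
move=> qz qw zw; have nz : negative J z by rewrite /negative qz /= ltrN10.
have : form z (w + z *v form z w) = 0 by rewrite formDr formZr qz mulN1r addrN.
have : qre (form (w + z *v form z w) (w + z *v form z w)) = qnorm2 (form z w) - 1.
  rewrite formDr !formDl !formZr !(formZl Jh) qz qw (formC Jh z w).
  by move: (form z w) => a; rewrite /qnorm2 !qcE /=; ring.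
have : w + z *v form z w != 0.
  apply: contra_notN zw => /eqP h; exists (- form z w).
  by apply/eqP; rewrite smulNr -addr_eq0 h.
move: (w + _) => y y0 yy zy; have := neg_orth_pos HJ nz zy y0.
rewrite yy subr_gt0 -sqr_qabs => h.
by rewrite -(@ltr_pXn2r _ 2) ?nnegrE ?qabs_ge0 ?ler01 // expr1n.
Qed.

(** [v] is the sum of [z] and [w] divided by [s], where [s ^+ 2 = 2 + 2 * c]. As [s > 2], the bound
    [2 * u / s] is better than [u]: nonpositive curvature in the form needed for the uniqueness of
    centres. *)
Lemma midpoint z w (c : R) : form z z = -1 -> form w w = -1 ->
  form z w = qreal (- c) -> 1 < c ->
  exists2 s : R, 2 < s & exists2 v, form v v = -1 &
    forall x (u : R), qabs (form z x) <= u -> qabs (form w x) <= u ->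
      qabs (form v x) <= 2 * u / s.
Proof.
move=> qz qw zw c1; have c2 : 0 < 2 + 2 * c by lra.
have := sqr_sqrtr (ltW c2); move: (Num.sqrt _) (sqrtr_ge0 (2 + 2 * c)) => s s0 s2.
have s2' : 2 < s by rewrite -(@ltr_pXn2r _ 2) ?nnegrE // s2; lra.
exists s => //; exists ((z + w) *v qreal s^-1).
  rewrite (form_diag Jh) (formZZ Jh) formDr !formDl qz qw zw.
  rewrite (formC Jh z w) zw qconj_real /qnorm2 !qcE /= !expr0n /= !addr0 exprVn s2.
  by rewrite qrealN1; congr qreal; field; rewrite gt_eqF.
move=> x u zx wx; rewrite (formZl Jh) qconj_real qabsM qabs_real ger0_norm ?invr_ge0 //.
rewrite mulrC ler_pM2r ?invr_gt0 ?(lt_trans _ s2') // formDl (le_trans (qabsD _ _)) //.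
by move: (qabs _) (qabs _) zx wx => a b ha hb; lra.
Qed.

(* The fixed point is the centre of the smallest ball containing an orbit. *)
Lemma bounded_fix (C : R) : (forall A, G A -> nrm A <= C) ->
  exists2 z, negative J z & forall A, G A -> onl z (A *m z).
Proof.
move=> bnd; have [e [ee _ Fn _]] := form_spec HJ.
pose ok z (u : R) := form z z = -1 /\ forall A, G A -> qabs (form z (A *m e)) <= u.
(* [M u] says that a ball whose half radius has hyperbolic cosine [u] contains the orbit of [e]. *)
pose M := [set u | exists z, ok z u].
have qe : form e e = -1 by rewrite (form_diag Jh) ee qrealN1.
have form_le z w : qabs (form z w) <= nrm z * (nrm J * nrm w).
  rewrite -nrm_scalar1 -form_mx -mulmxA (le_trans (nrmM _ _)) // nrm_adj.
  by rewrite ler_wpM2l ?nrm_ge0 // nrmM.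
have M0 : M !=set0.
  exists (nrm e * (nrm J * (C * nrm e))), e; split=> // A GA.
  apply: le_trans (form_le _ _) _; rewrite !ler_wpM2l ?nrm_ge0 //.
  by apply: le_trans (nrmM _ _) _; rewrite ler_wpM2r ?nrm_ge0 ?bnd.
have lbM : has_lbound M.
  by exists 0 => u [z [_ /(_ _ G1)]]; apply: le_trans; exact: qabs_ge0.
have infM : has_inf M by [].
pose u0 := inf M.
have /choice[zs hz] : forall k : nat, exists z, ok z (u0 + k.+1%:R^-1).
  move=> k; have k0 : 0 < k.+1%:R^-1 :> R by rewrite invr_gt0.
  have [u [z [qz zA]] hu] := inf_adherent k0 infM; exists z; split=> // A GA.
  by apply: le_trans (zA A GA) _; exact: ltW.
have u00 : 0 <= u0.
  by apply: lb_le_inf => // u [z [_ /(_ _ G1)]]; apply: le_trans; exact: qabs_ge0.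
have [U [UU Uinf]] := nat_ultra; have PU := @ultra_proper _ _ UU.
have zbnd k : nrm (zs k) <= m%:R * Num.sqrt (2 * (u0 + 1) ^+ 2).
  apply: le_trans (nrm_vn2 _) _; rewrite ler_wpM2l // ler_sqrt; last first.
    by rewrite mulr_ge0 // sqr_ge0.
  have [qz zA] := hz k; rewrite -Fn qz /= (formC Jh) qnorm2_conj.
  have := zA _ G1; rewrite mul1mx -sqr_qabs => h.
  have k1 : k.+1%:R^-1 <= 1 :> R by rewrite invf_le1 // ler1n.
  have := qabs_ge0 (form (zs k) e); move: (qabs _) h => t h t0.
  have {}h : t <= u0 + 1 by apply: (le_trans h); rewrite lerD2l.
  have : t ^+ 2 <= (u0 + 1) ^+ 2 by rewrite ler_pXn2r // nnegrE addr_ge0.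
  by move: (t ^+ 2) ((u0 + 1) ^+ 2) => x y; lra.
have [z zlim] := ultra_cvg UU (nearW _ zbnd).
have qz : form z z = -1.
  apply: scalar1_inj; apply: (mcvg_unique (mcvg_form zlim zlim)).
  by apply: mcvg_ext (@mcvg_cst _ _ U _ _ _ (-1)%:M) => k; case: (hz k) => ->.
have zA A : G A -> qabs (form z (A *m e)) <= u0.
  move=> GA; apply/ler_addgt0Pr => d d0; rewrite -nrm_scalar1.
  apply: (mcvg_nrm_le (mcvg_form zlim (mcvg_cst (A *m e)))).
  have [N hN] : exists N : nat, N.+1%:R^-1 < d.
    have [N _ hN] := near_infty_natSinv_lt (PosNum d0).
    by exists N; apply: hN => /=.
  apply: filterS (Uinf N) => k Nk; rewrite nrm_scalar1.
  apply: le_trans ((hz k).2 A GA) _; rewrite lerD2l (le_trans _ (ltW hN)) //.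
  by rewrite lef_pV2 ?posrE // ler_nat.
exists z; first by rewrite /negative qz /= ltrN10.
(* [B] permutes the orbit, so [B *m z] is a centre for [u0] as well; were it another point, the
   midpoint would beat the infimum. *)
move=> B GB; apply: contrapT => zB; have SB := subG GB.
have qB : form (B *m z) (B *m z) = -1 by rewrite form_Sp.
have c1 := strict_cosh qz qB zB.
have [a a0 [fa ga na]] := align HJ qz qB erefl (lt_trans ltr01 c1).
have wA A : G A -> qabs (form (B *m z *v a) (A *m e)) <= u0.
  move=> GA; rewrite (formZl Jh) qabsM qabs_conj na mul1r.
  by rewrite form_SpVr // mulmxA; apply: zA; exact: (GM (GV GB) GA).
have [s s2 [v qv vle]] := midpoint qz ga fa c1.
have s0 : 0 < s by rewrite (lt_trans _ s2).
have : M (2 * u0 / s).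
  by exists v; split=> // A GA; apply: vle; [exact: zA|exact: wA].
move/(ge_inf lbM); rewrite -/u0 ler_pdivlMr // => h.
have : 0 < u0.
  apply: lt_le_trans (zA _ G1); rewrite mul1mx qabs_gt0.
  by apply: (neg_neg_neq0 HJ); rewrite /negative ?qz ?qe /= ltrN10.
move: h s2; clear -u0; nra.
Qed.

Hypothesis ZG : Zariski_dense J G.

Lemma no_fixed_neg z : negative J z -> ~ (forall A, G A -> onl z (A *m z)).
Proof.
move=> nz h; case: ZG => + _; apply; exists (pt z); first by left; exists z.
move=> A GA; rewrite act_pt; apply/esym/onl_pt; last exact: h.
exact: (Sp_mul_neq0 (subG GA) (negative_neq0 nz)).
Qed.

Lemma no_fixed_null z : null J z -> exists2 A, G A & ~ onl z (A *m z).
Proof.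
move=> nz; apply: contrapT => h; case: ZG => + _; apply.
exists (pt z); first by right; exists z.
move=> A GA; rewrite act_pt; apply/esym/onl_pt.
  by apply: (Sp_mul_neq0 (subG GA)); case: nz.
by apply: contrapT => ?; apply: h; exists A.
Qed.

(** Zariski density as a principle of proof: otherwise [ptsof J V] would be a proper invariant
    totally geodesic subspace. It is applied to a single geodesic and to the common eigenvectors of
    the Lie algebra. *)
Lemma invariant_full (V : 'cV[H]_m -> Prop) :
  (forall z a, V z -> V (z *v a)) ->
  (forall (f : nat -> 'cV[H]_m) z, (forall k, V (f k)) -> mcvg \oo f z -> V z) ->
  (forall z w r (x y : R), V z -> V w -> negative J z -> negative J w ->
     form z w = qreal r -> V (z *v qreal x + w *v qreal y)) ->
  (exists2 z, negative J z & V z) ->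
  (forall A z, G A -> negative J z -> V z -> V (A *m z)) ->
  forall z, negative J z -> V z.
Proof.
move=> Vs Vl Vc Vn Vi z nz; case: ZG => _ h; apply: contrapT => Vz; apply: h.
exists (ptsof J V); split.
- exact: ptsof_totally_geodesic.
- move=> E; apply: Vz; apply: (ptsofP (J := J) Vs (negative_neq0 nz)).
  by rewrite E; exists z.
- have sub A : G A -> act A @` ptsof J V `<=` ptsof J V.
    move=> GA _ [_ [w [nw Vw] <-] <-]; rewrite act_pt; exists (A *m w) => //.
    by split; [exact: (negative_Sp (subG GA) nw)|exact: (Vi _ _ GA nw)].
  move=> A GA; apply/seteqP; split; first exact: sub.
  move=> P SP; exists (act (mxinv A) P).
    by apply: (sub _ (GV GA)); exists P.
  by case: SP => w _ <-; rewrite !act_pt mulmxA (SpKV (subG GA)) mul1mx.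
Qed.

End Subgroups.

(** * Existence of a loxodromic element *)

Section Loxodromics.
Variables (R : realType) (m : nat).
Local Notation H := (quat R).
Variable J : 'M[H]_m.
Hypothesis HJ : lorentz J.
Implicit Types (x y z w p q u v : 'cV[H]_m) (a b c : H) (r : R) (A B f g : 'M[H]_m).
Local Notation form := (Defs.form J).
Let Jh := lorentz_adj HJ.

Definition mpow A k := iter k (mulmx A) 1%:M.

Lemma mpowS A k : mpow A k.+1 = A *m mpow A k. Proof. by []. Qed.

Lemma mpow_real (r : R) A k : mpow (qreal r *: A) k = qreal (r ^+ k) *: mpow A k.
Proof.
elim: k => [|k IH]; first by rewrite expr0 scale1r.
by rewrite !mpowS IH -scalemxAl mulmx_real scalerA -qrealM exprS.
Qed.

Lemma mcvg_mpow (K : Type) (F : set_system K) {FF : ProperFilter F}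
    (f : K -> 'M[H]_m) L k : mcvg F f L ->
  mcvg F (fun i => mpow (f i) k) (mpow L k).
Proof.
by move=> fL; elim: k => [|k IH]; [exact: mcvg_cst|exact: mcvgM].
Qed.

Lemma mpow_outer (w : 'cV[H]_m) (y : 'rV[H]_m) c k : y *m w = c%:M ->
  mpow (w *m y) k.+1 = w *m (c ^+ k)%:M *m y.
Proof.
move=> yw; elim: k => [|k IH]; first by rewrite mpowS /= mulmx1 expr0 mulmx1.
by rewrite mpowS IH -!mulmxA (mulmxA y w) yw (mulmxA c%:M) -scalar_mxM -exprS !mulmxA.
Qed.

Lemma retr_outer (w : 'cV[H]_m) (y : 'rV[H]_m) b c : y *m w = c%:M ->
  retr (w *m b%:M *m y) = qre (b * c).
Proof.
move=> yw; rewrite -mulmxA retrC -mulmxA yw -scalar_mxM /retr big_ord1.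
by rewrite mxE eqxx mulr1n.
Qed.

(** The equations make the columns, and likewise the rows, null and pairwise orthogonal, and such
    vectors lie on one null line. *)
Lemma isotropic_rank1 (L : 'M[H]_m) : L != 0 ->
  adjmx L *m J *m L = 0 -> L *m J *m adjmx L = 0 ->
  exists u v, [/\ null J u, null J v & L = u *m (adjmx v *m J)].
Proof.
move=> L0 LJL LJL'.
have cc i j : form (col i L) (col j L) = 0.
  rewrite form_def; have /matrixP/(_ i j) := LJL; rewrite [RHS]mxE => <-.
  rewrite !mxE; apply: eq_bigr => k _; rewrite !mxE; congr (_ * _).
  by apply: eq_bigr => l _; rewrite !adjmxE !mxE.
have [i ui] : exists i, col i L != 0.
  apply: contrapT => h; move/eqP: L0; apply; apply/matrixP => k i.
  have : col i L = 0 by apply/eqP/negPn/negP => ?; apply: h; exists i.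
  by move/matrixP => /(_ k 0); rewrite !mxE.
have nu : null J (col i L) by split.
have /choice[l hl] : forall j, exists a, col j L = col i L *v a.
  by move=> j; apply: (null_orth HJ nu (cc i j)).2; rewrite cc.
have LE : L = col i L *m \row_j l j.
  apply/matrixP => k j; have /matrixP/(_ k 0) := hl j; rewrite smulE mxE => ->.
  by rewrite !mxE big_ord1 !mxE.
pose u := col i L; pose y := \row_j l j.
exists u, (J *m adjmx y); have yE : adjmx (J *m adjmx y) *m J = y.
  by rewrite adjmxM adjmxK Jh -mulmxA lorentz_sqr // mulmx1.
split; [exact: nu| |by rewrite yE].
have y0 : adjmx y != 0.
  apply: contraNneq L0 => h; rewrite LE -/y (_ : y = 0) ?mulmx0 //.
  by rewrite -(adjmxK y) h raddf0.
split.
  apply: contraNneq y0 => h; rewrite -(mul1mx (adjmx y)) -(lorentz_sqr HJ) -mulmxA h.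
  by rewrite mulmx0.
have E : form (J *m adjmx y) (J *m adjmx y) = (y *m J *m adjmx y) 0 0.
  by rewrite form_def yE mulmxA.
have : u *m ((y *m J *m adjmx y) *m adjmx u) = 0.
  by rewrite -LJL' LE adjmxM !mulmxA.
rewrite E; move: (y *m J *m adjmx y) => S.
move: (mx11_scalar S); move: (S 0 0) => c -> h; apply/eqP/negPn/negP => c0; case: nu => /eqP u0 _; apply: u0.
have {}h : (u *v c) *m adjmx u = 0 by rewrite -mulmxA h.
apply/matrixP => k j; rewrite ord1 [RHS]mxE; have /matrixP/(_ k k) := h.
rewrite [LHS]mxE big_ord1 smulE adjmxE [RHS]mxE => /eqP.
by rewrite !qmul_eq0 qconj_eq0 (negPf c0) orbF orbb => /eqP.
Qed.

Variable G : set 'M[H]_m.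
Hypothesis HG : subgroup J G.
Hypothesis ZG : Zariski_dense J G.
Hypothesis m0 : (0 < m)%N.

Lemma G_mpow A k : G A -> G (mpow A k).
Proof. by move=> GA; elim: k => [|k IH]; [exact: (G1 HG)|exact: (GM HG)]. Qed.

Lemma Sp_adj A : Sp J A -> A *m J *m adjmx A = J.
Proof.
move=> SA; have [_ h] := (SpP HJ A).1 SA.
by rewrite -[RHS]mul1mx -h -!mulmxA lorentz_sqr // mulmx1.
Qed.

(** [G] is unbounded since a bounded group fixes a point. Divided by their norms, the [gs k]
    preserve [J] up to a factor tending to 0, and the limit is isotropic of rank one. *)
Lemma unbounded_limit : exists gs : nat -> 'M[H]_m, exists U : set_system nat,
  exists u v, [/\ forall k, G (gs k), UltraFilter U,
    (forall C : R, \forall k \near U, C < nrm (gs k)), null J u /\ null J v &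
    mcvg U (fun k => qreal (nrm (gs k))^-1 *: gs k) (u *m (adjmx v *m J))].
Proof.
have /choice[gs hgs] : forall k : nat, exists A, G A /\ k.+1%:R < nrm A.
  move=> k; apply: contrapT => h.
  have bnd A : G A -> nrm A <= k.+1%:R.
    by move=> GA; rewrite leNgt; apply/negP => ?; apply: h; exists A.
  have [z nz fz] := bounded_fix HJ HG bnd.
  exact: (no_fixed_neg HG ZG nz fz).
have [U [UU Uinf]] := nat_ultra; have PU := @ultra_proper _ _ UU.
have n1 k : 1 < nrm (gs k).
  by apply: le_lt_trans (hgs k).2; rewrite ler1n.
have n0 k : 0 < nrm (gs k) := lt_trans ltr01 (n1 k).
have ubd (C : R) : \forall k \near U, C < nrm (gs k).
  have [N hN] : exists N : nat, C < N%:R.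
    by exists (Num.bound `|C|); rewrite (le_lt_trans (ler_norm C)) // archi_boundP.
  apply: filterS (Uinf N) => k Nk; apply: lt_trans hN (le_lt_trans _ (hgs k).2).
  by rewrite ler_nat ltnW // ltnS.
pose Ls k := qreal (nrm (gs k))^-1 *: gs k.
have nL k : nrm (Ls k) = 1.
  by rewrite nrm_real gtr0_norm ?invr_gt0 // mulVf ?gt_eqF.
have [L Llim] : exists L, mcvg U Ls L.
  by apply: (ultra_cvg (C := 1) UU); apply: nearW => k; rewrite nL.
have L0 : L != 0.
  rewrite -nrm_gt0; apply: lt_le_trans ltr01 (mcvg_nrm_ge Llim _).
  by apply: nearW => k; rewrite nL.
have small : mcvg U (fun k => qreal ((nrm (gs k))^-1 ^+ 2) *: J) 0.
  move=> e e0; have e1 : 0 < nrm J + 1 by rewrite ltr_wpDl ?nrm_ge0.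
  apply: filterS (ubd ((nrm J + 1) / e)) => k hk; rewrite subr0 nrm_real.
  rewrite ger0_norm ?sqr_ge0 // expr2 -mulrA.
  apply: (@le_lt_trans _ _ ((nrm (gs k))^-1 * nrm J)).
    rewrite ler_wpM2l ?invr_ge0 ?nrm_ge0 // ler_piMl ?nrm_ge0 //.
    by rewrite invf_le1 // ltW.
  rewrite mulrC ltr_pdivrMr // mulrC -ltr_pdivrMr //; apply: lt_trans hk.
  by rewrite ltr_pM2r ?invr_gt0 // ltrDl.
have h1 : adjmx L *m J *m L = 0.
  apply: (mcvg_unique (mcvgM (mcvgM (mcvg_adj Llim) (mcvg_cst J)) Llim)).
  apply: mcvg_ext small => k; rewrite /Ls adjmx_real -!scalemxAl mulmx_real scalerA -qrealM.
  by have [_ ->] := subG HG (hgs k).1.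
have h2 : L *m J *m adjmx L = 0.
  apply: (mcvg_unique (mcvgM (mcvgM Llim (mcvg_cst J)) (mcvg_adj Llim))).
  apply: mcvg_ext small => k; rewrite /Ls adjmx_real -!scalemxAl mulmx_real scalerA -qrealM.
  by rewrite (Sp_adj (subG HG (hgs k).1)).
have [u [v [nu nv LE]]] := isotropic_rank1 L0 h1 h2.
by exists gs, U, u, v; split=> //; [move=> k; case: (hgs k)|rewrite -LE].
Qed.

Lemma exists_lox : exists2 A, G A & loxE A.
Proof.
have [gs [U [u [v [Ggs UU ubd [nu nv] Llim]]]]] := unbounded_limit.
have PU := @ultra_proper _ _ UU.
(* Otherwise every [B *m u] lies on the line of [v], as [u] itself does, and [G] fixes the point of
   [u]. *)
have [B GB vBu] : exists2 B, G B & form v (B *m u) != 0.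
  apply: contrapT => h; have vB B : G B -> onl v (B *m u).
    move=> GB; apply: (null_null_onl HJ nv (null_Sp (subG HG GB) nu)).
    by apply/eqP/negPn/negP => ?; apply: h; exists B.
  have := vB _ (G1 HG); rewrite mul1mx => vu.
  have [A GA] := no_fixed_null HG ZG nu; apply.
  exact: onl_trans (onl_sym nu.1 vu) (vB _ GA).
move: vBu; set c := form v _ => c0; have [k k0 ck] := qre_pow_gt0 c0.
have yw : adjmx v *m J *m (B *m u) = c%:M by rewrite form_mx.
pose Bs i := qreal (nrm (gs i))^-1 *: (B *m gs i).
have Blim : mcvg U (fun i => mpow (Bs i) k) (mpow (B *m u *m (adjmx v *m J)) k).
  apply: mcvg_mpow; rewrite -mulmxA; have h := mcvgM (mcvg_cst (F := U) B) Llim.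
  by apply: mcvg_ext (h _ _) => i; rewrite mulmx_real.
have tB : retr (mpow (B *m u *m (adjmx v *m J)) k) = qre (c ^+ k).
  by case: (k) k0 => // j _; rewrite (mpow_outer _ yw) (retr_outer _ yw) exprSr.
(* The second condition makes [nrm (gs i) * (qre (c ^+ k) / 2)] exceed [m]; its summand 1 gives
   [1 < nrm (gs i)], so that the [k]-th power of the norm is no smaller than the norm. *)
have [i [hi hn]] : exists i, qre (c ^+ k) / 2 < retr (mpow (Bs i) k) /\
    2 * m%:R / qre (c ^+ k) + 1 < nrm (gs i).
  have c2 : 0 < qre (c ^+ k) / 2 by rewrite divr_gt0.
  have [i [h1 h2]] := filter_ex (filterI (Blim _ c2) (ubd (2 * m%:R / qre (c ^+ k) + 1))).
  exists i; split=> //; have := le_lt_trans (retr_le_nrm _) h1.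
  by rewrite raddfB /= tB ltr_norml => /andP[]; lra.
have n1 : 1 < nrm (gs i).
  by apply: le_lt_trans hn; rewrite lerDr divr_ge0 ?mulr_ge0 // ltW.
exists (mpow (B *m gs i) k); first exact/G_mpow/(GM HG).
apply: (retr_loxE HJ m0); first exact/(subG HG)/G_mpow/(GM HG).
have E : mpow (B *m gs i) k = qreal (nrm (gs i) ^+ k) *: mpow (Bs i) k.
  rewrite /Bs mpow_real scalerA -qrealM -exprMn divff ?expr1n ?scale1r //.
  by rewrite gt_eqF // (lt_trans ltr01).
rewrite E retr_real; apply: (@lt_le_trans _ _ (nrm (gs i) * (qre (c ^+ k) / 2))).
  rewrite mulrA ltr_pdivlMr // mulrC -ltr_pdivrMr //; apply: lt_trans hn.
  by rewrite ltrDl.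
rewrite ler_pM ?nrm_ge0 ?divr_ge0 ?(ltW ck) ?(ltW hi) //.
by case: (k) k0 => // j _; rewrite exprS ler_peMr ?nrm_ge0 // exprn_ege1 // ltW.
Qed.

End Loxodromics.

Lemma qmulIr (R : realType) (a x y : quat R) : a != 0 -> x * a = y * a -> x = y.
Proof. by move=> a0 h; rewrite -[x]mulr1 -(qmulxV a0) mulrA h -mulrA qmulxV ?mulr1. Qed.

(** * Orbits on the boundary *)

Section Orbit.
Variables (R : realType) (m : nat).
Local Notation H := (quat R).
Variable J : 'M[H]_m.
Hypothesis HJ : lorentz J.
Implicit Types (x y z w p q u v : 'cV[H]_m) (a b c : H) (r : R) (A B f g : 'M[H]_m).
Local Notation form := (Defs.form J).
Let Jh := lorentz_adj HJ.

Section Axis.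
Variables p q : 'cV[H]_m.
Hypotheses (np : null J p) (nq : null J q) (pq : form p q = -1).

Let qp : form q p = -1.
Proof. by rewrite (formC Jh) pq qrealN1 qconj_real. Qed.

(* Lifts of the points of the real geodesic joining p and q. *)
Definition on_axis z := z + p *v form q z + q *v form p z = 0 /\
  form p z * form z q = form q z * form z p.

Lemma on_axis_param (s t : R) c : on_axis ((p *v qreal s + q *v qreal t) *v c).
Proof.
have [[_ pp] [_ qq]] := (np, nq).
have E1 : form q (p *v qreal s + q *v qreal t) = - qreal s.
  by rewrite formDr !formZr qp qq mul0r addr0 mulN1r.
have E2 : form p (p *v qreal s + q *v qreal t) = - qreal t.
  by rewrite formDr !formZr pq pp mul0r add0r mulN1r.
split.
  rewrite !formZr E1 E2 !mulNr !smulNr -!smulA mulmxDl.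
  by rewrite -addrA -opprD subrr.
rewrite !formZr !(formZl Jh) (formC Jh q) (formC Jh p) E1 E2.
rewrite -!qrealN !qconj_real -!mulrA.
have h (r1 r2 : R) : qreal r1 * (c * (qconj c * qreal r2)) = qreal (r1 * qnorm2 c * r2).
  by rewrite (mulrA c) qmulC -!qrealM mulrA.
by rewrite !h; congr qreal; ring.
Qed.

Lemma on_axisP z : negative J z -> on_axis z ->
  exists (t : R) c, c != 0 /\ z = (p + q *v qreal t) *v c.
Proof.
move=> nz [zE re]; set a := form q z in zE re; set b := form p z in zE re.
have {}zE : z = - (p *v a + q *v b) by apply/eqP; rewrite -addr_eq0 addrA zE.
have a0 : a != 0.
  apply/eqP => a0; move: nz; rewrite zE a0 smul0 add0r -smulNr /negative (formZZ Jh).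
  by rewrite nq.2 mulr0 ltxx.
have zq : form z q = qconj a by rewrite (formC Jh).
have zp : form z p = qconj b by rewrite (formC Jh).
have real (x : H) : x = qconj x -> x = qreal (qre x).
  case: x => x1 x2 x3 x4 [] h2 h3 h4; rewrite /qreal; congr Quat; lra.
have bE : b = qreal (qre (b * qconj a) / qnorm2 a) * a.
  apply: (@qmulIr _ (qconj a)); first by rewrite qconj_eq0.
  rewrite -mulrA qmulC -qrealM divfK ?qnorm2_eq0 //; apply: real.
  by rewrite qconjM qconjK -zq -zp.
exists (qre (b * qconj a) / qnorm2 a), (- a); split; first by rewrite oppr_eq0.
by rewrite smulNr mulmxDl smulA -bE.
Qed.

(** The real product forces the right multipliers of [z] and [w] in [on_axisP] to differ by a real
    factor, so that a real combination has again a single multiplier. *)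
Lemma on_axis_comb z w r (x y : R) : on_axis z -> on_axis w -> negative J z ->
  negative J w -> form z w = qreal r -> on_axis (z *v qreal x + w *v qreal y).
Proof.
move=> Vz Vw nz nw; have [t [c [c0 zE]]] := on_axisP nz Vz.
have [s [d [d0 wE]]] := on_axisP nw Vw.
have [[_ pp] [_ qq]] := (np, nq).
have fE : form (p + q *v qreal t) (p + q *v qreal s) = qreal (- (s + t)).
  rewrite formDr !formDl !formZr !(formZl Jh) pp qq pq qp qconj_real.
  by rewrite !(mulr0, mul0r, addr0, add0r) mulrN1 mulN1r -opprD -qrealD qrealN addrC.
have zw0 := neg_neg_neq0 HJ nz nw.
move: zw0; rewrite {1 2}zE {1 2}wE formZr (formZl Jh) fE -!mulrA qrealC.
have r0 : qreal (- (s + t)) != 0 :> H -> - (s + t) != 0 by rewrite qreal_eq0.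
rewrite mulrA !qmul_eq0 !negb_or => /andP[_ /r0 st0] E.
have {}E : d = c *  qreal (r / - (s + t) / qnorm2 c).
  have n0 : qnorm2 c != 0 by rewrite qnorm2_eq0.
  have {}E : qconj c * d = qreal (r / - (s + t)).
    apply: (qmulIr (_ : qreal (- (s + t)) != 0)); first by rewrite qreal_eq0.
    by rewrite -qrealM divfK.
  rewrite qrealM mulrA -E mulrA qmulC -qrealC mulrA -qrealM mulVf // mul1r //.
rewrite zE wE E -[_ *v (c * _)]smulA.
move: (r / _ / _) => k.
have -> : (p + q *v qreal t) *v c *v qreal x + (p + q *v qreal s) *v c *v qreal k *v qreal y =
   (p *v qreal (x + k * y) + q *v qreal (t * x + s * k * y)) *v c.
  rewrite !smulA -mulrA -qrealM -!qrealC -!smulA -mulmxDl; congr (_ *m _).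
  rewrite !mulmxDl !smulA -!qrealM addrACA -!smulDr -!qrealD.
  by rewrite mulrA.
exact: on_axis_param.
Qed.

Lemma on_axis_lim (f : nat -> 'cV[H]_m) z : (forall k, on_axis (f k)) ->
  mcvg \oo f z -> on_axis z.
Proof.
move=> Vf fz; have cst (w : 'cV[H]_m) : mcvg \oo (fun _ : nat => w) w by exact: mcvg_cst.
have fl w : mcvg \oo (fun k => (form w (f k))%:M : 'M[H]_1) (form w z)%:M by exact: mcvg_form.
have fr w : mcvg \oo (fun k => (form (f k) w)%:M : 'M[H]_1) (form z w)%:M by exact: mcvg_form.
split.
  apply: (@mcvg_unique _ _ \oo _ _ _ (fun k => f k + p *v form q (f k) + q *v form p (f k))).
    by apply: mcvgD; [apply: mcvgD => //; exact: mcvgM|exact: mcvgM].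
  by apply: mcvg_ext (mcvg_cst 0) => k; case: (Vf k).
apply: scalar1_inj; rewrite !scalar_mxM.
apply: (@mcvg_unique _ _ \oo _ _ _ (fun k => (form p (f k))%:M *m (form (f k) q)%:M : 'M[H]_1)).
  exact: mcvgM.
apply: mcvg_ext (mcvgM (fl q) (fr p)) => k.
by rewrite -!scalar_mxM; case: (Vf k) => _ ->.
Qed.

Lemma on_axis_swap A z a b : Sp J A -> negative J z -> on_axis z ->
  (A *m p = p *v a /\ A *m q = q *v b) \/ (A *m p = q *v a /\ A *m q = p *v b) ->
  on_axis (A *m z).
Proof.
move=> SA nz Vz h; have [t [c [c0 zE]]] := on_axisP nz Vz.
have ab : qconj a * b = 1.
  have : form (A *m p) (A *m q) = -1 by rewrite form_Sp.
  case: h => -[-> ->]; rewrite formZr (formZl Jh) ?pq ?qp mulrN1 mulNr.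
    exact: oppr_inj.
  exact: oppr_inj.
have a0 : qnorm2 a != 0.
  rewrite qnorm2_eq0; apply/eqP => a0; move: ab; rewrite a0 raddf0 mul0r.
  by move/esym/eqP; rewrite oner_eq0.
have bE : b = a * qreal (qnorm2 a)^-1.
  have h' : qreal (qnorm2 a) * b = a by rewrite -qmulC -mulrA ab mulr1.
  by rewrite -(qrealC _ a) -[X in _ * X]h' mulrA -qrealM mulVf // mul1r.
case: h => -[pE qE].
  have -> : A *m z = (p *v qreal 1 + q *v qreal (t / qnorm2 a)) *v (a * c).
    rewrite zE !mulmxA mulmxDr pE !mulmxA qE bE !smulA mulmxDl !smulA mulmxDl !smulA qreal1 mul1r.
    congr (_ + _ *v _); move: (qnorm2 a)^-1 => k.
    by apply: quatP; rewrite !qcE /=; ring.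
  exact: on_axis_param.
have -> : A *m z = (p *v qreal (t / qnorm2 a) + q *v qreal 1) *v (a * c).
  rewrite zE !mulmxA mulmxDr pE !mulmxA qE bE !smulA mulmxDl !smulA mulmxDl !smulA qreal1 mul1r.
  rewrite addrC; congr (_ *v _ + _); move: (qnorm2 a)^-1 => k.
  by apply: quatP; rewrite !qcE /=; ring.
exact: on_axis_param.
Qed.

End Axis.

Variable G : set 'M[H]_m.
Hypothesis HG : subgroup J G.
Hypothesis ZG : Zariski_dense J G.

(* A two-point orbit at infinity would leave its axis invariant. *)
Lemma orbit_escapes p q : null J p -> null J q -> form p q != 0 ->
  exists2 A, G A & ~ onl p (A *m p) /\ ~ onl q (A *m p).
Proof.
move=> np nq0 pq0; apply: contrapT => h.
have hA A : G A -> onl p (A *m p) \/ onl q (A *m p).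
  move=> GA; have [|h1] := pselect (onl p (A *m p)); first by left.
  have [|h2] := pselect (onl q (A *m p)); first by right.
  by exfalso; apply: h; exists A.
have qp0 : form q p != 0 by rewrite (formC Jh) qconj_eq0.
have [q' [qq' nq pq]] : exists q', [/\ onl q q', null J q' & form p q' = -1].
  exists (q *v - (form p q)^-1); split; first by exists (- (form p q)^-1).
    by apply: nullZ => //; rewrite oppr_eq0 qinv_neq0.
  by rewrite formZr mulrN qmulxV.
have q'q : onl q' q := onl_sym nq.1 qq'.
have [A1 GA1 h1] := no_fixed_null HG ZG np.
have [//|[a1 A1p]] := hA _ GA1.
have nA1p := null_Sp (subG HG GA1) np.
have [b1 b1E] : onl (A1 *m p) q'.
  by apply: onl_trans qq'; apply: onl_sym; [exact: nA1p.1|exists a1].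
have moves A : G A -> exists a b, (A *m p = p *v a /\ A *m q' = q' *v b) \/
    (A *m p = q' *v a /\ A *m q' = p *v b).
  move=> GA; have SA := subG HG GA.
  have hq : onl p (A *m q') \/ onl q (A *m q').
    rewrite b1E mulmxA mulmxA -[A *m A1 *m p *v b1]mulmxA.
    case: (hA _ (GM HG GA GA1)) => -[c E]; [left|right]; exists (c * b1);
      by rewrite mulmxA E smulA.
  have fA : form (A *m p) (A *m q') = -1 by rewrite form_Sp.
  have neq1 : -1 != 0 :> H by rewrite oppr_eq0 oner_eq0.
  case: (hA _ GA) => -[a aE]; case: hq => -[b bE].
  - by move: neq1; rewrite -fA aE bE formZr (formZl Jh) np.2 mulr0 mul0r eqxx.
  - have [c cE] : onl q' (A *m q') by apply: onl_trans q'q _; exists b.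
    by exists a, c; left.
  - have [c cE] : onl q' (A *m p) by apply: onl_trans q'q _; exists a.
    by exists c, b; right.
  - by move: neq1; rewrite -fA aE bE formZr (formZl Jh) nq0.2 mulr0 mul0r eqxx.
have full := invariant_full HJ HG ZG (V := on_axis p q').
(* With this parameter off the real line, [p + q' *v c] is negative but violates the second equation
   of [on_axis]. *)
pose c : H := Quat 1 1 0 0.
have qp' : form q' p = -1 by rewrite (formC Jh) pq qrealN1 qconj_real.
have nz : negative J (p + q' *v c).
  rewrite /negative formDr !formDl !formZr !(formZl Jh) np.2 nq.2 pq qp'.
  by rewrite !qcE /=; lra.
have cE : form p (p + q' *v c) * form (p + q' *v c) q' = c.
  rewrite formDr formDl formZr (formZl Jh) np.2 nq.2 pq.
  by rewrite mulr0 addr0 add0r mulrN1 mulN1r opprK.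
have : on_axis p q' (p + q' *v c).
  apply: full nz.
  - move=> z a [h2 h3]; split.
      by rewrite !formZr -!smulA -!mulmxDl h2 mul0mx.
    rewrite !formZr !(formZl Jh) -!mulrA !(mulrA a) qmulC.
    by rewrite ![qreal _ * _]qrealC !mulrA h3.
  - exact: on_axis_lim.
  - move=> z w r x y; exact: (on_axis_comb np nq pq).
  - exists (p + q').
      rewrite /negative formDr !formDl np.2 nq.2 pq qp' add0r addr0.
      by rewrite !qcE /=; lra.
    have := on_axis_param np nq pq 1 1 1.
    by rewrite qreal1 !smul1.
  - move=> A z GA nz' Vz; have [a [b ab]] := moves _ GA.
    exact: (on_axis_swap np nq pq (subG HG GA) nz' Vz ab).
case=> _; rewrite cE (formC Jh _ q') (formC Jh p) -qconjM cE => /(congr1 (@qi R)) /=.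
lra.
Qed.

End Orbit.

(** * The Lie algebra of the closure of the group *)

Section Tangent.
Variables (R : realType) (m : nat).
Local Notation H := (quat R).
Variable J : 'M[H]_m.
Hypothesis HJ : lorentz J.
Implicit Types (A B X Y : 'M[H]_m) (f g : R -> 'M[H]_m).
Let Jh := lorentz_adj HJ.
Local Notation "r *.: A" := (qreal r *: A) (at level 40).

Definition rpos : set_system R :=
  [set P | exists2 d : R, 0 < d & forall t, 0 < t -> t < d -> P t].

#[local] Instance rpos_filter : ProperFilter rpos.
Proof.
split=> [[d d0 /(_ (d / 2))]|].
  by apply; [rewrite divr_gt0|rewrite ltr_pdivrMr // ltr_pMr // ltr1n].
split; first by exists 1.
  move=> P Q [d d0 hP] [e e0 hQ]; exists (Num.min d e); first by rewrite lt_min d0.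
  by move=> t t0; rewrite lt_min => /andP[td te]; split; [exact: hP|exact: hQ].
by move=> P Q PQ [d d0 hP]; exists d => // t t0 td; apply/PQ/hP.
Qed.

Lemma rpos_gt0 : \forall t \near rpos, 0 < t.
Proof. by exists 1. Qed.
Lemma rpos_lt e : 0 < e -> \forall t \near rpos, t < e.
Proof. by exists e. Qed.

Variable G : set 'M[H]_m.
Hypothesis HG : subgroup J G.

(* The Lie algebra of the closure of G. *)
Definition tangent X := forall e, 0 < e -> \forall t \near rpos,
  exists A, G A /\ nrm (t^-1 *.: (A - 1%:M) - X) < e.

Definition curve_to X (f : R -> 'M[H]_m) := (forall t, G (f t)) /\
  mcvg rpos (fun t => t^-1 *.: (f t - 1%:M)) X.

Lemma curve_tangent X f : curve_to X f -> tangent X.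
Proof. by case=> Gf fX e /fX; apply: filterS => t h; exists (f t). Qed.

(** For each [t] an element is chosen whose defect [D t] is within [t] of the infimum. The curve
    need not be continuous; its difference quotient is all that is used. *)
Lemma tangent_curve X : tangent X -> exists f, curve_to X f.
Proof.
move=> TX; pose D (t : R) (g : 'M[H]_m) := nrm (t^-1 *.: (g - 1%:M) - X).
have /choice[f hf] : forall t : R, exists g : 'M[H]_m, G g /\
    (0 < t -> forall g' : 'M[H]_m, G g' -> D t g <= D t g' + t).
  move=> t; have [t0|t0] := ltP 0 t; last by exists 1%:M; split; [exact: (G1 HG)|].
  have infD : has_inf [set D t g | g in G].
    split; first by exists (D t 1%:M), 1%:M => //; exact: (G1 HG).
    by exists 0 => _ [g _ <-]; exact: nrm_ge0.
  have [_ [g Gg <-] hg] := inf_adherent t0 infD.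
  exists g; split=> // _ g' Gg'; rewrite (le_trans (ltW hg)) // lerD2r.
  by apply: ge_inf; [case: infD|exists g'].
exists f; split=> [t|e e0]; first by case: (hf t).
have e2 : 0 < e / 2 by rewrite divr_gt0.
apply: filterS3 (TX _ e2) (rpos_lt e2) rpos_gt0 => t [g [Gg hg]] te t0.
apply: le_lt_trans ((hf t).2 t0 g Gg) _.
by rewrite [e]splitr ltrD.
Qed.

Lemma curve_cvg1 X f : curve_to X f -> mcvg rpos f 1%:M.
Proof.
case=> Gf fX; apply/(mcvg_sub0 f 1%:M).
apply: (mcvg_to0 (u := fun t => t * (nrm X + 1))).
  move=> e e0; have X1 : 0 < nrm X + 1 by rewrite ltr_wpDl ?nrm_ge0.
  have e1 : 0 < e / (nrm X + 1) by rewrite divr_gt0.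
  by apply: filterS (rpos_lt e1) => t; rewrite ltr_pdivlMr.
apply: filterS2 (mcvg_bounded fX) rpos_gt0 => t h t0.
have -> : f t - 1%:M = t *.: (t^-1 *.: (f t - 1%:M)).
  by rewrite scalerA -qrealM divff ?gt_eqF // qreal1 scale1r.
by rewrite nrm_real gtr0_norm // ler_pM2l // ltW.
Qed.

Lemma curve_inv_cvg1 X f : curve_to X f -> mcvg rpos (fun t => mxinv (f t)) 1%:M.
Proof.
move=> cf; have -> : 1%:M = J *m adjmx 1%:M *m J by rewrite adjmx1 mulmx1 lorentz_sqr.
apply: (@mcvg_ext _ _ _ _ _ (fun t => J *m adjmx (f t) *m J)).
  by move=> t; rewrite (Sp_inv HJ) //; apply: (subG HG); case: cf.
have h : mcvg rpos (fun t => adjmx (f t)) (adjmx 1%:M).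
  by apply: mcvg_adj; exact: curve_cvg1 cf.
apply: mcvgM; [apply: mcvgM; [exact: mcvg_cst|exact: h]|exact: mcvg_cst].
Qed.

Lemma tangent0 : tangent 0.
Proof.
move=> e e0; apply: filterS rpos_gt0 => t t0; exists 1%:M; split; first exact: (G1 HG).
by rewrite subrr scaler0 subr0 nrm0.
Qed.

Lemma tangentD X Y : tangent X -> tangent Y -> tangent (X + Y).
Proof.
move=> /tangent_curve[f cf] /tangent_curve[g cg].
apply: (@curve_tangent _ (fun t => f t *m g t)); split=> [t|].
  by apply: (GM HG); [case: cf|case: cg].
have -> : X + Y = X *m 1%:M + Y by rewrite mulmx1.
apply: (@mcvg_ext _ _ _ _ _ (fun t => t^-1 *.: (f t - 1%:M) *m g t + t^-1 *.: (g t - 1%:M))).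
  move=> t; rewrite -scalemxAl -scalerDr mulmxBl mul1mx addrA; congr (_ *: _).
  by rewrite subrK.
by apply: mcvgD cg.2; apply: mcvgM cf.2 (curve_cvg1 cg).
Qed.

Lemma tangentN X : tangent X -> tangent (- X).
Proof.
move=> /tangent_curve[f cf].
apply: (@curve_tangent _ (fun t => mxinv (f t))); split=> [t|].
  by apply: (GV HG); case: cf.
have -> : - X = - (X *m 1%:M) by rewrite mulmx1.
apply: (@mcvg_ext _ _ _ _ _ (fun t => - (t^-1 *.: (f t - 1%:M) *m mxinv (f t)))).
  move=> t; have Sf : Sp J (f t) by apply: (subG HG); case: cf.
  by rewrite -scalemxAl mulmxBl (SpKV Sf) mul1mx -scalerN opprB.
by apply: mcvgN; apply: mcvgM cf.2 (curve_inv_cvg1 cf).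
Qed.

Lemma tangentZ_pos (r : R) X : 0 < r -> tangent X -> tangent (r *.: X).
Proof.
move=> r0 /tangent_curve[f cf].
apply: (@curve_tangent _ (fun t => f (r * t))); split=> [t|]; first by case: cf.
have h : mcvg rpos (fun t => (r * t)^-1 *.: (f (r * t) - 1%:M)) X.
  apply: (mcvg_comp (h := fun t => r * t) _ cf.2) => P [d d0 hP].
  exists (d / r); first by rewrite divr_gt0.
  by move=> t t0 td /=; apply: hP; rewrite ?mulr_gt0 // mulrC -ltr_pdivlMr.
move=> e e0; have er : 0 < e / r by rewrite divr_gt0.
apply: filterS (h _ er) => t; rewrite ltr_pdivlMr // mulrC -[r in r * _](gtr0_norm r0).
rewrite -nrm_real scalerBr scalerA -qrealM invfM mulrA divff ?mul1r //.
by rewrite gt_eqF.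
Qed.

Lemma tangentZ (r : R) X : tangent X -> tangent (r *.: X).
Proof.
move=> TX; have [r0|r0|<-] := ltrgtP 0 r; first exact: tangentZ_pos.
  have r1 : 0 < - r by rewrite oppr_gt0.
  by have := tangentN (tangentZ_pos r1 TX); rewrite qrealN scaleNr opprK.
by rewrite scale0r; exact: tangent0.
Qed.

Lemma tangent_conj A X : G A -> tangent X -> tangent (A *m X *m mxinv A).
Proof.
move=> GA /tangent_curve[f cf].
apply: (@curve_tangent _ (fun t => A *m f t *m mxinv A)); split=> [t|].
  by apply: (GM HG _ (GV HG GA)); apply: (GM HG GA); case: cf.
apply: (@mcvg_ext _ _ _ _ _ (fun t => A *m (t^-1 *.: (f t - 1%:M)) *m mxinv A)).
  move=> t; rewrite mulmx_real -scalemxAl mulmxBr mulmxBl mulmx1.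
  by rewrite (SpKV (subG HG GA)).
apply: mcvgM; last exact: mcvg_cst.
by apply: mcvgM cf.2; exact: mcvg_cst.
Qed.

Lemma comm_sub1 A B : (A - 1%:M) *m (B - 1%:M) - (B - 1%:M) *m (A - 1%:M) = A *m B - B *m A.
Proof.
rewrite !mulmxBl !mulmxBr !mul1mx !mulmx1; move: (A *m B) (B *m A) => a b.
by rewrite -[a - A - _]addrA -[b - B - _]addrA -!opprD (addrCA B A); move: (A + _) => S; rewrite opprB addrA subrK.
Qed.

(** The commutator of [f t] and [g t] differs from 1 by [t ^+ 2] times the bracket, up to smaller
    terms; hence the parameter [Num.sqrt t]. *)
Lemma tangent_bracket X Y : tangent X -> tangent Y -> tangent (X *m Y - Y *m X).
Proof.
move=> /tangent_curve[f cf] /tangent_curve[g cg].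
pose b t := f t *m g t *m mxinv (f t) *m mxinv (g t).
apply: (@curve_tangent _ (fun t => b (Num.sqrt t))); split=> [t|].
  have [Gf Gg] := (cf.1, cg.1).
  by apply: (GM HG); [apply: (GM HG); [exact: (GM HG)|exact: (GV HG)]|exact: (GV HG)].
pose D (h : R -> 'M[H]_m) t := t^-1 *.: (h t - 1%:M).
pose c t := (D f t *m D g t - D g t *m D f t) *m mxinv (f t) *m mxinv (g t).
have cE t : t^-1 ^+ 2 *.: (b t - 1%:M) = c t.
  have Sf : Sp J (f t) by apply: (subG HG); case: cf.
  have Sg : Sp J (g t) by apply: (subG HG); case: cg.
  have bE : b t - 1%:M = (f t *m g t - g t *m f t) *m mxinv (f t) *m mxinv (g t).
    by rewrite !mulmxBl -/(b t) -(mulmxA (g t)) (SpKV Sf) mulmx1 (SpKV Sg).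
  by rewrite bE -comm_sub1 /c /D -!scalemxAl !mulmx_real !scalerA -!qrealM -expr2 -scalerBr -!scalemxAl.
have cXY : mcvg rpos c (X *m Y - Y *m X).
  rewrite -[_ - _]mulmx1 -[_ *m 1%:M]mulmx1.
  apply: mcvgM (curve_inv_cvg1 cg); apply: mcvgM (curve_inv_cvg1 cf).
  by apply: mcvgB; [exact: mcvgM cf.2 cg.2|exact: mcvgM cg.2 cf.2].
have h : mcvg rpos (c \o Num.sqrt) (X *m Y - Y *m X).
  apply: mcvg_comp cXY => P [d d0 hP]; exists (d ^+ 2); first by rewrite exprn_gt0.
  move=> t t0 td /=; apply: hP; rewrite ?sqrtr_gt0 //.
  by rewrite -(@ltr_pXn2r _ 2) ?nnegrE ?sqrtr_ge0 ?(ltW d0) // sqr_sqrtr // ltW.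
apply: mcvg_eq h; apply: filterS rpos_gt0 => t t0 /=.
by rewrite -cE exprVn sqr_sqrtr // ltW.
Qed.

Lemma tangent_closed (K : Type) (F : set_system K) {FF : ProperFilter F}
    (Xs : K -> 'M[H]_m) X : (\forall k \near F, tangent (Xs k)) ->
  mcvg F Xs X -> tangent X.
Proof.
move=> TXs XsX e e0; have e2 : 0 < e / 2 by rewrite divr_gt0.
have [k [h1 h2]] := filter_ex (filterI TXs (XsX _ e2)).
apply: filterS (h1 _ e2) => t [f [Gf hf]]; exists f; split=> //.
rewrite -(subrK (Xs k) (_ *: _)) -addrA (le_lt_trans (nrmD _ _)) //.
by rewrite [e]splitr ltrD.
Qed.

Lemma tangent_skew X : tangent X -> adjmx X *m J = - (J *m X).
Proof.
move=> /tangent_curve[f cf]; apply/eqP; rewrite -addr_eq0; apply/eqP.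
have h : mcvg rpos (fun t => adjmx (t^-1 *.: (f t - 1%:M)) *m J *m f t +
    J *m (t^-1 *.: (f t - 1%:M))) (adjmx X *m J *m 1%:M + J *m X).
  apply: mcvgD; last by apply: mcvgM cf.2; exact: mcvg_cst.
  apply: mcvgM (curve_cvg1 cf); apply: mcvgM; [exact: mcvg_adj cf.2|exact: mcvg_cst].
rewrite mulmx1 in h; apply: (mcvg_unique h).
apply: mcvg_ext (mcvg_cst 0) => t; have [_ fJ] := subG HG (cf.1 t).
rewrite adjmx_real mulmx_real -!scalemxAl -scalerDr raddfB /= adjmx1.
rewrite mulmxBr mulmx1 !mulmxBl fJ mul1mx addrA.
by rewrite subrK subrr scaler0.
Qed.

Lemma retr_inv A : Sp J A -> retr (mxinv A) = retr A.
Proof.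
by move=> SA; rewrite (Sp_inv HJ) // retrC mulmxA lorentz_sqr // mul1mx retr_adj.
Qed.

(** (A - 1)^2 A^-1 = A - 2 + A^-1 has real trace [2 * (retr A - m)], as inversion preserves [retr].
    Along a curve, divided by [t ^+ 2], it tends to [X *m X]. *)
Lemma tangent_retr_le0 (e0 : R) X : 0 < e0 ->
  (forall A, G A -> nrm (A - 1%:M) < e0 -> retr A <= m%:R) ->
  tangent X -> retr (X *m X) <= 0.
Proof.
move=> e00 small /tangent_curve[f cf]; rewrite -[X *m X]mulmx1.
pose D t := t^-1 *.: (f t - 1%:M).
apply: (mcvg_retr_le (mcvgM (mcvgM cf.2 cf.2) (curve_inv_cvg1 cf))).
apply: filterS (curve_cvg1 cf e00) => t ft; have Sf := subG HG (cf.1 t).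
rewrite -!scalemxAl mulmx_real -!scalemxAl scalerA -qrealM retr_real.
rewrite -mulmxA (mulmxBl (f t) 1%:M (mxinv (f t))) (SpKV Sf) mul1mx mulmxBl mulmxBr mulmx1 (SpKV Sf) mul1mx.
rewrite !raddfB /= retr_inv // retr1.
have := small _ (cf.1 t) ft; rewrite -expr2 => h.
by apply: mulr_ge0_le0; [exact: sqr_ge0|rewrite -[1 *- m]/(- m%:R); lra].
Qed.

(** The error is quadratic in the total displacement [N * nrm B], uniformly in the number of
    factors, so that long products of tiny elements stay under control. *)
Lemma mpow_linear B N : N%:R * nrm B <= 1 ->
  nrm (mpow (1%:M + B) N - 1%:M - N%:R *.: B) <= (N%:R * nrm B) ^+ 2.
Proof.
have B0 := nrm_ge0 B; elim: N => [|N IH] hN.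
  by rewrite subrr qreal0 scale0r subr0 nrm0 mul0r expr0n.
have hN' : N%:R * nrm B <= 1.
  by apply: le_trans hN; rewrite ler_wpM2r // ler_nat.
have {}IH := IH hN'; set r := mpow _ N - 1%:M - _ in IH.
have NE : N.+1%:R = 1 + N%:R :> R by rewrite -natr1 addrC.
have -> : mpow (1%:M + B) N.+1 - 1%:M - N.+1%:R *.: B = r + B *m (r + N%:R *.: B).
  rewrite /r subrK mpowS mulmxDl mul1mx mulmxBr mulmx1 NE qrealD scalerDl qreal1 scale1r.
  move: (mpow _ N) (N%:R *.: B) => M c; move: (B *m M) => b.
  by rewrite opprD !addrA [M + b - _]addrAC [LHS]addrAC [M - _ + b - c]addrAC.
apply: le_trans (nrmD _ _) _; apply: (@le_trans _ _ (nrm r + nrm B * (nrm r + N%:R * nrm B))).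
  rewrite lerD2l (le_trans (nrmM _ _)) // ler_wpM2l // (le_trans (nrmD _ _)) //.
  by rewrite nrm_real ger0_norm.
rewrite NE; move: (nrm r) (nrm_ge0 r) IH => x x0 IH; move: (N%:R : R) (ler0n R N) hN' IH => n n0 hN' IH.
move: (nrm B) B0 IH hN' => t t0 IH hN'.
have : x * (1 + t) <= (n * t) ^+ 2 * (1 + t) by apply: ler_wpM2r IH; rewrite addr_ge0.
have : n * t * (n * t * t) <= n * t * t by rewrite ler_piMl // !mulr_ge0.
nra.
Qed.

(** [X] is a limit of the normalized [a k - 1]. To reach [1 + s X] for every small [s], and not only
    at the scales [t k], one takes the power of [a k] whose exponent is [s / t k] rounded down. *)
Lemma tangent_exists : (forall e, 0 < e -> exists A, [/\ G A, A <> 1%:M & nrm (A - 1%:M) < e]) ->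
  exists2 X, X != 0 & tangent X.
Proof.
move=> nd; have /choice[a ha] : forall k : nat, exists A,
    [/\ G A, A <> 1%:M & nrm (A - 1%:M) < k.+1%:R^-1].
  by move=> k; apply: nd; rewrite invr_gt0.
pose t k := nrm (a k - 1%:M).
have t0 k : 0 < t k.
  by rewrite nrm_gt0 subr_eq0; apply/eqP; case: (ha k).
have [U [UU Uinf]] := nat_ultra; have PU := @ultra_proper _ _ UU.
have tU e : 0 < e -> \forall k \near U, t k < e.
  move=> e0; have [N _ hN] := near_infty_natSinv_lt (PosNum e0).
  apply: filterS (Uinf N) => k Nk; case: (ha k) => _ _ h.
  exact: lt_trans h (hN _ Nk).
pose Xs k := (t k)^-1 *.: (a k - 1%:M).
have nX k : nrm (Xs k) = 1.
  by rewrite nrm_real gtr0_norm ?invr_gt0 // mulVf ?gt_eqF.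
have [X XsX] : exists X, mcvg U Xs X.
  by apply: (ultra_cvg (C := 1) UU); apply: nearW => k; rewrite nX.
have X1 : nrm X <= 1 by apply: (mcvg_nrm_le XsX); apply: nearW => k; rewrite nX.
exists X.
  by rewrite -nrm_gt0; apply: lt_le_trans ltr01 (mcvg_nrm_ge XsX _); apply: nearW => k; rewrite nX.
move=> e e0; have e4 : 0 < e / 4 by rewrite divr_gt0.
(* Three errors of at most a quarter of [e]: [s] from [mpow_linear], the distance from [Xs k] to
   [X], and the rounding of the exponent. *)
have d0 : 0 < Num.min 1 (e / 4) by rewrite lt_min ltr01.
apply: filterS2 rpos_gt0 (rpos_lt d0) => s s0; rewrite lt_min => /andP[s1 se].
have se0 : 0 < s * (e / 4) by rewrite mulr_gt0.
have [k [h1 h2]] := filter_ex (filterI (XsX _ e4) (tU _ se0)).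
pose N := Num.truncn (s / t k).
have /andP[N1 N2] := Num.Theory.truncn_itv (divr_ge0 (ltW s0) (ltW (t0 k))).
rewrite -/N in N1 N2; rewrite ler_pdivlMr // in N1; rewrite ltr_pdivrMr // in N2.
exists (mpow (a k) N); split; first by apply: (G_mpow HG); case: (ha k).
have Nt1 : N%:R * nrm (a k - 1%:M) <= 1 by rewrite -/(t k) (le_trans N1) // ltW.
have aE : 1%:M + (a k - 1%:M) = a k by rewrite addrC subrK.
have := mpow_linear Nt1; rewrite aE; set r := mpow _ _ - _ - _ => hr.
have rE : mpow (a k) N - 1%:M = r + (N%:R * t k) *.: Xs k.
  by rewrite /Xs scalerA -qrealM mulfK ?gt_eqF // subrK.
pose c := s^-1 * (N%:R * t k).
have c1 : c <= 1 by rewrite /c mulrC ler_pdivrMr // mul1r.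
have c0 : 0 <= c by rewrite /c mulr_ge0 ?invr_ge0 ?(ltW s0) // mulr_ge0 ?(ltW (t0 k)).
have c2 : 1 - c <= e / 4.
  rewrite -(ler_pM2l s0) mulrBr mulr1 /c mulrA divff ?gt_eqF // mul1r.
  by rewrite -natr1 mulrDl mul1r in N2; move: N2 h2; move: (N%:R * t k) (t k) => x y; lra.
have -> : s^-1 *.: (mpow (a k) N - 1%:M) - X =
    s^-1 *.: r + (c *.: (Xs k - X) - (1 - c) *.: X).
  rewrite rE scalerDr scalerA -qrealM -/c -addrA; congr (_ + _).
  by rewrite scalerBr qrealB scalerBl qreal1 scale1r opprB addrA subrK.
apply: le_lt_trans (nrmD _ _) _.
have b1 : nrm (s^-1 *.: r) <= s.
  rewrite nrm_real ger0_norm ?invr_ge0 ?(ltW s0) // mulrC ler_pdivrMr // -expr2.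
  apply: le_trans hr _; rewrite ler_pXn2r ?nnegrE ?mulr_ge0 ?nrm_ge0 ?(ltW s0) //.
have b2 : nrm (c *.: (Xs k - X) - (1 - c) *.: X) <= e / 4 + e / 4.
  apply: le_trans (nrmB _ _) _; rewrite !nrm_real ger0_norm // ger0_norm ?subr_ge0 //.
  apply: lerD.
    by apply: le_trans (ltW h1); rewrite ler_piMl ?nrm_ge0.
  by apply: le_trans c2; rewrite ler_piMr ?subr_ge0.
lra.
Qed.

End Tangent.

Lemma qre_sqr_le0 (R : realType) (x : quat R) : qre x = 0 -> qre (x * x) <= 0.
Proof. by move=> x0; rewrite qreM x0; nra. Qed.

Lemma zmod_swap (V : zmodType) (a b c d e : V) :
  a - b + e = a - c - (b - d) + (c - d + e).
Proof. by rewrite opprB [RHS]addrA; congr (_ + _); rewrite addrACA subrK [d - b]addrC addrK. Qed.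

(** * Iterated brackets with a nilpotent matrix *)

Section Ad.
Variables (S : pzRingType) (m : nat).
Implicit Types U Y : 'M[S]_m.

(** The double bracket [U, [U, Y]], multiplied out. *)
Definition ad2 U Y := U *m U *m Y - U *m Y *m U - (U *m Y *m U - Y *m U *m U).

(** Bracketing with [U] is the difference of two commuting operators of cube 0, left and right
    multiplication; in its fourth power only the middle term survives, with binomial coefficient
    6. *)
Lemma ad2_ad2 U Y : U *m U *m U = 0 ->
  ad2 U (ad2 U Y) = (U *m U *m Y *m U *m U) *+ 6.
Proof.
move=> U3; have U3' : U *m (U *m U) = 0 by rewrite mulmxA.
have h1 : U *m U *m ad2 U Y = U *m U *m Y *m U *m U.
  by rewrite /ad2 !mulmxBr !mulmxA U3 !mul0mx subrr !sub0r opprK.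
have h2 : ad2 U Y *m U *m U = U *m U *m Y *m U *m U.
  by rewrite /ad2 !mulmxBl -!mulmxA !U3' !mulmx0 !subr0.
have h3 : U *m ad2 U Y *m U = - (U *m U *m Y *m U *m U + U *m U *m Y *m U *m U).
  rewrite /ad2 !mulmxBr !mulmxBl !mulmxA U3 !mul0mx sub0r.
  by rewrite -[U *m Y *m U *m U *m U]mulmxA -[U *m Y *m U *m (U *m U)]mulmxA U3' mulmx0 subr0 opprD.
move: h1 h2 h3; move: (ad2 U Y) (U *m U *m Y *m U *m U) => E W h1 h2 h3.
by rewrite /ad2 h1 h2 h3 !opprD !opprK !mulrS mulr0n addr0 !addrA.
Qed.

Lemma mul_ad2 U Y : U *m ad2 Y U =
  U *m Y *m Y *m U - U *m Y *m U *m Y - (U *m Y *m U *m Y - U *m U *m Y *m Y).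
Proof. by rewrite /ad2 !mulmxBr !mulmxA. Qed.

Lemma sqr_sub_add (A B C : 'M[S]_m) : (A - B + C) *m (A - B + C) =
  A *m A - A *m B + A *m C - (B *m A - B *m B + B *m C) + (C *m A - C *m B + C *m C).
Proof. by rewrite mulmxDl mulmxBl !(mulmxDr _ (A - B) C) !mulmxBr. Qed.

End Ad.

Lemma retrD (R : realType) m (A B : 'M[quat R]_m) : retr (A + B) = retr A + retr B.
Proof. exact: raddfD. Qed.
Lemma retrB (R : realType) m (A B : 'M[quat R]_m) : retr (A - B) = retr A - retr B.
Proof. exact: raddfB. Qed.
Lemma retrBBB (R : realType) m (A B C D : 'M[quat R]_m) :
  retr (A - B - (C - D)) = retr A - retr B - (retr C - retr D).
Proof. by rewrite retrB; congr (_ - _); rewrite retrB. Qed.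

(** * Exclusion of nilpotent root elements *)

Section NoSmallLoxodromic.
Variables (R : realType) (m : nat).
Local Notation H := (quat R).
Variable J : 'M[H]_m.
Hypothesis HJ : lorentz J.
Implicit Types (x y z w p q : 'cV[H]_m) (a b c : H) (r : R) (A B X Y U : 'M[H]_m).
Local Notation form := (Defs.form J).
Let Jh := lorentz_adj HJ.

(** The operator x |-> p b <q, x>. The factor [J] makes it equivariant under [Sp J], see
    [outer_conj]. *)
Definition outer p b q : 'M[H]_m := p *v b *m (adjmx q *m J).

Lemma outer_app p b q x : outer p b q *m x = p *v (b * form q x).
Proof. by rewrite /outer -mulmxA form_mx smulA. Qed.

Lemma outer_mul p b q p' b' q' :
  outer p b q *m outer p' b' q' = outer p (b * form q p' * b') q'.
Proof. by rewrite {2}/outer mulmxA outer_app formZr mulrA. Qed.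

Lemma retr_outer_form p b q : retr (outer p b q) = qre (b * form q p).
Proof. by apply: retr_outer; exact: form_mx. Qed.

Lemma outerD p b b' q : outer p (b + b') q = outer p b q + outer p b' q.
Proof. by rewrite /outer smulDr mulmxDl. Qed.

Lemma outerN p b q : outer p (- b) q = - outer p b q.
Proof. by rewrite /outer smulNr mulNmx. Qed.

Lemma outer0 p q : outer p 0 q = 0.
Proof. by rewrite /outer smul0 mul0mx. Qed.

Lemma outer_smull p a b q : outer (p *v a) b q = outer p (a * b) q.
Proof. by rewrite /outer smulA. Qed.

Lemma outer_smulr p a b q : outer p b (q *v a) = outer p (b * qconj a) q.
Proof. by rewrite /outer adjmxM adjmx_scalar -smulA !mulmxA. Qed.

Lemma outer_mull A p b q : A *m outer p b q = outer (A *m p) b q.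
Proof. by rewrite /outer !mulmxA. Qed.

Lemma outer_conj A p b q : Sp J A ->
  A *m outer p b q *m mxinv A = outer (A *m p) b (A *m q).
Proof.
move=> SA; rewrite outer_mull /outer -[LHS]mulmxA; congr (_ *m _).
by rewrite (Sp_inv HJ) // !mulmxA -(mulmxA _ J J) lorentz_sqr // mulmx1 -adjmxM.
Qed.

Lemma outerBl p p' b q : outer (p - p') b q = outer p b q - outer p' b q.
Proof. by rewrite /outer !mulmxBl. Qed.

Lemma outerBr p b q q' : outer p b (q - q') = outer p b q - outer p b q'.
Proof. by rewrite /outer raddfB /= mulmxBl mulmxBr. Qed.

Lemma outer_muln p b q k : outer p b q *+ k = outer p (b *+ k) q.
Proof.
elim: k => [|k IH]; first by rewrite !mulr0n outer0.
by rewrite !mulrS outerD IH.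
Qed.

Lemma outer0l b q : outer 0 b q = 0. Proof. by rewrite /outer !mul0mx. Qed.
Lemma outer0r p b : outer p b 0 = 0. Proof. by rewrite /outer raddf0 mul0mx mulmx0. Qed.

Local Opaque outer.

Variable G : set 'M[H]_m.
Hypothesis HG : subgroup J G.
Hypothesis ZG : Zariski_dense J G.
Local Notation T := (tangent G).
Hypothesis neg : forall X, T X -> retr (X *m X) <= 0.

Lemma form_skew X x y : T X -> form x (X *m y) = - form (X *m x) y.
Proof.
move=> TX; rewrite !form_def adjmxM -(mulmxA (adjmx x) (adjmx X) J) (tangent_skew HG TX).
by rewrite mulmxN mulNmx [in RHS]mxE opprK !mulmxA.
Qed.

Lemma radical U Y : T U -> retr (U *m U) = 0 -> T Y -> retr (U *m Y) = 0.
Proof.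
move=> TU UU TY; apply/eqP/negPn/negP => UY.
(* The multiple of [U] is chosen so that the square of the sum has real trace exactly 1. *)
have := neg (tangentD HG TY (tangentZ HJ HG ((1 - retr (Y *m Y)) / (2 * retr (U *m Y))) TU)).
set r := _ / _; rewrite mulmxDl !mulmxDr -!scalemxAl !mulmx_real !raddfD /= !retr_real UU.
rewrite [retr (Y *m U)]retrC mulr0 mulr0 addr0.
have -> : r * retr (U *m Y) = (1 - retr (Y *m Y)) / 2 by rewrite /r; field.
by lra.
Qed.

(** Put [c = form p (Y *m p)]. By [radical], [U] gives [qre (b * c) = 0], and [[U, Y], U] = 2 U Y U
    gives the same for the square of [b * c]; hence [c = 0]. With the conjugates of [U] as [Y], all
    of [G] would fix the point of [p]. *)
Lemma no_highest_root p b : null J p -> b != 0 -> ~ T (outer p b p).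
Proof.
move=> np b0 TU.
have OO c c' : outer p c p *m outer p c' p = 0.
  by rewrite outer_mul np.2 mulr0 mul0r outer0.
have tO c Y : retr (outer p c p *m Y) = qre (c * form p (Y *m p)).
  by rewrite retrC outer_mull retr_outer_form.
have r0 c : retr (outer p c p *m outer p c p) = 0 by rewrite OO raddf0.
have fY Y : T Y -> form p (Y *m p) = 0.
  move=> TY; set c := form p (Y *m p).
  have h1 : qre (b * c) = 0 by rewrite -tO; exact: radical.
  have OYO : outer p b p *m Y *m outer p b p = outer p (b * c * b) p.
    by rewrite -mulmxA outer_mull outer_mul.
  have TW : T (outer p (b * c * b + b * c * b) p).
    have := tangent_bracket HJ HG (tangent_bracket HJ HG TU TY) TU.
    rewrite mulmxBl mulmxBr OYO -[Y *m _ *m _]mulmxA OO mulmx0 subr0 mulmxA OO mul0mx.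
    by rewrite mulmxA OYO sub0r opprK -outerD.
  have h2 : qre ((b * c) * (b * c)) = 0.
    by have := radical TW (r0 _) TY; rewrite tO -/c mulrDl raddfD /= !mulrA; lra.
  by have /eqP := qre_sqr0 h1 h2; rewrite qmul_eq0 (negPf b0) => /eqP.
have [A GA] := no_fixed_null HG ZG np; apply; have SA := subG HG GA.
apply: (null_null_onl HJ np (null_Sp SA np)).
have := fY _ (tangent_conj HG GA TU); rewrite outer_conj // outer_app formZr.
move/eqP; rewrite !qmul_eq0 (negPf b0) /= (formC Jh p (A *m p)) qconj_eq0 orbb.
by move/eqP.
Qed.

Lemma conjKV A U : Sp J A -> mxinv A *m (A *m U *m mxinv A) *m A = U.
Proof. by move=> SA; rewrite !mulmxA (SpVK SA) mul1mx -mulmxA (SpVK SA) mulmx1. Qed.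

Lemma tangent_ad2 U Y : T U -> T Y -> T (ad2 U Y).
Proof.
move=> TU TY; have := tangent_bracket HJ HG TU (tangent_bracket HJ HG TU TY).
by rewrite mulmxBr mulmxBl !mulmxA.
Qed.

Section LowerRoot.
Variables (p z : 'cV[H]_m) (s : H).
Hypotheses (np : null J p) (pz : form p z = 0).

(** For purely imaginary [s] these are the elements of the nilradical of the stabilizer of the point
    of [p], a Heisenberg algebra with centre [outer p s p]. *)
Definition lower := outer p 1 z - outer z 1 p + outer p s p.

Let zp : form z p = 0. Proof. exact: form_eq0C pz. Qed.

Lemma lower_sqr : lower *m lower = outer p (- form z z) p.
Proof.
rewrite /lower sqr_sub_add !outer_mul pz zp np.2 !mulr0 !mul0r !outer0 mul1r mulr1.
by rewrite !addr0 !subr0 addr0 sub0r outerN.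
Qed.

Lemma lower_cube : lower *m lower *m lower = 0.
Proof.
rewrite lower_sqr /lower mulmxDr mulmxBr !outer_mul pz np.2.
by rewrite !mulr0 !mul0r !outer0 subr0 addr0.
Qed.

(** Four brackets with [lower] turn [Y] into a highest root element at [p] whose coefficient
    contains the factor [form p (Y *m p)], and [no_highest_root] applies. If [z] is null, it is a
    multiple of [p] and [lower] itself is such an element. *)
Lemma lower_form Y : T lower -> lower != 0 -> T Y -> form p (Y *m p) = 0.
Proof.
move=> TU U0 TY; have zz := form_diag Jh z.
have [h0 h1] := null_orth HJ np pz.
have [z0|z0] := eqVneq (qre (form z z)) 0.
  have [a zE] := h1 z0; exfalso.
  have UE : lower = outer p (qconj a - a + s) p.
    by rewrite /lower zE outer_smulr outer_smull mul1r mulr1 -outerN -!outerD.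
  apply: (@no_highest_root p (qconj a - a + s) np); last by rewrite -UE.
  by apply: contraNneq U0 => h; rewrite UE h outer0.
apply/eqP/negPn/negP => c0.
have := tangent_ad2 TU (tangent_ad2 TU TY); rewrite (ad2_ad2 _ lower_cube).
rewrite -[_ *m lower *m lower]mulmxA lower_sqr -mulmxA outer_mull outer_mul.
move: (form p _) c0 => c c0; have zz0 : form z z != 0 by rewrite zz qreal_eq0.
rewrite outer_muln; apply: no_highest_root => //.
rewrite -[_ *+ 6]mulr_natr !qmul_eq0 !oppr_eq0 !negb_or c0 zz0 /=.
have -> : 6%:R = qreal 6 :> H by rewrite raddfMn.
by rewrite qreal_eq0 pnatr_eq0.
Qed.

(** Replacing [z] by [z - p *v a], orthogonal to [p'] as well, changes only the coefficient of
    [outer p s p], and the assumption on [p'] makes the new coefficient 0. *)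
Lemma lower_normal p' : form p p' != 0 -> form p' (lower *m p') = 0 ->
  exists y, [/\ form p y = 0, form p' y = 0 & lower = outer p 1 y - outer y 1 p].
Proof.
move=> pp' h; pose a := (form p' p)^-1 * form p' z.
have p'p : form p' p != 0 by rewrite (formC Jh) qconj_eq0.
have [y yE] : exists y, y = z - p *v a by exists (z - p *v a).
have py : form p y = 0 by rewrite yE formBr formZr np.2 mul0r pz subrr.
have p'y : form p' y = 0 by rewrite yE formBr formZr /a mulrA qmulxV // mul1r subrr.
have yp' := form_eq0C Jh p'y.
exists y; split=> //; pose t := qconj a - a + s.
have UE : lower = outer p 1 y - outer y 1 p + outer p t p.
  rewrite /lower yE outerBr outerBl outer_smulr outer_smull mulr1 mul1r /t !outerD outerN.
  move: (outer p 1 z) (outer z 1 p) (outer p (qconj a) p) (outer p a p) (outer p s p) => b1 b2 b3 b4 b5.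
  exact: zmod_swap.
have t0 : t = 0.
  have E : form p' ((outer p 1 y - outer y 1 p + outer p t p) *m p') =
      form p' p * (1 * form y p') - form p' y * (1 * form p p') + form p' p * (t * form p p').
    by rewrite mulmxDl mulmxBl !outer_app formDr formBr; congr (_ - _ + _); rewrite formZr.
  move: h; rewrite UE E yp' p'y.
  rewrite mulr0 mulr0 mul0r subr0 add0r => /eqP.
  by rewrite !qmul_eq0 (negPf p'p) (negPf pp') /= orbF => /eqP.
by rewrite UE t0 outer0 addr0.
Qed.

End LowerRoot.

Lemma positive_orth2 p q z : null J p -> null J q -> form p q != 0 ->
  form p z = 0 -> form q z = 0 -> z != 0 -> 0 < qre (form z z).
Proof.
move=> np nq pq pz qz z0; have [h0 h1] := null_orth HJ np pz.
rewrite lt_def h0 andbT; apply: contraNneq pq => /h1[a zE].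
move: qz; rewrite zE formZr => /eqP; rewrite qmul_eq0 => /orP[h|/eqP a0].
  by rewrite (formC Jh) qconj_eq0.
by rewrite zE a0 smul0 eqxx in z0.
Qed.

Lemma lower0 p y : lower p y 0 = outer p 1 y - outer y 1 p.
Proof. by rewrite /lower outer0 addr0. Qed.

(** With [U] and [Y] the two elements, [radical] makes the real traces of U Y and of U [Y, [Y, U]]
    vanish. The latter is 2 tr U^2 Y^2 - 2 tr U Y U Y: the first term is positive because [x] and
    [y] are, and the vanishing of the former makes the second contribution nonnegative. *)
Lemma lower_pair p p' y x : null J p -> null J p' -> form p p' != 0 ->
  form p y = 0 -> form p' y = 0 -> form p x = 0 -> form p' x = 0 ->
  y != 0 -> x != 0 -> T (lower p y 0) -> T (lower p' x 0) -> False.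
Proof.
move=> np np' pp' py p'y px p'x y0 x0.
have yy := positive_orth2 np np' pp' py p'y y0.
have xx := positive_orth2 np np' pp' px p'x x0.
have xp := form_eq0C Jh px; have yp' := form_eq0C Jh p'y.
have UU := lower_sqr 0 np py; have YY := lower_sqr 0 np' p'x.
have UY : lower p y 0 *m lower p' x 0 = - outer p (form y x) p' - outer y (form p p') x.
  rewrite !lower0 mulmxBl !mulmxBr !outer_mul yp' px !mulr1 !mul1r !outer0.
  by rewrite sub0r subr0.
move: (lower p y 0) (lower p' x 0) UU YY UY => U Y UU YY UY TU TY.
have UU0 : retr (U *m U) = 0 by rewrite UU retr_outer_form np.2 mulr0.
have tUY := radical TU UU0 TY.
have p'pc : form p' p = qconj (form p p') by rewrite (formC Jh).
have xyk : form x y = qconj (form y x) by rewrite (formC Jh).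
have := radical TU UU0 (tangent_ad2 TY TU).
rewrite mul_ad2 retrBBB.
have -> : retr (U *m Y *m Y *m U) = retr (U *m U *m Y *m Y).
  by rewrite retrC !mulmxA.
have -> : retr (U *m U *m Y *m Y) = qre (form y y * form p p' * form x x * qconj (form p p')).
  by rewrite -[_ *m Y *m Y]mulmxA UU YY outer_mul retr_outer_form p'pc mulrN !mulNr opprK.
have -> : retr (U *m Y *m U *m Y) = 2 * qre (form y x * qconj (form p p') * (form y x * qconj (form p p'))).
  rewrite -[_ *m U *m Y]mulmxA UY mulmxBl !mulmxBr !mulNmx !mulmxN !outer_mul.
  rewrite p'y xp p'pc xyk !mulr0 !mul0r !outer0 !opprK addr0 oppr0 sub0r opprK retrD.
  rewrite !retr_outer_form p'pc xyk.
  move: (form y x) (form p p') => k c.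
  have -> : qre (c * qconj k * c * qconj k) = qre (k * qconj c * k * qconj c).
    by rewrite -qre_conj !qconjM !qconjK !mulrA.
  by rewrite !mulrA; lra.
have tk : qre (form y x * qconj (form p p')) = 0.
  move: tUY; rewrite UY raddfB raddfN /= !retr_outer_form p'pc xyk.
  move: (form y x) (form p p') => k c.
  by rewrite -[in qre (c * _)](qconjK c) -qconjM qre_conj; lra.
have := qre_sqr_le0 tk.
rewrite (form_diag Jh y) (form_diag Jh x).
have : 0 < qre (form y y) * qre (form x x) * qnorm2 (form p p').
  by rewrite !mulr_gt0 // lt_def qnorm2_ge0 qnorm2_eq0 pp'.
move: (qre (form y y)) (qre (form x x)) (form p p') (qre (_ * _)) => u v c w.
have -> : qre (qreal u * c * qreal v * qconj c) = u * v * qnorm2 c.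
  by case: c => c1 c2 c3 c4; rewrite /qnorm2 /=; ring.
by move: (_ * qnorm2 c) => t; lra.
Qed.

(** Conjugation by an [A] that moves [p] yields a second element of this kind at [A *m p]. By
    [lower_form] both can be normalized with respect to the two points, where [lower_pair]
    applies. *)
Lemma no_lower_root p z s : null J p -> form p z = 0 -> lower p z s != 0 ->
  ~ T (lower p z s).
Proof.
move=> np pz U0 TU; have fY := lower_form np pz TU U0.
have [A GA pA] := no_fixed_null HG ZG np; have SA := subG HG GA.
have np' := null_Sp SA np; have GVA := GV HG GA.
have pp' : form p (A *m p) != 0.
  by apply/eqP => h; apply: pA; exact: (null_null_onl HJ np np').
have p'p : form (A *m p) p != 0 by rewrite (formC Jh) qconj_eq0.
have TY := tangent_conj HG GA TU.
have YE : A *m lower p z s *m mxinv A = lower (A *m p) (A *m z) s.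
  by rewrite /lower mulmxDr mulmxBr mulmxDl mulmxBl !outer_conj.
have h1 : form (A *m p) (lower p z s *m (A *m p)) = 0.
  rewrite (form_SpVr _ _ SA) !mulmxA; apply: fY.
  have := tangent_conj HG GVA TU; suff -> : mxinv (mxinv A) = A by [].
  have SVA := SpV SA; rewrite -[LHS]mul1mx -(SpKV SA) -mulmxA (SpKV SVA) mulmx1 //.
have h2 : form p (lower (A *m p) (A *m z) s *m p) = 0 by rewrite -YE; exact: fY.
have Az : form (A *m p) (A *m z) = 0 by rewrite form_Sp.
have [y [py p'y UE]] := lower_normal np pz pp' h1.
have [x [p'x px YE']] := lower_normal np' Az p'p h2.
move: TY; rewrite YE YE' => TY.
have Y0 : outer (A *m p) 1 x - outer x 1 (A *m p) != 0.
  rewrite -YE' -YE; apply: contraNneq U0 => h; apply/eqP.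
  by rewrite -(conjKV (lower p z s) SA) h mulmx0 mul0mx.
have y0 : y != 0.
  by apply: contraNneq U0 => y0; rewrite UE y0 outer0l outer0r subr0.
have x0 : x != 0.
  by apply: contraNneq Y0 => x0; rewrite x0 outer0l outer0r subr0.
rewrite UE -lower0 in TU; rewrite -lower0 in TY.
exact: (lower_pair np np' pp' py p'y px p'x y0 x0 TU TY).
Qed.

End NoSmallLoxodromic.

Lemma expr_unbounded (R : realType) (r t C : R) : 1 < r -> 0 <= t ->
  (forall k, r ^+ k * t <= C) -> t = 0.
Proof.
move=> r1 t0 h; have [//|tn] := eqVneq t 0; exfalso.
have bern k : k%:R * (r - 1) <= r ^+ k.
  elim: k => [|k IH]; first by rewrite mul0r expr0.
  rewrite exprS -natr1; move: (exprn_ege1 k (ltW r1)) IH; move: (r ^+ k) (k%:R) => x y; nra.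
have tp : 0 < t * (r - 1) by rewrite mulr_gt0 ?subr_gt0 // lt_def tn.
have := archi_boundP (divr_ge0 (normr_ge0 C) (ltW tp)); set k := Num.bound _.
rewrite ltr_pdivrMr // => hk; have := h k; have := bern k; have := ler_norm C.
move: (k%:R) (r ^+ k) hk => x y; nra.
Qed.

(** * The orthogonal complement of an axis *)

Section Axis.
Variables (R : realType) (m : nat).
Local Notation H := (quat R).
Variable J : 'M[H]_m.
Hypothesis HJ : lorentz J.
Implicit Types (x y z w v : 'cV[H]_m) (a b c : H) (r : R) (A B X Y U D : 'M[H]_m).
Local Notation form := (Defs.form J).
Let Jh := lorentz_adj HJ.

Lemma qabs_form x y : qabs (form x y) <= nrm x * nrm J * nrm y.
Proof.
apply: le_trans (qabs_le_nrm _ _ _) _; apply: le_trans (nrmM _ _) _.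
by rewrite ler_wpM2r ?nrm_ge0 // (le_trans (nrmM _ _)) // nrm_adj.
Qed.

Variables p q : 'cV[H]_m.
Hypotheses (np : null J p) (nq : null J q) (pq : form p q != 0).

Let qp : form q p != 0.
Proof. by rewrite (formC Jh) qconj_eq0. Qed.

Definition axis_perp w := form p w = 0 /\ form q w = 0.

Lemma axis_decomp x : exists a b, exists2 w, axis_perp w & x = p *v a + q *v b + w.
Proof.
exists ((form q p)^-1 * form q x), ((form p q)^-1 * form p x).
set a := _ * _; set b := _ * _; exists (x - (p *v a + q *v b)); last by rewrite addrC subrK.
split; rewrite formBr formDr !formZr.
  by rewrite np.2 mul0r add0r /b mulrA qmulxV // mul1r subrr.
by rewrite nq.2 mul0r addr0 /a mulrA qmulxV // mul1r subrr.
Qed.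

Lemma axis_eq0 D : D *m p = 0 -> D *m q = 0 -> (forall w, axis_perp w -> D *m w = 0) -> D = 0.
Proof.
move=> Dp Dq Dw; have D0 x : D *m x = 0.
  have [a [b [w Ww ->]]] := axis_decomp x.
  by rewrite !mulmxDr !mulmxA Dp Dq !mul0mx Dw // !addr0.
apply/matrixP => i j; have /matrixP/(_ i 0) := D0 (delta_mx j 0).
by rewrite -colE !mxE.
Qed.

Lemma perp_eq0 v : form p v = 0 -> form q v = 0 ->
  (forall w, axis_perp w -> form w v = 0) -> v = 0.
Proof.
move=> pv qv wv; apply/eqP/negPn/negP => v0.
by have := positive_orth2 HJ np nq pq pv qv v0; rewrite wv // ltxx.
Qed.

Lemma axis_negative : exists2 z, negative J z & forall w, axis_perp w -> form z w = 0.
Proof.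
exists (p *v (form q p)^-1 - q).
  rewrite /negative formBr !formBl !(formZl Jh) !formZr np.2 nq.2 !mul0r !mulr0 subr0 sub0r.
  rewrite (formC Jh q p); move: (form q p) qp => c c0.
  by rewrite -qconjM !qmulxV // qconj1 !qcE /=; lra.
by move=> w [pw qw]; rewrite formBl (formZl Jh) pw qw mulr0 subr0.
Qed.

(** On the complement of the axis the form is positive definite, so its invariance bounds the
    norm. *)
Lemma perp_bounded w : axis_perp w -> exists C, forall B, Sp J B ->
  axis_perp (B *m w) -> nrm (B *m w) <= C.
Proof.
move=> Ww; have [z nz zw] := axis_negative; have [K K0 h] := negative_orth HJ nz.
exists (m%:R * Num.sqrt (K * qre (form w w))) => B SB WB.
apply: le_trans (nrm_vn2 _) _; rewrite ler_wpM2l // ler_sqrt.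
  by rewrite -(form_Sp _ _ SB) h // zw.
by apply: le_trans (vn2_ge0 w) _; rewrite h // zw.
Qed.

Lemma perp_Sp B a b w : Sp J B -> B *m p = p *v a -> B *m q = q *v b ->
  axis_perp w -> axis_perp (B *m w).
Proof.
move=> SB Bp Bq [pw qw].
have h z c : z != 0 -> B *m z = z *v c -> form z w = 0 -> form z (B *m w) = 0.
  move=> z0 Bz zw; have [c0 _] := eigen_inv SB z0 Bz.
  have := form_Sp z w SB; rewrite Bz (formZl Jh) zw => /eqP.
  by rewrite qmul_eq0 qconj_eq0 (negPf c0) => /eqP.
by split; [apply: h Bp pw; case: np|apply: h Bq qw; case: nq].
Qed.

Lemma perp_powers A a b w : Sp J A -> A *m p = p *v a -> A *m q = q *v b ->
  axis_perp w -> exists2 C, 0 <= C & forall k, nrm (mpow A k *m w) <= C /\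
     nrm (mxinv (mpow A k) *m w) <= C.
Proof.
move=> SA Ap Aq Ww; have [C hC] := perp_bounded Ww.
have S k : Sp J (mpow A k).
  elim: k => [|k IH]; last exact: SpM.
  by split; [exists 1%:M; rewrite mulmx1|rewrite adjmx1 mul1mx mulmx1].
have e z c k : A *m z = z *v c -> mpow A k *m z = z *v (c ^+ k).
  move=> Az; elim: k => [|k IH]; first by rewrite expr0 smul1 mul1mx.
  by rewrite mpowS -mulmxA IH mulmxA Az smulA exprS.
have n0 : 0 <= C by apply: le_trans (nrm_ge0 _) (hC _ (S 0%N) _); rewrite mul1mx.
exists C => // k; have [_ pV] := eigen_inv (S k) np.1 (e _ _ k Ap).
have [_ qV] := eigen_inv (S k) nq.1 (e _ _ k Aq).
split; apply: hC => //; first exact: perp_Sp (e _ _ k Ap) (e _ _ k Aq) Ww.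
  exact: SpV.
exact: (perp_Sp (SpV (S k)) pV qV).
Qed.

End Axis.

(** * Conjugates of a tangent vector by powers of a loxodromic element *)

Section AxisAlgebra.
Variables (R : realType) (m : nat).
Local Notation H := (quat R).
Variable J : 'M[H]_m.
Hypothesis HJ : lorentz J.
Implicit Types (x y z w v p q : 'cV[H]_m) (a b c : H) (r : R) (A B X Y U D : 'M[H]_m).
Local Notation form := (Defs.form J).
Let Jh := lorentz_adj HJ.
Variable G : set 'M[H]_m.
Hypothesis HG : subgroup J G.
Hypothesis ZG : Zariski_dense J G.
Local Notation T := (tangent G).
Hypothesis neg : forall X, T X -> retr (X *m X) <= 0.

Lemma mpow_eigen A z c k : A *m z = z *v c -> mpow A k *m z = z *v (c ^+ k).
Proof.
move=> Az; elim: k => [|k IH]; first by rewrite expr0 smul1 mul1mx.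
by rewrite mpowS -mulmxA IH mulmxA Az smulA exprS.
Qed.

Lemma lower_app p z s x :
  lower J p z s *m x = p *v form z x - z *v form p x + p *v (s * form p x).
Proof. by rewrite /lower mulmxDl mulmxBl !outer_app !mul1r. Qed.

(** By skewness, what remains of [L] is determined by [L *m q], from which [z] and [s] are read
    off. *)
Lemma skew_lower p q L : null J p -> null J q -> form p q != 0 ->
  (forall x y, form x (L *m y) = - form (L *m x) y) -> L *m p = 0 ->
  (forall w w', axis_perp J p q w -> axis_perp J p q w' -> form w' (L *m w) = 0) ->
  exists z s, form p z = 0 /\ L = lower J p z s.
Proof.
move=> np nq c0 skew Lp wLw.
have py : form p (L *m q) = 0 by rewrite skew Lp (form0l Jh) oppr0.
exists (- (L *m q) *v (form p q)^-1); set z := _ *v _.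
have pz : form p z = 0 by rewrite /z formZr formNr py oppr0 mul0r.
have zp := form_eq0C Jh pz.
have zc : z *v form p q = - (L *m q) by rewrite /z smulA qmulVx // smul1.
have wz w : form w z = - (form w (L *m q) * (form p q)^-1) by rewrite /z formZr formNr mulNr.
move: z pz zp zc wz => z pz zp zc wz.
exists (- (form z q * (form p q)^-1)); split=> //; apply/eqP; rewrite -subr_eq0; apply/eqP.
apply: (axis_eq0 HJ np nq c0).
- by rewrite mulmxBl Lp lower_app zp np.2 mulr0 !smul0 subr0 addr0 subr0.
- rewrite mulmxBl lower_app zc opprK mulNr -mulrA qmulVx // mulr1 smulNr.
  by rewrite addrAC subrr add0r subrr.
move=> w Ww; have [pw qw] := Ww; rewrite mulmxBl lower_app pw mulr0 !smul0 subr0 addr0.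
apply: (perp_eq0 HJ np nq c0).
- by rewrite formBr formZr np.2 mul0r subr0 skew Lp (form0l Jh) oppr0.
- rewrite formBr formZr skew (formC Jh w z) wz.
  rewrite raddfN /= qconjM qconjV // -(formC Jh p q) -(formC Jh w (L *m q)).
  rewrite mulrN opprK mulrA qmulxV ?mul1r ?addNr //.
  by rewrite (formC Jh) qconj_eq0.
move=> w' Ww'; have [pw' qw'] := Ww'.
by rewrite formBr formZr wLw // (form_eq0C Jh pw') mul0r subr0.
Qed.

Section Powers.
Variables (A : 'M[H]_m) (p q : 'cV[H]_m) (a b : H).
Hypotheses (GA : G A) (np : null J p) (nq : null J q) (pq : form p q != 0).
Hypotheses (Ap : A *m p = p *v a) (a1 : 1 < qabs a).
Hypotheses (Aq : A *m q = q *v b) (b1 : qabs b < 1).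
Variable X : 'M[H]_m.
Hypothesis TX : T X.

Let B k := mpow A k.
Let XB k := B k *m X *m mxinv (B k).
Let GB k : G (B k). Proof. exact: (G_mpow HG). Qed.
Let SB k : Sp J (B k). Proof. exact: subG (GB k). Qed.
Let ab : qabs a * qabs b = 1. Proof. exact: (eigen_pair HJ (subG HG GA) Ap Aq pq). Qed.
Let b0 : 0 < qabs b.
Proof. by rewrite lt_def qabs_ge0 andbT; apply/eqP => h; move: ab; rewrite h mulr0 => /esym/eqP; rewrite oner_eq0. Qed.
Let r1 : 1 < (qabs b)^-1. Proof. by rewrite invf_gt1. Qed.

Let Vp k : mxinv (B k) *m p = p *v (a ^+ k)^-1.
Proof. exact: (eigen_inv (SB k) np.1 (mpow_eigen k Ap)).2. Qed.
Let Vq k : mxinv (B k) *m q = q *v (b ^+ k)^-1.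
Proof. exact: (eigen_inv (SB k) nq.1 (mpow_eigen k Aq)).2. Qed.
Let ak0 k : a ^+ k != 0.
Proof. exact: (eigen_inv (SB k) np.1 (mpow_eigen k Ap)).1. Qed.
Let bk0 k : b ^+ k != 0.
Proof. exact: (eigen_inv (SB k) nq.1 (mpow_eigen k Aq)).1. Qed.
Let qVb k : qabs (b ^+ k)^-1 = (qabs b)^-1 ^+ k.
Proof. by rewrite qabsV // qabsX exprVn. Qed.
Let qVa k : qabs (a ^+ k)^-1 = qabs b ^+ k.
Proof.
rewrite qabsV // qabsX; apply: (mulfI (x := qabs a ^+ k)).
  by rewrite expf_neq0 // gt_eqF // (lt_trans ltr01).
by rewrite divff -?exprMn ?ab ?expr1n // expf_neq0 // gt_eqF // (lt_trans ltr01).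
Qed.

Let formXB k x y : form x (XB k *m y) = form (mxinv (B k) *m x) (X *m (mxinv (B k) *m y)).
Proof. by rewrite (form_SpV _ _ (SB k)) !mulmxA. Qed.

(** Conjugation by the k-th power of [A] expands [form q (X *m q)] by |b|^(-2k) and the components
    of [X *m q] across the axis by |b|^(-k); in a bounded family both must be 0. *)
Lemma bounded_conjugates_axis C : (forall k, nrm (XB k) <= C) -> onl q (X *m q).
Proof.
move=> hC; have C0 : 0 <= C by exact: le_trans (nrm_ge0 _) (hC 0%N).
have nXq k : nrm (XB k *m q) <= C * nrm q.
  by apply: le_trans (nrmM _ _) _; rewrite ler_wpM2r ?nrm_ge0.
have qXq : form q (X *m q) = 0.
  apply/eqP; rewrite -qabs_eq0; apply/eqP.
  apply: (@expr_unbounded _ ((qabs b)^-1 * (qabs b)^-1) _ (nrm q * nrm J * (C * nrm q))).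
  - by rewrite -[ltLHS]mulr1; apply: ltr_pM.
  - exact: qabs_ge0.
  move=> k; apply: (@le_trans _ _ (qabs (form q (XB k *m q)))); last first.
    by apply: le_trans (qabs_form _ _ _) _; rewrite ler_wpM2l ?mulr_ge0 ?nrm_ge0.
  rewrite formXB Vq mulmxA formZr (formZl Jh) qabsM [qabs (_ * form _ _)]qabsM qabs_conj qVb exprMn.
  by rewrite mulrAC.
have wXq w : axis_perp J p q w -> form w (X *m q) = 0.
  move=> Ww; have [D D0 hD] := perp_powers HJ np nq pq (subG HG GA) Ap Aq Ww.
  apply/eqP; rewrite -qabs_eq0; apply/eqP.
  apply: (@expr_unbounded _ (qabs b)^-1 _ (D * nrm J * (C * nrm q)) r1 (qabs_ge0 _)).
  move=> k; apply: (@le_trans _ _ (qabs (form (B k *m w) (XB k *m q)))).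
    rewrite formXB mulmxA (SpVK (SB k)) mul1mx Vq mulmxA formZr qabsM qVb mulrC //.
  apply: le_trans (qabs_form _ _ _) _; apply: ler_pM => //.
  + by rewrite mulr_ge0 ?nrm_ge0.
  + exact: nrm_ge0.
  + by rewrite ler_wpM2r ?nrm_ge0 //; case: (hD k).
exists ((form p q)^-1 * form p (X *m q)); apply/eqP; rewrite -subr_eq0; apply/eqP.
apply: (perp_eq0 HJ np nq pq).
- by rewrite formBr formZr mulrA qmulxV // mul1r subrr.
- by rewrite formBr formZr qXq nq.2 mul0r subrr.
move=> w Ww; rewrite formBr formZr (wXq _ Ww).
by rewrite (form_eq0C Jh Ww.2) mul0r subrr.
Qed.

(** The rescaled conjugates have a nonzero limit [L] in [T]. The components that stay bounded under
    conjugation vanish in it; so [L] kills [p], has no block across the axis and is excluded by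
    [no_lower_root]. *)
Lemma unbounded_conjugates : (forall C : R, exists k, C < nrm (XB k)) -> False.
Proof.
move=> unb; have /choice[K hK] : forall j : nat, exists k, j.+1%:R < nrm (XB k).
  by move=> j; apply: unb.
have [F [UF Finf]] := nat_ultra; have PF := @ultra_proper _ _ UF.
have n0 j : 0 < nrm (XB (K j)) by apply: lt_trans (hK j).
pose Us j := qreal (nrm (XB (K j)))^-1 *: XB (K j).
have nU j : nrm (Us j) = 1.
  by rewrite nrm_real gtr0_norm ?invr_gt0 // mulVf ?gt_eqF.
have [L UsL] : exists L, mcvg F Us L.
  by apply: (ultra_cvg (C := 1) UF); apply: nearW => k; rewrite nU.
have L0 : L != 0.
  rewrite -nrm_gt0; apply: lt_le_trans ltr01 (mcvg_nrm_ge UsL _).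
  by apply: nearW => k; rewrite nU.
have TL : T L.
  apply: tangent_closed UsL; apply: nearW => j; apply: (tangentZ HJ HG).
  exact: (tangent_conj HG (GB _) TX).
have small x y C : (forall k, qabs (form x (XB k *m y)) <= C) -> form x (L *m y) = 0.
  move=> hC; have C0 : 0 <= C by exact: le_trans (qabs_ge0 _) (hC 0%N).
  have h1 : mcvg F (fun j => (form x (Us j *m y))%:M : 'M[H]_1) (form x (L *m y))%:M.
    by apply: (mcvg_form J (mcvg_cst x)); apply: mcvgM UsL _; exact: mcvg_cst.
  have h2 : mcvg F (fun j => (form x (Us j *m y))%:M : 'M[H]_1) (0 : H)%:M.
    move=> e e0; have [N hN] : exists N : nat, C / e < N%:R.
      by exists (Num.bound (C / e)); rewrite archi_boundP // divr_ge0 // ltW.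
    apply: filterS (Finf N) => j Nj; rewrite -raddfB /= nrm_scalar1 subr0.
    rewrite /Us -scalemxAl scale_real_scalar formZr qabsM qabs_real gtr0_norm ?invr_gt0 //.
    apply: le_lt_trans (ler_wpM2r _ (hC _)) _; first by rewrite invr_ge0 ltW.
    rewrite ltr_pdivrMr // mulrC -ltr_pdivrMr //; apply: lt_trans hN (le_lt_trans _ (hK j)).
    by rewrite ler_nat (leq_trans Nj).
  exact: scalar1_inj (mcvg_unique h1 h2).
have bnd x y Cx Cy : (forall k, nrm (mxinv (B k) *m x) <= Cx) ->
    (forall k, nrm (mxinv (B k) *m y) <= Cy) -> form x (L *m y) = 0.
  move=> hx hy; have Cx0 := le_trans (nrm_ge0 _) (hx 0%N).
  apply: (small _ _ (Cx * nrm J * (nrm X * Cy))) => k; rewrite formXB.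
  apply: le_trans (qabs_form _ _ _) _; apply: ler_pM => //.
  - by rewrite mulr_ge0 ?nrm_ge0.
  - exact: nrm_ge0.
  - by rewrite ler_wpM2r ?nrm_ge0.
  by apply: le_trans (nrmM _ _) _; rewrite ler_wpM2l ?nrm_ge0.
have bp k : nrm (mxinv (B k) *m p) <= nrm p.
  rewrite Vp; apply: le_trans (nrmM _ _) _; rewrite nrm_scalar1 qVa ler_piMr ?nrm_ge0 //.
  by rewrite exprn_ile1 ?qabs_ge0 // ltW.
have bw w : axis_perp J p q w -> exists C, forall k, nrm (mxinv (B k) *m w) <= C.
  move=> Ww; have [D D0 hD] := perp_powers HJ np nq pq (subG HG GA) Ap Aq Ww.
  by exists D => k; case: (hD k).
have pLp : form p (L *m p) = 0 by exact: (bnd _ _ _ _ bp bp).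
have qLp : form q (L *m p) = 0.
  apply: (small _ _ (qabs (form q (X *m p)))) => k.
  rewrite formXB Vq Vp mulmxA formZr (formZl Jh) qabsM [qabs (_ * form _ _)]qabsM qabs_conj qVb qVa mulrAC -exprMn.
  by rewrite mulVf ?gt_eqF // expr1n mul1r.
have Lp : L *m p = 0.
  apply: (perp_eq0 HJ np nq pq) => // w /bw[D hD]; exact: bnd hD bp.
have wLw w w' : axis_perp J p q w -> axis_perp J p q w' -> form w' (L *m w) = 0.
  by move=> /bw[D hD] /bw[D' hD']; exact: bnd hD' hD.
have skew := form_skew HG _ _ TL.
have [z [s [pz LE]]] := skew_lower np nq pq skew Lp wLw.
by apply: (no_lower_root HJ HG ZG neg np pz (s := s)); rewrite -LE.
Qed.

End Powers.

Lemma tangent_axis A p q a b X : G A -> null J p -> null J q -> form p q != 0 ->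
  A *m p = p *v a -> 1 < qabs a -> A *m q = q *v b -> qabs b < 1 -> T X ->
  onl q (X *m q).
Proof.
move=> GA np nq pq Ap a1 Aq b1 TX.
have [[C hC]|unb] := pselect (exists C : R, forall k, nrm (mpow A k *m X *m mxinv (mpow A k)) <= C).
  exact: (bounded_conjugates_axis GA np nq pq Ap Aq b1 hC).
exfalso; apply: (unbounded_conjugates GA np nq pq Ap a1 Aq b1 TX) => C.
apply: contrapT => h; apply: unb; exists C => k; rewrite leNgt; apply/negP => hk.
by apply: h; exists k.
Qed.

End AxisAlgebra.

(** * Vanishing of the Lie algebra *)

Section Rigidity.
Variables (R : realType) (m : nat).
Local Notation H := (quat R).
Variable J : 'M[H]_m.
Hypothesis HJ : lorentz J.
Implicit Types (x y z w v p q : 'cV[H]_m) (a b c : H) (r : R) (A B X Y U D : 'M[H]_m).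
Local Notation form := (Defs.form J).
Let Jh := lorentz_adj HJ.

Lemma loxE_axis f : Sp J f -> loxE f -> exists p q a b,
  [/\ null J p, null J q, form p q != 0, f *m p = p *v a /\ 1 < qabs a &
      f *m q = q *v b /\ qabs b < 1].
Proof.
move=> Sf [p [q [a [b [p0 q0 [fp a1] [fq b1]]]]]].
have np : null J p by apply: (eigen_null HJ Sf p0 fp); rewrite gt_eqF.
have nq : null J q by apply: (eigen_null HJ Sf q0 fq); rewrite lt_eqF.
exists p, q, a, b; split=> //; apply/eqP => /(null_null_onl HJ np nq)[c qE].
have c0 : c != 0 by apply: contraNneq q0 => c0; rewrite qE c0 smul0.
have : p *v (a * c) = p *v (c * b) by rewrite -!smulA -fp -qE -fq qE mulmxA.
move/(smul_cancel p0)/(congr1 (@qabs R)); rewrite !qabsM [qabs c * _]mulrC.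
by move/mulIf => E; have := E; rewrite qabs_eq0 c0 => /(_ isT); lra.
Qed.

Lemma re0_commutes_real a : qre a = 0 -> a * Quat 1 1 0 0 = Quat 1 1 0 0 * a ->
  a * Quat 1 0 1 0 = Quat 1 0 1 0 * a -> a = 0 :> H.
Proof.
case: a => a1 a2 a3 a4 /= -> [] _ _ e1 e2 [] _ e3 _ e4.
by apply: quatP => //=; lra.
Qed.

Variable G : set 'M[H]_m.
Hypothesis HG : subgroup J G.
Hypothesis ZG : Zariski_dense J G.
Hypothesis m0 : (0 < m)%N.
Local Notation T := (tangent G).

Section NoSmall.
Hypothesis neg : forall X, T X -> retr (X *m X) <= 0.

Lemma tangent_fixes_axis A p q a b X : G A -> null J p -> null J q -> form p q != 0 ->
  A *m p = p *v a -> 1 < qabs a -> A *m q = q *v b -> qabs b < 1 -> T X ->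
  onl p (X *m p) /\ onl q (X *m q).
Proof.
move=> GA np nq pq Ap a1 Aq b1 TX; have SA := subG HG GA.
have [a0 Vp] := eigen_inv SA np.1 Ap; have [b0 Vq] := eigen_inv SA nq.1 Aq.
have qp : form q p != 0 by rewrite (formC Jh) qconj_eq0.
split.
  apply: (tangent_axis HJ HG ZG neg (GV HG GA) nq np qp Vq _ Vp _ TX).
    by rewrite qabsV // invf_gt1 ?qabs_gt0.
  by rewrite qabsV // invf_lt1 ?qabs_gt0.
exact: (tangent_axis HJ HG ZG neg GA np nq pq Ap a1 Aq b1 TX).
Qed.

(** Every [X] fixes both ends of an axis and, by conjugation, a third point of the orbit. Skewness
    makes the real parts of the eigenvalues at any two of these points opposite, hence all 0; it
    then equates the eigenvalues at [p] and [q]. *)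
Lemma tangent_frame : exists p q, [/\ null J p, null J q, form p q = -1 &
  forall X, T X -> exists2 c, qre c = 0 & X *m p = p *v c /\ X *m q = q *v c].
Proof.
have [A GA lA] := exists_lox HJ HG ZG m0.
have [p [q0 [a [b [np nq0 pq0 [Ap a1] [Aq b1]]]]]] := loxE_axis (subG HG GA) lA.
have [C GC [Cp Cq]] := orbit_escapes HJ HG ZG np nq0 pq0.
have [d [d0 pq]] : exists d : H, d != 0 /\ form p (q0 *v d) = -1.
  by exists (- (form p q0)^-1); rewrite oppr_eq0 qinv_neq0 // formZr mulrN qmulxV.
have nq : null J (q0 *v d) by apply: nullZ.
exists p, (q0 *v d); split=> // X TX.
have fix_ X' : T X' -> onl p (X' *m p) /\ onl q0 (X' *m q0).
  by move=> TX'; exact: (tangent_fixes_axis GA np nq0 pq0 Ap a1 Aq b1 TX').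
have [[l Xp] [mu0 Xq0]] := fix_ _ TX.
have [mu Xq] : exists mu, X *m (q0 *v d) = q0 *v d *v mu.
  exists (d^-1 * mu0 * d); rewrite mulmxA Xq0 !smulA; congr (_ *v _).
  by rewrite (mulrA d (d^-1 * mu0)) (mulrA d d^-1) qmulxV // mul1r.
have SC := subG HG GC.
have [nu Xu] : exists nu, X *m (C *m p) = C *m p *v nu.
  have TC := tangent_conj HG (GV HG GC) TX.
  have [[nu E] _] := fix_ _ TC; exists nu.
  rewrite -mulmxA -E !mulmxA (SpKV SC) mul1mx.
  have -> : mxinv (mxinv C) = C by
    have SVC := SpV SC; rewrite -[LHS]mul1mx -(SpKV SC) -mulmxA (SpKV SVC) mulmx1.
  by rewrite -mulmxA.
have skew := form_skew HG _ _ TX.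
have nu_ := null_Sp SC np.
have re z w e e' : X *m z = z *v e -> X *m w = w *v e' -> form z w != 0 -> qre e' = - qre e.
  move=> Xz Xw zw; have := skew z w; rewrite Xz Xw formZr (formZl Jh).
  move: (form z w) zw => c c0 /(congr1 (fun t => c^-1 * t)).
  rewrite mulrA qmulVx // mul1r mulrN => ->; rewrite raddfN /=; congr (- _).
  by rewrite mulrA qreMC mulrA qmulxV // mul1r.
have pu : form p (C *m p) != 0.
  by apply/eqP => /(null_null_onl HJ np nu_).
have qu : form q0 (C *m p) != 0.
  by apply/eqP => /(null_null_onl HJ nq0 nu_).
have qu' : form (q0 *v d) (C *m p) != 0.
  by rewrite (formZl Jh) qmul_eq0 qconj_eq0 negb_or d0.
have pq' : form p (q0 *v d) != 0 by rewrite pq oppr_eq0 oner_eq0.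
have l0 : qre l = 0.
  have := re _ _ _ _ Xp Xu pu; have := re _ _ _ _ Xq Xu qu'; have := re _ _ _ _ Xp Xq pq'.
  lra.
exists l => //; split=> //; rewrite Xq; congr (_ *v _).
have := skew p (q0 *v d); rewrite Xp Xq; move: (q0 *v d) pq => q pq; rewrite formZr (formZl Jh) pq mulN1r mulrN1 opprK.
move/(congr1 -%R); rewrite opprK => ->.
by apply: quatP; rewrite !qcE /= ?opprK ?l0 ?oppr0.
Qed.

(** [V] states the eigenvector condition without the eigenvalue, so that it passes to limits.
    Negative eigenvectors with real product share a purely imaginary eigenvalue, which makes real
    combinations of them eigenvectors. *)
Lemma tangent_eigen X z : T X -> negative J z -> exists c, X *m z = z *v c.
Proof.
pose V z := forall X, T X -> X *m z *v form z z = z *v form z (X *m z).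
move=> TX nz; suff /(_ X TX) h : V z.
  have zz0 := neg_neg_neq0 HJ nz nz.
  by exists (form z (X *m z) * (form z z)^-1); rewrite -smulA -h smulA qmulxV // smul1.
move: z nz; apply: (invariant_full HJ HG ZG).
- move=> z a Vz Y TY; rewrite mulmxA !formZr !(formZl Jh) (form_diag Jh) !smulA.
  have k c : a * (qconj a * c * a) = c * (qreal (qnorm2 a) * a).
    by rewrite !mulrA qmulC qrealC.
  have E := Vz _ TY; rewrite (form_diag Jh) in E.
  by rewrite !k -(smulA _ (qreal _)) E smulA.
- move=> f z Vf fz Y TY.
  have h1 : mcvg \oo (fun k => Y *m f k *v form (f k) (f k)) (Y *m z *v form z z).
    apply: mcvg_smul; first by apply: mcvgM; [exact: mcvg_cst|exact: fz].
    by apply: mcvg_form; exact: fz.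
  have h2 : mcvg \oo (fun k => f k *v form (f k) (Y *m f k)) (z *v form z (Y *m z)).
    apply: mcvg_smul; first exact: fz.
    apply: mcvg_form; first exact: fz.
    by apply: mcvgM; [exact: mcvg_cst|exact: fz].
  by apply: (mcvg_unique h1); apply: mcvg_ext h2 => k; rewrite (Vf k Y TY).
- move=> z w r x y Vz Vw nz nw zw Y TY.
  have eig v : negative J v -> V v -> exists2 c, Y *m v = v *v c & qre c = 0.
    move=> nv Vv; have vv0 := neg_neg_neq0 HJ nv nv.
    exists (form v (Y *m v) * (form v v)^-1).
      by rewrite -smulA -(Vv _ TY) smulA qmulxV // smul1.
    have := form_skew HG v v TY; rewrite (formC Jh v (Y *m v)).
    rewrite (form_diag Jh v) in vv0 *; rewrite qreal_eq0 in vv0.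
    move/(congr1 (@qre R)); rewrite raddfN /= => h.
    have -> : (qreal (qre (form v v)))^-1 = qreal (qre (form v v))^-1.
      apply: (qmulIr (a := qreal (qre (form v v)))); rewrite ?qreal_eq0 //.
      by rewrite qmulVx ?qreal_eq0 // -qrealM mulVf.
    rewrite qreMC qre_realM; move: h; move: (qre (form v (Y *m v))) => t h.
    by rewrite (_ : t = 0) ?mulr0 //; lra.
  have [l Yz l0] := eig _ nz Vz; have [mu Yw mu0] := eig _ nw Vw.
  have r0 : r != 0 by have := neg_neg_neq0 HJ nz nw; rewrite zw qreal_eq0.
  have lmu : mu = l.
    have := form_skew HG z w TY; rewrite Yz Yw formZr (formZl Jh) zw => E.
    have lc : qconj l = - l by apply: quatP; rewrite !qcE /= ?l0 ?oppr0.
    move: E; rewrite lc mulNr opprK qrealC.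
    by move/qmulIr; apply; rewrite qreal_eq0.
  have E : Y *m (z *v qreal x + w *v qreal y) = (z *v qreal x + w *v qreal y) *v l.
    by rewrite mulmxDr !mulmxA Yz Yw lmu mulmxDl !smulA !(qrealC _ l).
  by rewrite E formZr [form _ _ in LHS](form_diag Jh) [form _ _ in RHS](form_diag Jh) !smulA (qrealC _ l).
- have [p [q [np nq pq h]]] := tangent_frame.
  have qp : form q p = -1 by rewrite (formC Jh) pq raddfN /= qconj1.
  have zz : form (p + q) (p + q) = - 2.
    by rewrite formDl !formDr np.2 nq.2 pq qp add0r addr0 -opprD.
  exists (p + q); first by rewrite /negative zz (_ : qre _ = - (1 + 1) :> R) ?oppr_lt0 ?addr_gt0.
  move=> Y TY; have [c c0 [Yp Yq]] := h _ TY.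
  by rewrite mulmxDr Yp Yq -mulmxDl formZr zz !smulA mulrN mulNr mulr_natr mulr_natl.
move=> A z GA nz Vz Y TY; have SA := subG HG GA.
have := Vz _ (tangent_conj HG (GV HG GA) TY).
have -> : mxinv (mxinv A) = A.
  have SVA := SpV SA; rewrite -[LHS]mul1mx -(SpKV SA) -mulmxA (SpKV SVA) mulmx1 //.
rewrite (form_Sp _ _ SA) [form (A *m z) _](form_SpVr _ _ SA).
by move/(congr1 (mulmx A)); rewrite !mulmxA (SpKV SA) mul1mx.
Qed.

(** The eigenvectors [p + q *v a] with positive [qre a] show that the eigenvalue [c] on the frame
    commutes with [a]; being imaginary, it is 0. The vectors [p + q + w *v t] then show that [X]
    kills the complement. *)
Lemma tangent_trivial X : T X -> X = 0.
Proof.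
move=> TX; have [p [q [np nq pq h]]] := tangent_frame.
have [c c0 [Xp Xq]] := h _ TX.
have qp : form q p = -1 by rewrite (formC Jh) pq raddfN /= qconj1.
have pq0 : form p q != 0 by rewrite pq oppr_eq0 oner_eq0.
have com a : 0 < qre a -> c * a = a * c.
  move=> a0; have nz : negative J (p + q *v a).
    rewrite /negative formDl !formDr !(formZl Jh) !formZr np.2 nq.2 pq qp.
    by rewrite !(mul0r, mulr0, add0r, addr0) !qcE /=; lra.
  have [e E] := tangent_eigen TX nz.
  move: E; rewrite mulmxDr mulmxA Xp Xq mulmxDl !smulA => E.
  have ce : c = e.
    have := congr1 (form q) E; rewrite !formDr !formZr nq.2 qp !mul0r !addr0 !mulN1r.
    by move/oppr_inj.
  have := congr1 (form p) E; rewrite !formDr !formZr np.2 pq !mul0r !add0r !mulN1r -ce.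
  by move/oppr_inj.
have {}c0 : c = 0.
  by apply: (re0_commutes_real c0); apply: com => /=; exact: ltr01.
rewrite c0 !smul0 in Xp Xq.
apply: (axis_eq0 HJ np nq pq0 Xp Xq) => w [pw qw].
(* Small enough for the square [-2 + t ^+ 2 * qre (form w w)] to be negative. *)
pose t := (1 + `|qre (form w w)|)^-1; have t0 : 0 < t by rewrite invr_gt0 ltr_pwDl.
have wp := form_eq0C Jh pw; have wq := form_eq0C Jh qw.
have nz : negative J (p + q + w *v qreal t).
  have SS : qre (form (p + q) (p + q)) = -2.
    by rewrite formDl !formDr np.2 nq.2 pq qp !qcE /=; lra.
  have Sw : form (p + q) w = 0 by rewrite formDl pw qw addr0.
  move: (p + q) SS Sw => S SS Sw.
  rewrite /negative formDl !formDr !formZr !(formZl Jh) Sw (form_eq0C Jh Sw) mul0r mulr0 addr0 add0r.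
  rewrite qconj_real raddfD /= SS -mulrA qre_realM qreMC qre_realM.
  move: t0; rewrite /t invr_gt0 => t0'; move: (qre (form w w)) t0' => f t0'.
  have h1 : (1 + `|f|)^-1 * f <= 1.
    by rewrite mulrC ler_pdivrMr // mul1r (le_trans (ler_norm f)) // lerDr.
  have h2 : (1 + `|f|)^-1 <= 1 by rewrite invf_le1 // lerDl.
  have h3 : 0 < (1 + `|f|)^-1 by rewrite invr_gt0.
  move: (_^-1) h1 h2 h3 => u; nra.
have [e E] := tangent_eigen TX nz.
move: E; rewrite !mulmxDr Xp Xq !add0r mulmxA => E.
have e0 : e = 0.
  have := congr1 (form p) E; rewrite formZr (form_skew HG p w TX) Xp (form0l Jh) oppr0 mul0r.
  rewrite formZr !formDr formZr np.2 pq pw mul0r addr0 add0r mulN1r.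
  by move/eqP; rewrite eq_sym oppr_eq0 => /eqP.
move: E; rewrite e0 smul0 => /eqP; rewrite smul_eq0 qreal_eq0 (gt_eqF t0) orbF => /eqP //.
Qed.

End NoSmall.

Lemma exists_small_lox : (forall e, 0 < e -> exists A, [/\ G A, A <> 1%:M & nrm (A - 1%:M) < e]) ->
  forall e, 0 < e -> exists A, [/\ G A, loxE A & nrm (A - 1%:M) < e].
Proof.
move=> nd e e0; apply: contrapT => h.
have [X X0 TX] := tangent_exists HG nd.
move/eqP: X0; apply; apply: tangent_trivial TX => Y.
apply: (tangent_retr_le0 HJ HG e0) => A GA Ae; rewrite leNgt; apply/negP => hA.
by apply: h; exists A; split=> //; exact: (retr_loxE HJ m0 (subG HG GA) hA).
Qed.

End Rigidity.

(** * Discreteness in terms of the norm *)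

Section Topology.
Variable R : realType.
Local Notation H := (quat R).

Lemma quat_nbhs (x : H) (A : set H) :
  nbhs x A <-> exists2 e : R, 0 < e & forall y, qabs (y - x) < e -> A y.
Proof.
split=> [|[e e0 eA]].
  have E : nbhs x = nbhs (x : initial_topology (@quat_tuple R)) by [].
  rewrite E nbhsE => -[U [[B oB <-] Bx] BA].
  have /nbhs_ballP[e /= e0 eB] : nbhs (quat_tuple x) B by exact: open_nbhs_nbhs.
  exists e => // y yx; apply: BA; apply: eB.
  have [h1 h2 h3 h4] := qcomp_le_qabs (y - x).
  by split; split; rewrite /ball /= distrC; apply: le_lt_trans yx.
have e4 : 0 < e / 4 by rewrite divr_gt0.
have h : nbhs (quat_tuple x) (ball (quat_tuple x) (e / 4)) by exact: nbhsx_ballx.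
have h' : nbhs x (@quat_tuple R @^-1` ball (quat_tuple x) (e / 4)).
  have E : nbhs x = nbhs (x : initial_topology (@quat_tuple R)) by [].
  rewrite E nbhsE; exists (@quat_tuple R @^-1` (ball (quat_tuple x) (e / 4))^°).
    split; last exact: h.
    by exists (ball (quat_tuple x) (e / 4))^°; first exact: open_interior.
  by move=> y; exact: interior_subset.
apply: filterS h' => y [[h1 h2] [h3 h4]]; apply: eA.
move: h1 h2 h3 h4; rewrite /ball /= distrC => h1; rewrite distrC => h2.
rewrite distrC => h3; rewrite distrC => h4.
apply: le_lt_trans (qabs_le_comp _) _ => /=.
by move: h1 h2 h3 h4; move: `|_| `|_| `|_| `|_| => a b c d; lra.
Qed.

Lemma matrix_nbhs m n (M : 'M[H]_(m, n)) (A : set 'M[H]_(m, n)) :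
  nbhs M A <-> exists2 e : R, 0 < e & forall N, nrm (N - M) < e -> A N.
Proof.
split=> [[P MP PA]|[e e0 eA]].
  have h : \forall e \near @rpos R, forall ij : 'I_m * 'I_n,
      forall y, qabs (y - M ij.1 ij.2) < e -> P ij.1 ij.2 y.
    have FF := rpos_filter R; apply: filter_forall => -[i j]; have /quat_nbhs[e e0 eP] := MP i j.
    by apply: filterS (rpos_lt e0) => t te y ty; apply: eP; exact: lt_trans te.
  have FF := rpos_filter R; have [e [he e0]] := filter_ex (filterI h (rpos_gt0 R)).
  exists e => // N NM; apply: PA => i j; apply: (he (i, j)) => /=.
  by apply: le_lt_trans NM; have := qabs_le_nrm (N - M) i j; rewrite !mxE.
pose d : R := e / ((m * n)%:R + 1); have M0 : 0 < (m * n)%:R + 1 :> R by rewrite ltr_wpDl.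
have d0 : 0 < d by rewrite divr_gt0.
exists (fun i j => [set y | qabs (y - M i j) < d]).
  by move=> i j; apply/quat_nbhs; exists d.
move=> N /= h; apply: eA; rewrite /nrm.
apply: (@le_lt_trans _ _ (\sum_(i < m) \sum_(j < n) d)).
  by do 2![apply: ler_sum => ? _]; rewrite !mxE ltW.
rewrite sumr_const card_ord sumr_const card_ord -mulrnA -mulr_natl /d mulrA.
by rewrite ltr_pdivrMr // mulrC ltr_pM2l // mulnC; lra.
Qed.

Variables (m : nat) (J : 'M[H]_m).
Implicit Types (A B : 'M[H]_m) (K : set 'M[H]_m).

Lemma discrete_near1 K : subgroup J K -> discrete K ->
  exists2 e : R, 0 < e & forall A, K A -> nrm (A - 1%:M) < e -> A = 1%:M.
Proof.
move=> SK dK; have [_ [V /matrix_nbhs[e e0 eV] VK]] := dK _ (G1 SK).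
exists e => // A KA Ae; have : (V `&` K) A by split=> //; exact: eV.
by rewrite VK.
Qed.

Lemma near1_discrete K : subgroup J K ->
  (exists2 e : R, 0 < e & forall A, K A -> nrm (A - 1%:M) < e -> A = 1%:M) -> discrete K.
Proof.
move=> SK [e e0 h] A KA; have SA := subG SK KA; split; first exact/mem_set.
pose d := e / (nrm (mxinv A) + 1).
have A1 : 0 < nrm (mxinv A) + 1 by rewrite ltr_wpDl ?nrm_ge0.
have d0 : 0 < d by rewrite divr_gt0.
exists [set B | nrm (B - A) < d]; first by apply/matrix_nbhs; exists d.
apply/seteqP; split=> [B [/= BA KB]|B ->]; last by split=> //=; rewrite subrr nrm0.
have : B *m mxinv A = 1%:M.
  apply: h; first exact: (GM SK KB (GV SK KA)).
  rewrite -(SpKV SA) -mulmxBl; apply: le_lt_trans (nrmM _ _) _.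
  rewrite ltr_pdivlMr // in BA; apply: le_lt_trans BA.
  by rewrite ler_wpM2l ?nrm_ge0 // lerDl.
by move/(congr1 (mulmx^~ A)); rewrite -mulmxA (SpVK SA) mulmx1 mul1mx.
Qed.

Lemma generated_subgroup (S : set 'M[H]_m) : lorentz J -> S `<=` Sp J -> subgroup J (generated J S).
Proof.
move=> HJ SS; have SpJ : subgroup J (Sp J).
  split=> //; [|by move=> ? ?; exact: SpM|by move=> ?; exact: SpV].
  by split; [exists 1%:M; rewrite mulmx1|rewrite adjmx1 mul1mx mulmx1].
split.
- by apply: smallest_sub.
- by move=> K [SK _]; exact: (G1 SK).
- by move=> a b ha hb K hK; have [SK _] := hK; apply: (GM SK); [exact: ha|exact: hb].
by move=> a ha K hK; have [SK _] := hK; apply: (GV SK); exact: ha.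
Qed.

End Topology.

(** * Loxodromic elements near 1 that move a boundary point *)

Section LoxNear.
Variables (R : realType) (m : nat).
Local Notation H := (quat R).
Variable J : 'M[H]_m.
Hypothesis HJ : lorentz J.
Implicit Types (x y z w v p q : 'cV[H]_m) (a b c : H) (r : R) (A B : 'M[H]_m).
Local Notation form := (Defs.form J).
Let Jh := lorentz_adj HJ.
Variable G : set 'M[H]_m.
Hypothesis HG : subgroup J G.
Hypothesis ZG : Zariski_dense J G.
Hypothesis m0 : (0 < m)%N.
Hypothesis nd : forall e : R, 0 < e ->
  exists A, [/\ G A, A <> 1%:M & nrm (A - 1%:M) < e].

Lemma conj_near1 A h : Sp J A ->
  nrm (mxinv A *m h *m A - 1%:M) <= nrm (mxinv A) * nrm A * nrm (h - 1%:M).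
Proof.
move=> SA; have -> : mxinv A *m h *m A - 1%:M = mxinv A *m (h - 1%:M) *m A.
  by rewrite mulmxBr mulmxBl mulmx1 (SpVK SA).
apply: le_trans (nrmM _ _) _; rewrite mulrAC ler_wpM2r ?nrm_ge0 //.
exact: nrmM.
Qed.

(* A loxodromic element has only two fixed points at infinity, so it moves one
   of three distinct points of the orbit of p. *)
Lemma lox_near1_moving p e : null J p -> 0 < e ->
  exists h, [/\ G h, loxE h, nrm (h - 1%:M) < e & ~ onl p (h *m p)].
Proof.
move=> np e0; have [A GA pA] := no_fixed_null HG ZG np; have SA := subG HG GA.
have nA := null_Sp SA np.
have pA0 : form p (A *m p) != 0.
  by apply/eqP => /(null_null_onl HJ np nA).
have [B GB [pB AB]] := orbit_escapes HJ HG ZG np nA pA0; have SB := subG HG GB.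
have nB := null_Sp SB np.
(* Conjugation by [A] or [B] multiplies the distance to 1 by at most [C]. *)
pose C := 1 + nrm (mxinv A) * nrm A + nrm (mxinv B) * nrm B.
have cA : 0 <= nrm (mxinv A) * nrm A by rewrite mulr_ge0 ?nrm_ge0.
have cB : 0 <= nrm (mxinv B) * nrm B by rewrite mulr_ge0 ?nrm_ge0.
have C0 : 0 < C by rewrite /C; lra.
have eC : 0 < e / C by rewrite divr_gt0.
have [h [Gh lh he]] := exists_small_lox HJ HG ZG m0 nd eC; have Sh := subG HG Gh.
rewrite ltr_pdivlMr // in he.
have small D : G D -> nrm (mxinv D) * nrm D <= C -> [/\ G (mxinv D *m h *m D),
    loxE (mxinv D *m h *m D) & nrm (mxinv D *m h *m D - 1%:M) < e].
  move=> GD hD; have SD := subG HG GD; split.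
  - by apply: (GM HG) => //; apply: (GM HG) => //; exact: (GV HG).
  - have := loxE_conj (SpV SD) lh; congr loxE; congr (_ *m _).
    have SVD := SpV SD; rewrite -[LHS]mul1mx -(SpKV SD) -mulmxA (SpKV SVD) mulmx1 //.
  apply: le_lt_trans (conj_near1 _ SD) _; apply: le_lt_trans he.
  by rewrite mulrC ler_wpM2l ?nrm_ge0.
have onlD D : G D -> onl p (mxinv D *m h *m D *m p) -> onl (D *m p) (h *m (D *m p)).
  move=> GD /(onl_mx D); have SD := subG HG GD.
  by rewrite !mulmxA (SpKV SD) mul1mx.
apply: contrapT => no.
have hA : onl (A *m p) (h *m (A *m p)).
  apply: onlD => //; apply: contrapT => ?; apply: no.
  by have [|? ? ?] := small A GA; [rewrite /C; lra|exists (mxinv A *m h *m A)].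
have hB : onl (B *m p) (h *m (B *m p)).
  apply: onlD => //; apply: contrapT => ?; apply: no.
  by have [|? ? ?] := small B GB; [rewrite /C; lra|exists (mxinv B *m h *m B)].
have hp : onl p (h *m p).
  apply: contrapT => ?; apply: no; exists h; split=> //; apply: le_lt_trans he.
  by rewrite -[leLHS]mulr1 ler_wpM2l ?nrm_ge0 // /C; lra.
have [z [w [a [b [nz nw _ [hz a1] [hw b1]]]]]] := loxE_axis HJ Sh lh.
have two v : null J v -> onl v (h *m v) -> onl z v \/ onl w v.
  by move=> nv [c hv]; exact: (loxE_fix HJ Sh nz nw hz a1 hw b1 nv hv).
have eq v v' y : null J v -> onl y v -> onl y v' -> onl v v'.
  by move=> nv yv; apply: onl_trans; apply: onl_sym yv; case: nv.
(* Three distinct points among two fixed ones: in each case two of them would coincide. *)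
case: (two _ np hp) (two _ nA hA) (two _ nB hB) => h1 [] h2 [] h3.
- by apply: pA; exact: eq h2.
- by apply: pA; exact: eq h2.
- by apply: pB; exact: eq h3.
- by apply: AB; exact: eq h3.
- by apply: AB; exact: eq h3.
- by apply: pB; exact: eq h3.
- by apply: pA; exact: eq h2.
- by apply: pA; exact: eq h2.
Qed.

End LoxNear.

(** * Diagonal isometries and the two models *)

Section DiagonalMatrices.
Variable R : realType.
Local Notation H := (quat R).
Implicit Types (l : R).

Lemma adjmx_diag m (v : 'rV[H]_m) : adjmx (diag_mx v) = diag_mx (map_mx (@qconj R) v).
Proof.
apply/matrixP => i j; rewrite adjmxE !mxE eq_sym.
by case: eqP => [->|_]; rewrite ?raddf0.
Qed.

Lemma diag_mxM m (v w : 'rV[H]_m) :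
  diag_mx v *m diag_mx w = diag_mx (\row_i (v 0 i * w 0 i)).
Proof. by apply/matrixP => i j; rewrite mul_diag_mx !mxE mulrnAr. Qed.

Lemma diag_conjE m (v w : 'rV[H]_m) (A : 'M[H]_m) i j :
  (diag_mx v *m A *m diag_mx w) i j = v 0 i * A i j * w 0 j.
Proof. by rewrite mul_mx_diag mxE mul_diag_mx mxE. Qed.

Lemma Sp_diag m (J : 'M[H]_m) (v : 'rV[H]_m) : (forall i, v 0 i != 0) ->
  (forall i j, qconj (v 0 i) * J i j * v 0 j = J i j) -> Sp J (diag_mx v).
Proof.
move=> v0 h; split; last first.
  by rewrite adjmx_diag; apply/matrixP => i j; rewrite diag_conjE mxE h.
exists (diag_mx (\row_i (v 0 i)^-1)); rewrite !diag_mxM.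
by split; apply/matrixP => i j; rewrite !mxE ?qmulxV ?qmulVx.
Qed.

End DiagonalMatrices.

Section ModelForms.
Variables (R : realType) (n : nat).
Local Notation H := (quat R).

Lemma J1E (i j : 'I_n.+2) : J1 R n i j = if i == j then (if i == ord0 then -1 else 1) else 0.
Proof.
rewrite -![i == _]val_eqE /J1 !mxE /=.
case: splitP => a ->; rewrite !mxE; case: splitP => b ->; rewrite ?mxE ?ord1 //=.
by rewrite eqn_add2l val_eqE; case: (a == b).
Qed.

Lemma lorentz_J1 : lorentz (J1 R n).
Proof.
exists (delta_mx ord0 0); split.
  apply/matrixP => i j; rewrite !ord1 !mxE (bigD1 ord0) //= big1 ?addr0 => [|k k0].
    by rewrite adjmxE !mxE qconj1 mulr1.
  by rewrite !mxE (negPf k0) mulr0.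
apply/matrixP => i j; rewrite J1E !mxE big_ord1 adjmxE !mxE !andbT.
have two : qreal 2 = 1 + 1 :> H by rewrite [LHS]raddfD.
case: eqVneq => [<-|ij].
  by case: eqP => _; rewrite ?qconj1 ?qconj_real ?two ?mulr1 ?mulr0 ?subr0 // opprD addrA subrr add0r.
have [i0|i0] := eqVneq i ord0; last by rewrite mul0r mulr0 subr0.
by rewrite -i0 eq_sym (negPf ij) qconj_real !mulr0 subr0.
Qed.

Lemma J2E (i j : 'I_n.+2) : J2 R n i j =
  if (i + j == 1)%N then -1 else if (i == j) && (1 < i)%N then 1 else 0.
Proof.
rewrite -val_eqE /J2 !mxE /=.
case: splitP => a ->; rewrite !mxE; case: splitP => b ->; rewrite ?mxE.
- case: splitP => a' ->; rewrite !mxE; case: splitP => b' ->; rewrite ?mxE ?ord1 //=.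
- by case: a => [[|[|a]]] ha //=; case: b => b hb; rewrite ?addn0 ?eqxx.
- by rewrite addnC; case: b => -[|[|//]] hb.
by rewrite eqn_add2l val_eqE /= andbT; case: (a == b).
Qed.

Lemma lorentz_J2 : lorentz (J2 R n).
Proof.
(* [J2] exchanges the first two basis vectors up to sign, so it is the reflection in their
   normalized sum. *)
pose s : R := (Num.sqrt 2)^-1; have ss : s * s = 2^-1.
  by rewrite -expr2 exprVn sqr_sqrtr.
pose e : 'cV[H]_n.+2 := \col_i qreal (if (i < 2)%N then s else 0).
have eE i : e i 0 = qreal (if (i < 2)%N then s else 0) by rewrite mxE.
exists e; split.
  apply/matrixP => i j; rewrite !ord1 !mxE !big_ord_recl big1 ?addr0 => [|k _].
    by rewrite !adjmxE !eE !qconj_real -!qrealM -qrealD ss -[RHS]qreal1; congr qreal; field.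
  by rewrite adjmxE eE qconj_real -qrealM mul0r.
apply/matrixP => i j; rewrite J2E !mxE big_ord1 adjmxE !eE qconj_real -!qrealM.
have two : 2 * (s * s) = 1 by rewrite ss; field.
have E : (i == j)%:R = qreal (i == j)%:R :> H by case: eqP.
rewrite [_ *+ _]E -qrealB {E}.
case: i => -[|[|i]] hi; case: j => -[|[|j]] hj; rewrite -?val_eqE /= ?two ?mul0r ?mulr0 ?subr0 //=.
- by rewrite subrr.
- by rewrite sub0r qrealN1.
- by rewrite sub0r qrealN1.
- by rewrite subrr.
by rewrite !eqSS; case: (i == j).
Qed.

(** For positive [t], a translation along the geodesic that joins the two null basis vectors of
    [J2]. *)
Definition dil (t : R) : 'M[H]_n.+2 :=
  diag_mx (\row_i qreal (if i == 0%N :> nat then t else if i == 1%N :> nat then t^-1 else 1)).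

Lemma dil_Sp t : t != 0 -> Sp (J2 R n) (dil t).
Proof.
move=> t0; apply: Sp_diag => [i|i j].
  by rewrite mxE qreal_eq0; case: (nat_of_ord i) => [|[|k]] //=; rewrite ?invr_eq0 ?oner_eq0.
rewrite J2E [_ 0 i]mxE [_ 0 j]mxE qconj_real.
case: i => -[|[|i]] hi; case: j => -[|[|j]] hj; rewrite -?val_eqE /= ?mul0r ?mulr0 ?mul0r //.
- by rewrite mulrN1 mulNr -qrealM divff.
- by rewrite mulrN1 mulNr -qrealM mulVf.
by rewrite mul1r mulr1.
Qed.

Lemma form_delta m (J : 'M[H]_m) i j : Defs.form J (delta_mx i 0) (delta_mx j 0) = J i j.
Proof.
rewrite form_def -mulmxA -colE mxE (bigD1 i) //= big1 ?addr0 => [|k ki].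
  by rewrite adjmxE !mxE !eqxx qconj1 mul1r.
by rewrite adjmxE !mxE (negPf ki) raddf0 mul0r.
Qed.

Lemma delta_neq0 m (i : 'I_m) : delta_mx i 0 != 0 :> 'cV[H]_m.
Proof. by apply/eqP => /matrixP/(_ i 0)/eqP; rewrite !mxE !eqxx oner_eq0. Qed.

End ModelForms.

(** * Change of model and reduction to the normal form *)

Section Conjugation.
Variables (R : realType) (m : nat).
Local Notation H := (quat R).
Implicit Types (A B C g h T f : 'M[H]_m) (K G : set 'M[H]_m) (z w p : 'cV[H]_m).

Lemma mxinv_uniq A B : A *m B = 1%:M -> B *m A = 1%:M -> mxinv A = B.
Proof.
move=> AB BA; have [AV VA] := mxinvP (ex_intro _ B (conj AB BA) : GLH A).
by rewrite -[LHS]mulmx1 -AB mulmxA VA mul1mx.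
Qed.

Definition mxconj C A := mxinv C *m A *m C.

Variables (J J' C : 'M[H]_m).
Hypothesis CJ : Defs.isometry J' J C.

Let CV : C *m mxinv C = 1%:M. Proof. by case: (mxinvP CJ.1). Qed.
Let VC : mxinv C *m C = 1%:M. Proof. by case: (mxinvP CJ.1). Qed.

Lemma form_isometry z w : Defs.form J (C *m z) (C *m w) = Defs.form J' z w.
Proof.
rewrite !form_def adjmxM -!mulmxA (mulmxA J) (mulmxA (adjmx C)) (mulmxA (adjmx C)).
by rewrite CJ.2.
Qed.

Lemma isometry_eq0 z : (C *m z == 0) = (z == 0).
Proof.
apply/eqP/eqP => [h|->]; last exact: mulmx0.
by rewrite -(mul1mx z) -VC -mulmxA h mulmx0.
Qed.

Lemma mxconj1 : mxconj C 1%:M = 1%:M. Proof. by rewrite /mxconj mulmx1 VC. Qed.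

Lemma mxconjM A B : mxconj C (A *m B) = mxconj C A *m mxconj C B.
Proof. by rewrite /mxconj !mulmxA -(mulmxA _ C) CV mulmx1. Qed.

Lemma mxconj_inv A : GLH A -> mxconj C (mxinv A) = mxinv (mxconj C A).
Proof.
move=> gA; have [AV VA] := mxinvP gA; apply/esym/mxinv_uniq; rewrite -mxconjM ?AV ?VA mxconj1 //.
Qed.

Lemma mxconj_onl p f : onl p (mxconj C f *m p) -> onl (C *m p) (f *m (C *m p)).
Proof. by move=> /(onl_mx C); rewrite /mxconj !mulmxA CV mul1mx. Qed.

Lemma mxconj_Sp A : Sp J A -> Sp J' (mxconj C A).
Proof.
move=> SA; split.
  have [AV VA] := mxinvP SA.1.
  by exists (mxconj C (mxinv A)); rewrite -!mxconjM AV VA mxconj1.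
have E : C *m mxconj C A = A *m C by rewrite /mxconj !mulmxA CV mul1mx.
rewrite -[in LHS]CJ.2 !mulmxA -adjmxM -!mulmxA E (mulmxA _ J) adjmxM -!mulmxA.
by rewrite (mulmxA C) CV mul1mx (mulmxA (adjmx A) J) (mulmxA _ A C) SA.2 mulmxA CJ.2.
Qed.

Lemma mxconj_subgroup K : subgroup J K -> subgroup J' (mxconj C @` K).
Proof.
move=> SK; split.
- by move=> _ [A KA <-]; apply: mxconj_Sp; exact: subG SK _ KA.
- by exists 1%:M; [exact: (G1 SK)|exact: mxconj1].
- by move=> _ _ [A KA <-] [B KB <-]; exists (A *m B); [exact: (GM SK)|exact: mxconjM].
move=> _ [A KA <-]; exists (mxinv A); first exact: (GV SK).
by apply: mxconj_inv; case: (subG SK KA).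
Qed.

Lemma nrm_mxconj A : nrm (mxconj C A - 1%:M) <= nrm (mxinv C) * nrm C * nrm (A - 1%:M).
Proof.
have -> : mxconj C A - 1%:M = mxconj C (A - 1%:M).
  by rewrite /mxconj mulmxBr mulmxBl mulmx1 VC.
apply: le_trans (nrmM _ _) _; rewrite mulrAC ler_wpM2r ?nrm_ge0 //.
exact: nrmM.
Qed.

Lemma nrm_mxconjV A : nrm (A - 1%:M) <= nrm C * nrm (mxinv C) * nrm (mxconj C A - 1%:M).
Proof.
have E : A - 1%:M = C *m (mxconj C A - 1%:M) *m mxinv C.
  by rewrite /mxconj mulmxBr mulmx1 mulmxBl !mulmxA CV mul1mx -mulmxA CV mulmx1.
rewrite [in leLHS]E; apply: le_trans (nrmM _ _) _; rewrite mulrAC ler_wpM2r ?nrm_ge0 //.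
exact: nrmM.
Qed.

End Conjugation.

Section Reduction.
Variables (R : realType) (m : nat).
Local Notation H := (quat R).
Implicit Types (A B C g h T f J : 'M[H]_m) (K G : set 'M[H]_m) (z w p : 'cV[H]_m).

Definition near1_trivial K :=
  exists2 e : R, 0 < e & forall A, K A -> nrm (A - 1%:M) < e -> A = 1%:M.

(* Jorgensen's inequality for T, in qualitative form. *)
Definition jorgensen J T p := exists2 e : R, 0 < e & forall f K,
  Sp J f -> nrm (f - 1%:M) < e -> ~ onl p (f *m p) -> subgroup J K ->
  K T -> K (f *m T *m mxinv f) -> ~ near1_trivial K.

(** If [G] is not discrete, a loxodromic [h] near 1 that moves the point of [C *m p] contradicts
    [jorgensen] after conjugation by [C]. A negative [C *m p] is moved by every loxodromic element;
    for a null one [lox_near1_moving] provides [h]. *)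
Lemma jorgensen_discrete J J' G g T p : (0 < m)%N -> lorentz J ->
  subgroup J G -> Zariski_dense J G -> Sp J g -> conj_to J g J' T ->
  negative J' p \/ null J' p -> jorgensen J' T p ->
  (forall h, G h -> loxodromic J h ->
     discrete (generated J [set g; h *m g *m mxinv h])) -> discrete G.
Proof.
move=> m0 HJ HG ZG Sg [C CJ gT] np [e e0 jor] hdisc.
have [[x x0 hx]|nd0] := pselect (near1_trivial G).
  by apply: (near1_discrete HG); exists x.
have nd (x : R) : 0 < x -> exists A, [/\ G A, A <> 1%:M & nrm (A - 1%:M) < x].
  move=> x0; apply: contrapT => h; apply: nd0; exists x => // A GA Ax.
  by apply: contrapT => A1; apply: h; exists A.
pose D := nrm (mxinv C) * nrm C + 1.
have D0 : 0 < D by rewrite ltr_wpDl ?mulr_ge0 ?nrm_ge0.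
have eD : 0 < e / D by rewrite divr_gt0.
have [h [Gh lh he ph]] : exists h, [/\ G h, loxE h, nrm (h - 1%:M) < e / D &
    ~ onl (C *m p) (h *m (C *m p))].
  case: np => np.
    have nCp : negative J (C *m p) by rewrite /negative (form_isometry CJ).
    have [h [Gh lh he]] := exists_small_lox HJ HG ZG m0 nd eD; exists h; split=> // hp.
    have [ne _] := loxE_loxodromic HJ (subG HG Gh) lh; apply: ne.
    exists (pt (C *m p)); first by exists (C *m p).
    rewrite act_pt; apply/esym/onl_pt => //; apply: (Sp_mul_neq0 (subG HG Gh)).
    exact: negative_neq0 nCp.
  apply: (lox_near1_moving HJ HG ZG m0 nd) => //; case: np => p0 pp.
  by split; rewrite ?(isometry_eq0 CJ) ?(form_isometry CJ).
have Sh := subG HG Gh; rewrite ltr_pdivlMr // in he.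
pose K := generated J [set g; h *m g *m mxinv h].
have SK : subgroup J K.
  apply: (generated_subgroup HJ) => _ [->|->] //; apply: (SpM HJ); last exact: SpV.
  exact: (SpM HJ).
have Kg : K g by apply: sub_gen_smallest; left.
have Kh : K (h *m g *m mxinv h) by apply: sub_gen_smallest; right.
have [x x0 hx] := discrete_near1 SK (hdisc h Gh (loxE_loxodromic HJ Sh lh)).
have gE : mxconj C g = T by [].
exfalso; apply: (jor (mxconj C h) (mxconj C @` K)).
- exact: mxconj_Sp CJ _ Sh.
- apply: le_lt_trans (nrm_mxconj CJ _) _; apply: le_lt_trans he.
  by rewrite mulrC ler_wpM2l ?nrm_ge0 // lerDl.
- by move=> /(mxconj_onl CJ).
- exact: (mxconj_subgroup CJ).
- by exists g.
- by exists (h *m g *m mxinv h) => //; rewrite !(mxconjM CJ) (mxconj_inv CJ) ?gE //; case: Sh.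
pose D' := nrm C * nrm (mxinv C) + 1.
have D'0 : 0 < D' by rewrite ltr_wpDl ?mulr_ge0 ?nrm_ge0.
exists (x / D'); first by rewrite divr_gt0.
move=> _ [A KA <-]; rewrite ltr_pdivlMr // => Ax.
rewrite (hx A KA) ?(mxconj1 CJ) //; apply: le_lt_trans (nrm_mxconjV CJ _) _.
by apply: le_lt_trans Ax; rewrite mulrC ler_wpM2l ?nrm_ge0 // lerDl.
Qed.

End Reduction.

(** * Iterated commutators with an element near 1 *)

Section Iteration.
Variables (R : realType) (m : nat).
Local Notation H := (quat R).
Variable J : 'M[H]_m.
Hypothesis HJ : lorentz J.
Implicit Types (A B C D g h T f F : 'M[H]_m) (K G : set 'M[H]_m) (z w p q : 'cV[H]_m).
Let Jh := lorentz_adj HJ.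

Lemma expr_small (q c x : R) : 0 < q -> q < 1 -> 0 < x -> exists k, q ^+ k.+1 * c < x.
Proof.
move=> q0 q1 x0; apply: contrapT => h.
have : x = 0; last by move=> x_0; rewrite x_0 ltxx in x0.
apply: (@expr_unbounded _ q^-1 _ c); [by rewrite invf_gt1|exact: ltW|].
case=> [|k].
  rewrite expr0 mul1r leNgt; apply/negP => cx; apply: h; exists 0%N.
  rewrite expr1; have [c0|c0] := ltP c 0; first by nra.
  by apply: le_lt_trans cx; rewrite ler_piMl // ltW.
rewrite exprVn mulrC ler_pdivrMr ?exprn_gt0 // leNgt mulrC; apply/negP => ?.
by apply: h; exists k.
Qed.

Lemma iter_contracts (step : 'M[H]_m -> 'M[H]_m) (q e : R) :
  0 < q -> q < 1 ->
  (forall F, Sp J F -> nrm (F - 1%:M) <= e ->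
     Sp J (step F) /\ nrm (step F - 1%:M) <= q * nrm (F - 1%:M)) ->
  forall F, Sp J F -> nrm (F - 1%:M) <= e -> forall k,
  [/\ Sp J (iter k step F), nrm (iter k step F - 1%:M) <= e &
      nrm (iter k step F - 1%:M) <= q ^+ k * nrm (F - 1%:M)].
Proof.
move=> q0 q1 hs F SF Fe; elim=> [|k [S1 h1 h2]]; first by rewrite expr0 mul1r.
have [S2 h3] := hs _ S1 h1; split=> //=.
  by apply: le_trans h3 _; apply: le_trans h1; rewrite ler_piMl ?nrm_ge0 // ltW.
by apply: le_trans h3 _; rewrite exprS -mulrA ler_wpM2l // ltW.
Qed.

Lemma nrm_near1 F : nrm (F - 1%:M) <= 1 -> nrm F <= m%:R + 1.
Proof.
move=> h; rewrite -(subrK 1%:M F); apply: le_trans (nrmD _ _) _; rewrite addrC lerD //.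
rewrite /nrm (eq_bigr (fun=> 1)) ?sumr_const ?card_ord // => i _.
rewrite (bigD1 i) //= big1 => [|j ij]; first by rewrite mxE eqxx qabs1 addr0.
by rewrite mxE eq_sym (negPf ij) qabs0.
Qed.

Lemma nrm_inv_near1 F : Sp J F -> nrm (F - 1%:M) <= 1 ->
  nrm (mxinv F) <= nrm J ^+ 2 * (m%:R + 1).
Proof.
move=> SF h; apply: le_trans (nrm_SpV HJ SF) _.
by rewrite ler_wpM2l ?sqr_ge0 // nrm_near1.
Qed.

Lemma commutatorE F T : Sp J F -> Sp J T -> F *m T *m mxinv F *m mxinv T - 1%:M =
  ((F - 1%:M) *m (T - 1%:M) - (T - 1%:M) *m (F - 1%:M)) *m mxinv F *m mxinv T.
Proof.
move=> SF ST; rewrite comm_sub1 !mulmxBl -(mulmxA T F) (SpKV SF) mulmx1 (SpKV ST) //.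
Qed.

Lemma onl_Sp_inv F z : Sp J F -> z != 0 -> onl z (mxinv F *m z) -> onl z (F *m z).
Proof.
move=> SF z0 [a E]; have a0 : a != 0.
  apply: contraTneq (Sp_mul_neq0 (SpV SF) z0) => a0; by rewrite E a0 smul0 eqxx.
exists a^-1; have := congr1 (fun y => F *m y *v a^-1) E.
by rewrite !mulmxA (SpKV SF) mul1mx smulA qmulxV // smul1.
Qed.

Lemma fixed_conj F T z : Sp J F -> onl z (F *m T *m mxinv F *m z) ->
  onl (mxinv F *m z) (T *m (mxinv F *m z)).
Proof.
move=> SF /(onl_mx (mxinv F)); rewrite !mulmxA (SpVK SF) mul1mx //.
Qed.

Lemma onl_comp A B z : onl z (B *m z) -> onl z (A *m z) -> onl z (A *m B *m z).
Proof. by case=> b Bz [a Az]; exists (a * b); rewrite -mulmxA Bz mulmxA Az smulA. Qed.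

Lemma onl_cancelr A B z : Sp J B -> z != 0 -> onl z (B *m z) -> onl z (A *m mxinv B *m z) ->
  onl z (A *m z).
Proof.
move=> SB z0 zB zA; have := onl_comp zB zA; rewrite -(mulmxA A) (SpVK SB) mulmx1 //.
Qed.

(** By [commutatorE] the commutator is within 2 |F - 1| |T - 1| of 1, times the norms of the two
    inverses, each at most [nrm J ^+ 2 * (m%:R + 1)]; the factor 4 in the hypothesis leaves a
    contraction by 1/2. *)
Lemma jorgensen_unipotent T p : Sp J T -> null J p ->
  nrm (T - 1%:M) <= 1 -> 4 * nrm (T - 1%:M) * (nrm J ^+ 2 * (m%:R + 1)) ^+ 2 <= 1 ->
  onl p (T *m p) -> (forall z, null J z -> onl z (T *m z) -> onl p z) ->
  jorgensen J T p.
Proof.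
move=> ST np T1 Tk Tp uniq; exists 1 => // F0 K SF0 F01 pF0 SK KT KFT [x x0 hx].
pose step F := F *m T *m mxinv F *m mxinv T.
have stepP F : Sp J F -> nrm (F - 1%:M) <= 1 ->
    Sp J (step F) /\ nrm (step F - 1%:M) <= 2^-1 * nrm (F - 1%:M).
  move=> SF F1; split.
    by apply: (SpM HJ); [apply: (SpM HJ); [exact: (SpM HJ)|]|]; exact: SpV.
  rewrite commutatorE //; apply: le_trans (nrmM _ _) _.
  have h1 := nrm_inv_near1 SF F1; have h2 := nrm_inv_near1 ST T1.
  have h3 : nrm ((F - 1%:M) *m (T - 1%:M) - (T - 1%:M) *m (F - 1%:M)) <=
      2 * nrm (F - 1%:M) * nrm (T - 1%:M).
    apply: le_trans (nrmB _ _) _; have := nrmM (F - 1%:M) (T - 1%:M).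
    by have := nrmM (T - 1%:M) (F - 1%:M); lra.
  move: h1 h2 h3 Tk (nrm_ge0 (mxinv F)) (nrm_ge0 (mxinv T)) (nrm_ge0 (F - 1%:M)) (nrm_ge0 (T - 1%:M)).
  move: (nrmM ((F - 1%:M) *m (T - 1%:M) - (T - 1%:M) *m (F - 1%:M)) (mxinv F)).
  move: (nrm_ge0 ((F - 1%:M) *m (T - 1%:M) - (T - 1%:M) *m (F - 1%:M))).
  move: (nrm J ^+ 2 * _) (nrm (mxinv F)) (nrm (mxinv T)) (nrm (F - 1%:M)) (nrm (T - 1%:M)) => k a b c d.
  move: (nrm_ge0 (((F - 1%:M) *m (T - 1%:M) - (T - 1%:M) *m (F - 1%:M)) *m mxinv F)).
  move: (nrm (_ *m mxinv F)) (nrm (_ - _)) => t s t0 s0 ts ak bk scd dk a0 b0 c0 d0.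
  apply: (@le_trans _ _ (2 * c * d * k * k)).
    apply: (ler_pM t0 b0 _ bk); apply: le_trans ts _; exact: (ler_pM s0 a0 scd ak).
  have : 0 <= c * (1 - 4 * d * k ^+ 2) by rewrite mulr_ge0 // subr_ge0.
  rewrite expr2; nra.
(* The index starts at 1: [F0] itself is not known to lie in [K]. *)
have KF k : K (iter k.+1 step F0).
  elim: k => [|k IH]; first exact: (GM SK KFT (GV SK KT)).
  by apply: (GM SK); [apply: (GM SK); [exact: (GM SK)|exact: (GV SK)]|exact: (GV SK)].
have q0 : 0 < 2^-1 :> R by rewrite invr_gt0.
have q1 : 2^-1 < 1 :> R by rewrite invf_lt1 ?ltr1n.
have [k hk] := expr_small (nrm (F0 - 1%:M)) q0 q1 x0.
have it := iter_contracts q0 q1 stepP SF0 (ltW F01).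
(* If the commutator fixes [p], so does F T F^-1; then [T] fixes F^-1 p, which by uniqueness is the
   point [p]. *)
have move_ j : ~ onl p (iter j step F0 *m p).
  elim: j => [//|j IH] /= h; apply: IH.
  have [SF _ _] := it j; move: (iter j step F0) SF h => F SF h.
  have {}h := fixed_conj SF (onl_cancelr ST np.1 Tp h).
  apply: (onl_Sp_inv SF np.1); apply: (uniq _ _ h); exact: (null_Sp (SpV SF) np).
have E : iter k.+1 step F0 = 1%:M.
  by apply: hx; [exact: KF|have [_ _ h] := it k.+1; exact: le_lt_trans h hk].
by apply: (move_ k.+1); rewrite E mul1mx; exact: onl_refl.
Qed.

End Iteration.

(** * Iterated commutators conjugated by a dilation *)

Section LoxodromicIteration.
Variables (R : realType) (m : nat).
Local Notation H := (quat R).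
Variable J : 'M[H]_m.
Hypothesis HJ : lorentz J.
Implicit Types (A B C D E g h T f F X : 'M[H]_m) (K G : set 'M[H]_m) (z w p q : 'cV[H]_m).
Local Notation form := (Defs.form J).
Let Jh := lorentz_adj HJ.

Definition comm_mxg F T := F *m T *m mxinv F *m mxinv T.

Lemma comm_mxg_Sp F T : Sp J F -> Sp J T -> Sp J (comm_mxg F T).
Proof.
by move=> SF ST; apply: (SpM HJ); [apply: (SpM HJ); [exact: (SpM HJ)|]|]; exact: SpV.
Qed.

Lemma mxconj_fixed D T : Sp J D -> D *m T = T *m D -> mxconj D T = T.
Proof. by move=> SD DT; rewrite /mxconj -mulmxA -DT mulmxA (SpVK SD) mul1mx. Qed.

Lemma mxconj_comm D T h : Sp J D -> Sp J T -> Sp J h -> D *m T = T *m D ->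
  mxconj D (comm_mxg h T) = comm_mxg (mxconj D h) T.
Proof.
move=> SD ST Sh DT; rewrite /comm_mxg !(mxconjM SD) (mxconj_inv SD Sh.1) (mxconj_inv SD ST.1).
by rewrite (mxconj_fixed SD DT).
Qed.

Lemma mxconj_eq1 X h : Sp J X -> mxconj X h = 1%:M -> h = 1%:M.
Proof.
move=> SX E; have : X *m mxconj X h *m mxinv X = h.
  by rewrite /mxconj !mulmxA (SpKV SX) mul1mx -mulmxA (SpKV SX) mulmx1.
by rewrite E mulmx1 (SpKV SX).
Qed.

Lemma mpowSr D k : mpow D k.+1 = mpow D k *m D.
Proof. by elim: k => [|k IH]; [rewrite mpowS mulmx1 mul1mx|rewrite mpowS {1}IH mulmxA]. Qed.

Lemma Sp_mpow D k : Sp J D -> Sp J (mpow D k).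
Proof.
move=> SD; elim: k => [|k IH]; last exact: (SpM HJ).
by split; [exists 1%:M; rewrite mulmx1|rewrite adjmx1 mul1mx mulmx1].
Qed.

Lemma mpow_comm D T k : D *m T = T *m D -> mpow D k *m T = T *m mpow D k.
Proof.
move=> DT; elim: k => [|k IH]; first by rewrite mul1mx mulmx1.
by rewrite mpowS -mulmxA IH mulmxA DT -mulmxA.
Qed.

Lemma mxconj_mul D X A : GLH D -> GLH X -> mxconj D (mxconj X A) = mxconj (X *m D) A.
Proof.
move=> /mxinvP[DV VD] /mxinvP[XV VX]; rewrite /mxconj !mulmxA; congr (_ *m _ *m _ *m _).
apply/esym/mxinv_uniq; first by rewrite !mulmxA -(mulmxA X) DV mulmx1 XV.
by rewrite !mulmxA -(mulmxA _ _ X) VX mulmx1 VD.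
Qed.

(** The first term is linear in [F - 1%:M] and decides about contraction; the second is of second
    order. *)
Lemma comm_mxgE F T : Sp J F -> Sp J T -> comm_mxg F T - 1%:M =
  (F - 1%:M - T *m (F - 1%:M) *m mxinv T) -
  (F - 1%:M - T *m (F - 1%:M) *m mxinv T) *m (T *m (F - 1%:M) *m mxinv F *m mxinv T).
Proof.
move=> SF ST.
have -> : F - 1%:M - T *m (F - 1%:M) *m mxinv T = (F *m T - T *m F) *m mxinv T.
  rewrite mulmxBr mulmx1 !mulmxBl -(mulmxA F) !(SpKV ST) mulmx1.
  by rewrite opprB addrA subrK.
have -> : T *m (F - 1%:M) *m mxinv F *m mxinv T = 1%:M - T *m mxinv F *m mxinv T.
  by rewrite mulmxBr mulmx1 !mulmxBl -(mulmxA T F) (SpKV SF) mulmx1 (SpKV ST).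
rewrite mulmxBr mulmx1 subKr !mulmxA -(mulmxA _ _ T) (SpVK ST) mulmx1.
by rewrite !mulmxBl -(mulmxA T F) (SpKV SF) mulmx1 (SpKV ST).
Qed.

(** The linear term contributes the factor M, the quadratic one at most M (1 - M) / 2, and the sum
    is at most (1 + M) / 2. *)
Lemma comm_contracts T D F (M : R) : Sp J T -> Sp J D -> 0 <= M -> M < 1 ->
  (forall E, nrm (mxconj D (E - T *m E *m mxinv T)) <= M * nrm E) ->
  Sp J F -> nrm (F - 1%:M) <= 1 ->
  nrm (mxinv D) * (nrm T * (nrm J ^+ 2 * (m%:R + 1)) * nrm (mxinv T)) * nrm D *
    nrm (F - 1%:M) <= (1 - M) / 2 ->
  Sp J (mxconj D (comm_mxg F T)) /\
  nrm (mxconj D (comm_mxg F T) - 1%:M) <= (1 + M) / 2 * nrm (F - 1%:M).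
Proof.
move=> ST SD M0 M1 hM SF F1 Fk; split; first by apply: (mxconj_Sp SD); exact: comm_mxg_Sp.
have -> : mxconj D (comm_mxg F T) - 1%:M = mxconj D (comm_mxg F T - 1%:M).
  by rewrite /mxconj mulmxBr mulmx1 mulmxBl (SpVK SD).
rewrite comm_mxgE //; have hW := hM (F - 1%:M).
set Q := T *m (F - 1%:M) *m mxinv F *m mxinv T.
have hQ : nrm (mxconj D Q) <= (1 - M) / 2.
  apply: le_trans Fk; have F2 := nrm_inv_near1 HJ SF F1.
  have h1 : nrm Q <= nrm T * nrm (F - 1%:M) * (nrm J ^+ 2 * (m%:R + 1)) * nrm (mxinv T).
    apply: le_trans (nrmM _ _) _; rewrite ler_wpM2r ?nrm_ge0 //.
    apply: le_trans (nrmM _ _) _; apply: ler_pM; [exact: nrm_ge0|exact: nrm_ge0|exact: nrmM|exact: F2].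
  apply: le_trans (nrmM _ _) _; rewrite mulrAC ler_wpM2r ?nrm_ge0 //.
  apply: le_trans (nrmM _ _) _; rewrite -[leRHS]mulrA ler_wpM2l ?nrm_ge0 //.
  by apply: le_trans h1 _; rewrite -!(mulrAC _ _ (nrm (F - 1%:M))).
move: (F - 1%:M - _) Q hW hQ => W Q hW hQ.
have -> : mxconj D (W - W *m Q) = mxconj D W - mxconj D W *m mxconj D Q.
  by rewrite -(mxconjM SD) /mxconj mulmxBr mulmxBl.
apply: le_trans (nrmB _ _) _.
apply: (@le_trans _ _ (nrm (mxconj D W) + nrm (mxconj D W) * nrm (mxconj D Q))).
  by rewrite lerD2l nrmM.
move: (nrm_ge0 (mxconj D W)) (nrm_ge0 (mxconj D Q)) (nrm_ge0 (F - 1%:M)) hW hQ.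
move: (nrm (mxconj D W)) (nrm (mxconj D Q)) (nrm (F - 1%:M)) => u v w u0 v0 w0 uM vk.
have : u * v <= M * w * ((1 - M) / 2) by apply: ler_pM.
have : M * w * ((1 - M) / 2) <= w * ((1 - M) / 2).
  by rewrite ler_wpM2r ?divr_ge0 ?subr_ge0 ?(ltW M1) // ler_piMl // ltW.
by move: uM; lra.
Qed.

(** [D] produces the contraction but need not lie in [K]. The last hypothesis repairs this:
    conjugation by the power [k] of [T], which does lie in [K], has the same effect on norms as
    [2 * k] conjugations by [D]. *)
Lemma jorgensen_axis T D p q a b (M : R) :
  Sp J T -> Sp J D -> D *m T = T *m D ->
  null J p -> null J q -> form p q != 0 ->
  T *m p = p *v a -> 1 < qabs a -> T *m q = q *v b -> qabs b < 1 ->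
  onl p (D *m p) -> onl q (D *m q) -> 0 <= M -> M < 1 ->
  (forall E, nrm (mxconj D (E - T *m E *m mxinv T)) <= M * nrm E) ->
  (forall k A, nrm (mxconj (mpow T k) A) = nrm (mxconj (mpow D k.*2) A)) ->
  jorgensen J T p.
Proof.
move=> ST SD DT np nq pq Tp a1 Tq b1 Dp Dq M0 M1 hM hU.
pose k1 := nrm (mxinv D) * (nrm T * (nrm J ^+ 2 * (m%:R + 1)) * nrm (mxinv T)) * nrm D.
have k10 : 0 <= k1 by rewrite !mulr_ge0 ?nrm_ge0 ?sqr_ge0 ?addr_ge0.
pose k2 := nrm p * nrm J * nrm q.
have k20 : 0 <= k2 by rewrite !mulr_ge0 ?nrm_ge0.
(* The bound with [k1] controls the quadratic term; the one with [k2] prevents elements this close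
   to 1 from carrying one end of the axis to the other. *)
have [e [e0 e1 ek1 ek2]] : exists e : R, [/\ 0 < e, e <= 1, k1 * e <= (1 - M) / 2 &
    k2 * e < qabs (form p q)].
  have pq0 : 0 < qabs (form p q) by rewrite qabs_gt0.
  have d1 : 0 < (1 - M) / 2 / (k1 + 1) by rewrite !divr_gt0 ?subr_gt0 ?ltr_wpDl.
  have d2 : 0 < qabs (form p q) / (k2 + 1) by rewrite divr_gt0 ?ltr_wpDl.
  exists (Num.min 1 (Num.min ((1 - M) / 2 / (k1 + 1)) (qabs (form p q) / (k2 + 1)))).
  set e := Num.min _ _; have e0 : 0 < e by rewrite !lt_min ltr01 d1 d2.
  have h1 : e <= (1 - M) / 2 / (k1 + 1) by rewrite !ge_min lexx !orbT.
  have h2 : e <= qabs (form p q) / (k2 + 1) by rewrite !ge_min lexx !orbT.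
  rewrite ler_pdivlMr ?ltr_wpDl // in h1; rewrite ler_pdivlMr ?ltr_wpDl // in h2.
  by split; [exact: e0|rewrite ge_min lexx|nra|nra].
exists e => // F0 K SF0 F0e pF0 SK KT KFT [x x0 hx].
pose step F := mxconj D (comm_mxg F T).
have stepP F : Sp J F -> nrm (F - 1%:M) <= e ->
    Sp J (step F) /\ nrm (step F - 1%:M) <= (1 + M) / 2 * nrm (F - 1%:M).
  move=> SF Fe; apply: (comm_contracts ST SD M0 M1 hM SF (le_trans Fe e1)).
  by apply: le_trans ek1; rewrite ler_wpM2l.
have q0 : 0 < (1 + M) / 2 by rewrite divr_gt0 // ltr_pwDl.
have q1 : (1 + M) / 2 < 1 by lra.
have [k hk] := expr_small (nrm (F0 - 1%:M)) q0 q1 x0.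
have it := iter_contracts q0 q1 stepP SF0 (ltW F0e).
pose h_ j := iter j (comm_mxg^~ T) F0.
have Sh j : Sp J (h_ j) by elim: j => [//|j IH]; exact: comm_mxg_Sp.
(* As [D] commutes with [T], all conjugations can be postponed; the plain commutators [h_] lie in
   [K] from index 1 on. *)
have Fh j : iter j step F0 = mxconj (mpow D j) (h_ j).
  elim: j => [|j IH].
    by rewrite /mxconj mulmx1 (mxinv_uniq (mulmx1 _) (mulmx1 _)) mul1mx.
  have SDj := Sp_mpow j SD.
  rewrite iterS IH mpowSr -(mxconj_mul _ SD.1 SDj.1) /step; congr mxconj.
  by rewrite -mxconj_comm // mpow_comm.
have Kh j : K (h_ j.+1).
  elim: j => [|j IH]; first exact: (GM SK KFT (GV SK KT)).
  by apply: (GM SK); [apply: (GM SK); [exact: (GM SK)|exact: (GV SK)]|exact: (GV SK)].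
have sep F z w : (z = p /\ w = q) \/ (z = q /\ w = p) -> nrm (F - 1%:M) <= e ->
    ~ onl z (F *m w).
  move=> zw Fe h; have nz : null J z by case: zw => -[->].
  have zw_ : qabs (form z w) = qabs (form p q).
    by case: zw => -[-> ->] //; rewrite (formC Jh) qabs_conj.
  have zwk : nrm z * nrm J * nrm w = k2.
    by rewrite /k2; case: zw => -[-> ->] //; rewrite mulrAC [nrm q * _]mulrC mulrAC.
  have E : form z w = - form z ((F - 1%:M) *m w).
    by rewrite mulmxBl mul1mx formBr (null_onl_form nz h) sub0r opprK.
  have : qabs (form p q) <= k2 * e.
    rewrite -zw_ E qabsN; apply: le_trans (qabs_form _ _ _) _.
    rewrite -zwk -[leRHS]mulrA; apply: ler_pM; rewrite ?mulr_ge0 ?nrm_ge0 //.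
    by apply: le_trans (nrmM _ _) _; rewrite mulrC ler_wpM2l ?nrm_ge0.
  by lra.
(* If the commutator fixes the end [z], then [T] fixes F^-1 z, which is one of the two ends and, by
   [sep], not the other one. *)
have fixp F z w : (z = p /\ w = q) \/ (z = q /\ w = p) -> Sp J F ->
    nrm (F - 1%:M) <= e -> onl z (step F *m z) -> onl z (F *m z).
  move=> zw SF Fe h; have nz : null J z by case: zw => -[->].
  have Dz : onl z (D *m z) by case: zw => -[->].
  have Tz : onl z (T *m z).
    by case: zw => -[-> _]; [exists a|exists b].
  have {}h : onl z (comm_mxg F T *m z).
    have h1 : onl (D *m z) (comm_mxg F T *m (D *m z)) by exact: (mxconj_onl SD).
    case: Dz h1 => d Dz; have d0 : d != 0.
      by apply: contraTneq (Sp_mul_neq0 SD nz.1) => d0; rewrite Dz d0 smul0 eqxx.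
    rewrite Dz => -[c E]; exists (d * c * d^-1).
    have := congr1 (fun y => y *v d^-1) E.
    by rewrite -(mulmxA _ (z *v d)) (smulA z d) qmulxV // smul1 (smulA z d) (smulA z).
  have {}h := fixed_conj SF (onl_cancelr ST nz.1 Tz h).
  have nFz := null_Sp (SpV SF) nz.
  apply: (onl_Sp_inv SF nz.1); case: h => c h.
  case: (loxE_fix HJ ST np nq Tp a1 Tq b1 nFz h) => hz.
    case: zw => -[zE wE]; first by rewrite zE in hz *.
    exfalso; apply: (sep F z w _ Fe); first by right.
    have := onl_mx F hz; rewrite mulmxA (SpKV SF) mul1mx -wE.
    by apply: onl_sym; case: nz.
  case: zw => -[zE wE]; last by rewrite zE in hz *.
  exfalso; apply: (sep F z w _ Fe); first by left.
  have := onl_mx F hz; rewrite mulmxA (SpKV SF) mul1mx -wE.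
  by apply: onl_sym; case: nz.
have move_ j : ~ (onl p (iter j step F0 *m p) /\ onl q (iter j step F0 *m q)).
  elim: j => [[]//|j IH] [] h1 h2; apply: IH; have [SF Fe _] := it j.
  by split; [apply: (fixp _ p q); [left| | |]|apply: (fixp _ q p); [right| | |]].
(* An element of [K] as far from 1 as the iterate of index [k.+1.*2], hence equal to 1. *)
pose y := mxconj (mpow T k.+1) (h_ (k.+1).*2).
have STk := Sp_mpow k.+1 ST.
have Ky : K y.
  have KTk : K (mpow T k.+1) by exact: (G_mpow SK).
  by apply: (GM SK) => //; apply: (GM SK); [exact: (GV SK)|exact: Kh].
have y1 : y = 1%:M.
  apply: hx => //.
  have SDk := Sp_mpow k.+1.*2 SD.
  have -> : y - 1%:M = mxconj (mpow T k.+1) (h_ (k.+1).*2 - 1%:M).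
    by rewrite /y /mxconj mulmxBr mulmx1 mulmxBl (SpVK STk).
  rewrite hU.
  have -> : mxconj (mpow D k.+1.*2) (h_ k.+1.*2 - 1%:M) = iter k.+1.*2 step F0 - 1%:M.
    by rewrite Fh /mxconj mulmxBr mulmx1 mulmxBl (SpVK SDk).
  have [_ _ h] := it k.+1.*2; apply: le_lt_trans h _; apply: le_lt_trans hk.
  rewrite ler_wpM2r ?nrm_ge0 // -addnn exprD ler_piMl ?exprn_ge0 ?(ltW q0) //.
  by rewrite exprn_ile1 // ltW.
apply: (move_ k.+1.*2); rewrite Fh.
rewrite (mxconj_eq1 STk y1).
rewrite (mxconj1 (Sp_mpow _ SD)) !mul1mx; split; exact: onl_refl.
Qed.

End LoxodromicIteration.

(** * The loxodromic normal form *)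

Section LoxodromicForm.
Variables (R : realType).
Local Notation H := (quat R).
Implicit Types (a b x : H).

(** This bound divides by [qabs b], its companion [qtwist_leV] multiplies by [qabs a];
    [lox_contract] needs one or the other according to the position of the entry. *)
Lemma qtwist_le a b x : b != 0 ->
  qabs (x - a * x * b^-1) <= (qabs (a - 1) + qabs (b - 1)) / qabs b * qabs x.
Proof.
move=> b0; have -> : x - a * x * b^-1 = (x * (b - 1) - (a - 1) * x) * b^-1.
  rewrite [x * (b - 1)]mulrBr [(a - 1) * x]mulrBl mulr1 mul1r opprB addrA subrK mulrBl.
  by rewrite -(mulrA x) qmulxV // mulr1.
rewrite qabsM qabsV // mulrAC ler_wpM2r ?invr_ge0 ?qabs_ge0 //.
apply: le_trans (qabsB _ _) _; rewrite !qabsM; lra.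
Qed.

Lemma qtwist_leV a b x : a != 0 ->
  qabs (x - a * x * b^-1) <= qabs a * (qabs (a^-1 - 1) + qabs (b^-1 - 1)) * qabs x.
Proof.
move=> a0; have -> : x - a * x * b^-1 = a * ((a^-1 - 1) * x - x * (b^-1 - 1)).
  move: (b^-1) => c; rewrite [x * (c - 1)]mulrBr [(a^-1 - 1) * x]mulrBl mulr1 mul1r opprB addrA subrK mulrBr.
  by rewrite (mulrA a a^-1) qmulxV // mul1r mulrA.
rewrite qabsM -mulrA ler_wpM2l ?qabs_ge0 //.
apply: le_trans (qabsB _ _) _; rewrite !qabsM; lra.
Qed.

Lemma qabs_inv_sub1 a : a != 0 -> qabs (a^-1 - 1) = qabs (a - 1) / qabs a.
Proof.
move=> a0; have -> : a^-1 - 1 = (1 - a) * a^-1 by rewrite mulrBl qmulxV // mul1r.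
by rewrite qabsM qabsV // qabs_distC.
Qed.

Lemma rowfE (I : Type) m (f : 'I_m -> I) i : (\row_j f j) 0 i = f i.
Proof. by rewrite mxE. Qed.

Lemma mxinv_diag m (v : 'rV[H]_m) : (forall i, v 0 i != 0) ->
  mxinv (diag_mx v) = diag_mx (\row_i (v 0 i)^-1).
Proof.
move=> v0; apply: mxinv_uniq; rewrite diag_mxM; apply/matrixP => i j; rewrite !mxE.
  by rewrite qmulxV.
by rewrite qmulVx.
Qed.

Lemma mxconj_diagE m (v : 'rV[H]_m) (A : 'M[H]_m) i j : (forall i, v 0 i != 0) ->
  mxconj (diag_mx v) A i j = (v 0 i)^-1 * A i j * v 0 j.
Proof. by move=> v0; rewrite /mxconj mxinv_diag // diag_conjE mxE. Qed.

Lemma mpow_diag m (v : 'rV[H]_m) k : mpow (diag_mx v) k = diag_mx (\row_i (v 0 i) ^+ k).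
Proof.
elim: k => [|k IH]; last first.
  by rewrite mpowS IH diag_mxM; congr diag_mx; apply/rowP => i; rewrite !mxE exprS.
by apply/matrixP => i j; rewrite !mxE expr0.
Qed.

Lemma diag_delta m (v : 'rV[H]_m) i : diag_mx v *m delta_mx i 0 = (delta_mx i 0 : 'cV[H]_m) *v v 0 i.
Proof.
apply/matrixP => k j; rewrite ord1 mul_diag_mx smulE !mxE eqxx andbT.
by case: eqP => [->|_]; rewrite ?mulr1 ?mul1r ?mulr0 ?mul0r.
Qed.

Variables (n : nat) (l1 : H) (mu : 'rV[H]_n).
Hypotheses (l1_gt1 : 1 < qabs l1) (mu1 : forall i, qabs (mu 0 i) = 1).
Hypothesis M1 : M_lox l1 mu < 1.

Definition lox_row : 'rV[H]_n.+2 := (row_mx (row_mx l1%:M ((qconj l1)^-1)%:M) mu : 'rV[H]_(1 + 1 + n)).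

Lemma lox_rowE (i : 'I_n.+2) : lox_row 0 i =
  match nat_of_ord i with 0%N => l1 | 1%N => (qconj l1)^-1 | k.+2 => odflt 1 (omap (mu 0) (insub k)) end.
Proof.
rewrite /lox_row mxE; case: splitP => a /= ->.
  by rewrite mxE; case: splitP => b ->; rewrite !mxE !ord1 eqxx.
by rewrite add2n insubT //= => ha; congr (mu 0 _); apply: val_inj.
Qed.

Let r := qabs l1.
Let s := Num.sqrt r.
Let u := qabs (l1 - 1).
Let d := delta_cp mu.
Let T := diag_mx lox_row.

Let r0 : 0 < r. Proof. exact: lt_trans l1_gt1. Qed.
Let l10 : l1 != 0. Proof. by rewrite -qabs_gt0. Qed.
Let s0 : 0 < s. Proof. by rewrite sqrtr_gt0. Qed.
Let ss : s * s = r. Proof. by rewrite -expr2 sqr_sqrtr // ltW. Qed.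
Let s1 : 1 <= s. Proof. by rewrite -sqrtr1 ler_sqrt ?(ltW r0) // (ltW l1_gt1). Qed.
Let d0 : 0 <= d. Proof. exact: bigmax_ge_id. Qed.
Let cl0 : qconj l1 != 0. Proof. by rewrite qconj_eq0. Qed.
Let cu : qabs (qconj l1 - 1) = u.
Proof. by rewrite -[1](@qconj1 R) -raddfB qabs_conj. Qed.

Lemma M_loxE : M_lox l1 mu = 2 * d + u + u / r.
Proof. by rewrite /M_lox -/d -/u qabs_inv_sub1 // qabs_conj cu. Qed.

Let unit_entry k : let y := odflt 1 (omap (mu 0) (insub k)) in
  [/\ y != 0, qabs y = 1 & qabs (y - 1) <= d].
Proof.
case: insubP => [i _ _|_] /=; last by rewrite subrr qabs0 qabs1 oner_eq0.
rewrite -qabs_eq0 mu1 oner_eq0; split=> //.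
exact: (le_bigmax _ (fun i => qabs (mu 0 i - 1))).
Qed.

Lemma lox_row_neq0 i : lox_row 0 i != 0.
Proof.
rewrite lox_rowE; case: (nat_of_ord i) => [|[|k]] //; first exact: qinv_neq0.
by case: (unit_entry k).
Qed.

Definition dil_wt (t : R) (i : nat) : R := if i == 0%N then t else if i == 1%N then t^-1 else 1.

Let wt0 i : 0 < dil_wt s i.
Proof. by rewrite /dil_wt; case: i => [|[|i]] //=; rewrite invr_gt0. Qed.

Lemma lox_row_abs i : qabs (lox_row 0 i) = dil_wt s i ^+ 2.
Proof.
rewrite lox_rowE /dil_wt; case: (nat_of_ord i) => [|[|k]] /=.
- exact: (esym ss).
- by rewrite qabsV // qabs_conj exprVn -[s ^+ 2]/(s * s) ss.
by rewrite expr1n; case: (unit_entry k).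
Qed.

(** Let r = |l1| and u = |l1 - 1|. Without the dilation the entry (0, 1) could grow by r (u + u /
    r). The weight 1 / r reduces this to u + u / r, at the cost of the entry (1, 0), whose factor
    rises from (u + u / r) / r to the same value; the parameter sqrt r is the one that balances the
    two. *)
Lemma lox_contract (E : 'M[H]_n.+2) :
  nrm (mxconj (dil n s) (E - T *m E *m mxinv T)) <= M_lox l1 mu * nrm E.
Proof.
rewrite /nrm big_distrr; apply: ler_sum => i _; rewrite big_distrr; apply: ler_sum => j _ /=.
have w0 k : (\row_i qreal (dil_wt s i) : 'rV[H]_n.+2) 0 k != 0.
  by rewrite rowfE qreal_eq0 gt_eqF.
have -> : dil n s = diag_mx (\row_i qreal (dil_wt s i)) by [].
rewrite mxconj_diagE // /T mxinv_diag ?diag_conjE; last exact: lox_row_neq0.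
have subE (A B : 'M[H]_n.+2) : (A - B) i j = A i j - B i j by rewrite !mxE.
rewrite subE diag_conjE !rowfE.
rewrite qabsM qabsM qabsV ?qreal_eq0 ?gt_eqF // !qabs_real !gtr0_norm //.
move: (E i j) => x; rewrite M_loxE.
suff [c hc cM] : exists2 c, qabs (x - lox_row 0 i * x * (lox_row 0 j)^-1) <= c * qabs x &
    (dil_wt s i)^-1 * dil_wt s j * c <= 2 * d + u + u / r.
  apply: (@le_trans _ _ ((dil_wt s i)^-1 * dil_wt s j * (c * qabs x))).
    by rewrite mulrAC ler_wpM2l // mulr_ge0 // ?invr_ge0 ltW.
  by rewrite mulrA ler_wpM2r // qabs_ge0.
have hL := qtwist_le (lox_row 0 i) x (lox_row_neq0 j).
have hR := qtwist_leV (lox_row 0 j) x (lox_row_neq0 i).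
have u0 : 0 <= u := qabs_ge0 _.
have e1 : qabs ((qconj l1)^-1 - 1) = u / r by rewrite qabs_inv_sub1 // qabs_conj cu.
have e2 : qabs (qconj l1)^-1 = r^-1 by rewrite qabsV // qabs_conj.
have e3 : qabs ((qconj l1)^-1^-1 - 1) = u.
  by rewrite qabs_inv_sub1 ?qinv_neq0 // e1 e2 invrK mulfVK ?gt_eqF.
have eV k : let y := odflt 1 (omap (mu 0) (insub k)) in qabs (y^-1 - 1) <= d.
  by have [y0 y1 yd] := unit_entry k => /=; rewrite qabs_inv_sub1 // y1 divr1.
have [t [t0 t1 ts tr tV]] : exists t, [/\ 0 < t, t <= 1, t * s = 1, r^-1 = t * t & s^-1 = t].
  exists s^-1; rewrite invr_gt0 s0 mulVf ?gt_eqF // -ss invfM; split=> //.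
  by rewrite invf_le1.
have tVV : t^-1 = s by rewrite -tV invrK.
have ut : 0 <= u * (t * t) by rewrite !mulr_ge0 // ltW.
have ut1 : u * (t * t) <= u.
  by rewrite ler_piMr // mulr_ile1 // ltW.
have udt : t * (u + d) <= u + d by rewrite ler_piMl // addr_ge0.
(* One bound for each kind of position: (0, 0) and (1, 1); (0, 1) and (1, 0); exactly one index
   above 1; both above 1. *)
have [B1 B2 B3 B4] : [/\ u * (t * t) + u * (t * t) <= 2 * d + u + u * (t * t),
    u + u * (t * t) <= 2 * d + u + u * (t * t),
    t * (u + d) <= 2 * d + u + u * (t * t) & d + d <= 2 * d + u + u * (t * t)].
  move: d0 u0 ut ut1 udt; move: (t * (u + d)) (u * (t * t)); move: (u) (d).
  by move=> u' d' k v ? ? ? ? ?; split; lra.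
rewrite tr; move: hL hR; rewrite !lox_rowE /dil_wt /=.
move: (nat_of_ord i) (nat_of_ord j) => i' j'.
case: i' => [|[|k]]; case: j' => [|[|l]] /= hL hR.
- exists ((u + u) * (t * t)); first by rewrite -tr.
  by rewrite tV ts mul1r mulrDl.
- exists ((u + u * (t * t)) * (s * s)).
    by move: hL; rewrite e1 e2 (invrK r) -/u tr -ss.
  have -> : s^-1 * s^-1 * ((u + u * (t * t)) * (s * s)) = (t * s) ^+ 2 * (u + u * (t * t)).
    by rewrite tV; ring.
  by rewrite ts expr1n mul1r.
- case: (unit_entry l) hL => y0 y1 yd hL; exists (u + d).
    apply: le_trans hL _; rewrite y1 divr1 -/u ler_wpM2r ?qabs_ge0 // lerD2l //.
  by rewrite tV mulr1.
- exists ((u * (t * t) + u) * (t * t)).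
    by move: hL; rewrite e1 -/u -/r tr.
  have -> : s^-1^-1 * s * ((u * (t * t) + u) * (t * t)) = (t * s) ^+ 2 * (u + u * (t * t)).
    by rewrite invrK; ring.
  by rewrite ts expr1n mul1r.
- exists (t * t * (u + u)); first by move: hR; rewrite e2 e3 tr.
  by rewrite tV tVV [s * t]mulrC ts mul1r [t * t * _]mulrC mulrDl.
- have yd := eV l; exists (t * t * (u + d)).
    apply: le_trans hR _; rewrite e2 e3 tr ler_wpM2r ?qabs_ge0 // ler_wpM2l ?lerD2l //.
    by rewrite mulr_ge0 // ltW.
  have -> : s^-1^-1 * 1 * (t * t * (u + d)) = (t * s) * (t * (u + d)) by rewrite invrK; ring.
  by rewrite ts mul1r.
- case: (unit_entry k) hL => y0 y1 yd hL; exists ((d + u) * (t * t)).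
    apply: le_trans hL _; rewrite -/u -/r tr ler_wpM2r ?qabs_ge0 // ler_wpM2r ?lerD2r //.
    by rewrite mulr_ge0 // ltW.
  have -> : 1^-1 * s * ((d + u) * (t * t)) = (t * s) * (t * (u + d)) by rewrite invr1; ring.
  by rewrite ts mul1r.
- case: (unit_entry k) => y0 y1 _; have yd := eV k; exists (d + u).
    by apply: le_trans hR _; rewrite y1 e3 mul1r ler_wpM2r ?qabs_ge0 // lerD2r.
  by rewrite tV invr1 mul1r addrC.
case: (unit_entry k) => _ _ yk; case: (unit_entry l) hL => _ yl1 yl hL; exists (d + d).
  by apply: le_trans hL _; rewrite yl1 divr1 ler_wpM2r ?qabs_ge0 // lerD.
by rewrite invr1 !mul1r.
Qed.

Lemma jorgensen_loxodromic_form : Sp (J2 R n) T -> jorgensen (J2 R n) T (delta_mx ord0 0).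
Proof.
move=> ST; have sN : s != 0 by rewrite gt_eqF.
have SD := dil_Sp n sN; pose i1 : 'I_n.+2 := lift ord0 ord0.
have DE : dil n s = diag_mx (\row_i qreal (dil_wt s i)) by [].
have w0 k : (\row_i qreal (dil_wt s i) : 'rV[H]_n.+2) 0 k != 0.
  by rewrite rowfE qreal_eq0 gt_eqF.
apply: (jorgensen_axis (lorentz_J2 R n) (D := dil n s) (q := delta_mx i1 0) (a := l1)
  (b := (qconj l1)^-1) (M := M_lox l1 mu) ST SD).
- rewrite DE !diag_mxM; congr diag_mx; apply/rowP => i; rewrite !mxE.
  by rewrite qrealC.
- by split; [exact: delta_neq0|rewrite form_delta J2E].
- by split; [exact: delta_neq0|rewrite form_delta J2E].
- by rewrite form_delta J2E /= oppr_eq0 oner_eq0.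
- by rewrite /T diag_delta lox_rowE.
- exact: l1_gt1.
- by rewrite /T diag_delta lox_rowE.
- by rewrite qabsV // qabs_conj invf_lt1.
- by exists (qreal s); rewrite DE diag_delta rowfE.
- by exists (qreal s^-1); rewrite DE diag_delta rowfE.
- by rewrite M_loxE !addr_ge0 ?mulr_ge0 ?qabs_ge0 ?invr_ge0 ?(ltW r0).
- exact: M1.
- exact: lox_contract.
(* The eigenvalues of [T] have the squared weights of the dilation as moduli, so both conjugations
   scale every entry alike. *)
move=> k A; apply: eq_bigr => i _; apply: eq_bigr => j _.
have vk e : (\row_i lox_row 0 i ^+ k) 0 e != 0.
  by rewrite rowfE -qabs_eq0 qabsX expf_neq0 // qabs_eq0 lox_row_neq0.
have wk e : (\row_i (\row_i0 qreal (dil_wt s i0) : 'rV[H]_n.+2) 0 i ^+ k.*2) 0 e != 0.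
  by rewrite rowfE -qabs_eq0 qabsX expf_neq0 // qabs_eq0 w0.
rewrite DE /T !mpow_diag !mxconj_diagE //.
rewrite [in LHS]qabsM [in LHS]qabsM qabsV // [in RHS]qabsM [in RHS]qabsM qabsV //.
rewrite !rowfE !qabsX !lox_row_abs !qabs_real !(gtr0_norm (wt0 _)).
by rewrite -!exprM -mul2n.
Qed.

End LoxodromicForm.

(** * Heisenberg translations *)

Section HeisenbergForm.
Variables (R : realType) (n : nat).
Local Notation H := (quat R).
Implicit Types (g C T A : 'M[H]_n.+2).

Lemma parabolic_uniq m (J J' C g : 'M[H]_m) p z : parabolic J g -> Sp J g ->
  Defs.isometry J' J C -> null J' p -> null J' z ->
  onl p (mxconj C g *m p) -> onl z (mxconj C g *m z) -> onl p z.
Proof.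
move=> [_ [P fixP]] Sg CJ np nz hp hz.
have h y : null J' y -> onl y (mxconj C g *m y) -> pt (C *m y) = P.
  move=> ny /(mxconj_onl CJ) hy; have nCy : null J (C *m y).
    by case: ny => y0 yy; split; rewrite ?(isometry_eq0 CJ) ?(form_isometry CJ).
  suff : fix_bd J g (pt (C *m y)) by rewrite fixP.
  split; first by exists (C *m y).
  by rewrite act_pt; apply/esym/onl_pt => //; exact: (Sp_mul_neq0 Sg nCy.1).
have : pt (C *m p) = pt (C *m z) by rewrite !h.
move=> /pt_onl /(onl_mx (mxinv C)); case: (mxinvP CJ.1) => _ VC.
by rewrite !mulmxA VC !mul1mx.
Qed.

Lemma heisE (s : H) (zeta : 'cV[H]_n) (i j : 'I_n.+2) :
  (i == 0 :> nat) || (i == 1 :> nat) && (j == 1 :> nat) || (1 < i)%N && (0 < j)%N ->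
  (heis s zeta - 1%:M) i j = 0.
Proof.
have E : (heis s zeta - 1%:M) i j = heis s zeta i j - (i == j)%:R by rewrite !mxE.
rewrite E /heis -val_eqE /= !mxE.
case: splitP => a ->; rewrite !mxE; case: splitP => b ->; rewrite ?mxE.
- case: splitP => a' ->; rewrite !mxE; case: splitP => b' ->; rewrite ?mxE ?ord1 //= ?subrr ?subr0 //.
- case: splitP => a' ->; rewrite !mxE ?ord1 //= subr0 //.
- by case: splitP => b' ->; rewrite ?mxE ?ord1 //= ?subr0.
by rewrite eqn_add2l val_eqE subrr.
Qed.

(** The entries of [heis s zeta - 1%:M] sit at (1, 0), where the dilation scales by [t ^+ 2], and at
    (1, j) and (i, 0) with i, j > 1, where it scales by [t]. *)
Lemma heis_dil_le (s : H) (zeta : 'cV[H]_n) (t : R) : 0 < t -> t <= 1 ->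
  nrm (mxconj (dil n t) (heis s zeta) - 1%:M) <= t * nrm (heis s zeta - 1%:M).
Proof.
move=> t0 t1; have SD := dil_Sp n (lt0r_neq0 t0); have [_ VD] := mxinvP SD.1.
have -> : mxconj (dil n t) (heis s zeta) - 1%:M = mxconj (dil n t) (heis s zeta - 1%:M).
  by rewrite /mxconj mulmxBr mulmxBl mulmx1 VD.
rewrite /nrm big_distrr; apply: ler_sum => i _; rewrite big_distrr; apply: ler_sum => j _ /=.
have wt0 k : 0 < dil_wt t k by rewrite /dil_wt; case: k => [|[|k]] //=; rewrite invr_gt0.
have w0 k : (\row_i qreal (dil_wt t i) : 'rV[H]_n.+2) 0 k != 0.
  by rewrite rowfE qreal_eq0 gt_eqF.
have -> : dil n t = diag_mx (\row_i qreal (dil_wt t i)) by [].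
rewrite mxconj_diagE // !rowfE qabsM qabsM qabsV ?qreal_eq0 ?gt_eqF // !qabs_real !gtr0_norm //.
have := @heisE s zeta i j; move: ((heis s zeta - 1%:M) i j) => x h.
rewrite mulrAC; have [c1|c1] := boolP ((i == 0 :> nat) || (i == 1 :> nat) && (j == 1 :> nat) || (1 < i)%N && (0 < j)%N).
  by rewrite (h c1) qabs0 !mulr0.
rewrite ler_wpM2r ?qabs_ge0 //; move: c1; rewrite /dil_wt.
case: (nat_of_ord i) => [|[|k]] //; case: (nat_of_ord j) => [|[|l]] //= _.
- by rewrite invrK ler_piMr // ltW.
- by rewrite invrK mulr1.
by rewrite invr1 mul1r.
Qed.

Lemma jorgensen_heisenberg J g s zeta : Sp J g -> parabolic J g ->
  conj_to J g (J2 R n) (heis s zeta) ->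
  exists T p, [/\ conj_to J g (J2 R n) T, null (J2 R n) p & jorgensen (J2 R n) T p].
Proof.
move=> Sg par [C CJ gE]; set N := nrm (heis s zeta - 1%:M).
pose k := (nrm (J2 R n) ^+ 2 * (n.+2%:R + 1)) ^+ 2.
have N0 : 0 <= N := nrm_ge0 _; have k0 : 0 <= k by rewrite sqr_ge0.
(* The summands of the denominator give [t <= 1], [t * N <= 1] and [4 * (t * N) * k <= 1]; the last
   two are what [jorgensen_unipotent] asks of the shrunken translation. *)
pose t := (1 + N + 4 * (N * k))^-1.
have Nk : 0 <= N * k by rewrite mulr_ge0.
have b0 : 0 < 1 + N + 4 * (N * k) by move: N0 Nk; lra.
have t0 : 0 < t by rewrite invr_gt0.
have t1 : t <= 1 by rewrite invf_le1 //; move: N0 Nk; lra.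
pose i1 : 'I_n.+2 := lift ord0 ord0.
have SD := dil_Sp n (lt0r_neq0 t0); have [DV VD] := mxinvP SD.1.
have C'J : Defs.isometry (J2 R n) J (C *m dil n t).
  split; last first.
    rewrite adjmxM !mulmxA -(mulmxA (adjmx (dil n t)) (adjmx C)).
    by rewrite -(mulmxA (adjmx (dil n t)) (adjmx C *m J)) CJ.2 SD.2.
  have [CV VC] := mxinvP CJ.1; exists (mxinv (dil n t) *m mxinv C).
  by rewrite !mulmxA -(mulmxA C) DV mulmx1 CV -(mulmxA _ _ C) VC mulmx1 VD.
have TE : mxconj (C *m dil n t) g = mxconj (dil n t) (heis s zeta).
  by rewrite -(mxconj_mul _ SD.1 CJ.1) -gE.
exists (mxconj (C *m dil n t) g), (delta_mx i1 0).
have ne : null (J2 R n) (delta_mx i1 0).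
  by split; [exact: delta_neq0|rewrite form_delta J2E].
have He : heis s zeta *m delta_mx i1 0 = delta_mx i1 0 :> 'cV[H]_n.+2.
  apply/eqP; rewrite -subr_eq0 -{2}[delta_mx i1 0]mul1mx -mulmxBl; apply/eqP.
  apply/matrixP => i j; rewrite ord1 -colE mxE heisE ?mxE //.
  by case: i => -[|[|i]] hi.
have fe : onl (delta_mx i1 0) (mxconj (C *m dil n t) g *m delta_mx i1 0).
  have De : dil n t *m delta_mx i1 0 = (delta_mx i1 0 : 'cV[H]_n.+2) *v qreal t^-1.
    by rewrite /dil diag_delta rowfE.
  rewrite TE; have [d0 De'] := eigen_inv SD ne.1 De.
  by eexists; rewrite /mxconj -!mulmxA De (mulmxA (heis s zeta)) He mulmxA De' smulA.
split; [by exists (C *m dil n t)|exact: ne|].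
have ht := heis_dil_le s zeta t0 t1; rewrite -/N in ht.
apply: (jorgensen_unipotent (lorentz_J2 R n)) => //.
- exact: (mxconj_Sp C'J).
- rewrite TE; apply: le_trans ht _; rewrite /t mulrC ler_pdivrMr //; move: N0 Nk; lra.
- rewrite TE -/k; apply: (@le_trans _ _ (4 * (t * N) * k)).
    by rewrite ler_wpM2r // ler_wpM2l.
  have -> : 4 * (t * N) * k = 4 * (N * k) * t by ring.
  by rewrite /t ler_pdivrMr //; move: N0 Nk; lra.
by move=> z nz hz; exact: (parabolic_uniq par Sg C'J ne nz fe hz).
Qed.

End HeisenbergForm.

(** * The elliptic normal form *)

Section EllipticForm.
Variables (R : realType).
Local Notation H := (quat R).

Lemma qconj_trans (a x y : H) : x != 0 -> y != 0 ->
  x * y^-1 * (y * a * y^-1) * (x * y^-1)^-1 = x * a * x^-1.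
Proof.
move=> x0 y0; have xy0 : x * y^-1 != 0 by rewrite qmul_eq0 negb_or x0 qinv_neq0.
have -> : x * y^-1 * (y * a * y^-1) = x * a * x^-1 * (x * y^-1).
  move: (y^-1) (x^-1) (qmulVx y0) (qmulVx x0) => y' x' hy hx.
  by rewrite !mulrA -(mulrA x y') hy mulr1 -(mulrA (x * a) x') hx mulr1.
by rewrite -(mulrA (x * a * x^-1)) qmulxV // mulr1.
Qed.

(** Two terms close to a common limit have a quotient close to 1, hence equal to 1. *)
Lemma bounded_repeats m (J : 'M[H]_m) K (F : nat -> 'M[H]_m) (C : R) : lorentz J ->
  subgroup J K -> near1_trivial K -> (forall k, K (F k)) -> (forall k, nrm (F k) <= C) ->
  exists j k, (j < k)%N /\ F j = F k.
Proof.
move=> HJ SK [x x0 hx] KF FC; have [U [UU Uinf]] := nat_ultra; have PU := @ultra_proper _ _ UU.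
have [L FL] : exists L, mcvg U F L by apply: (ultra_cvg (C := C) UU); exact: nearW.
have C0 : 0 <= C by apply: le_trans (nrm_ge0 _) (FC 0%N).
pose B := nrm J ^+ 2 * C; have B0 : 0 <= B by rewrite mulr_ge0 ?sqr_ge0.
pose d := x / (B + 1) / 2; have d0 : 0 < d by rewrite !divr_gt0 ?ltr_wpDl.
have [k hk] := filter_ex (FL _ d0).
have [j [hj kj]] := filter_ex (filterI (FL _ d0) (Uinf k.+1)).
exists k, j; split=> //; have SF := subG SK (KF k).
suff : F j *m mxinv (F k) = 1%:M.
  by move/(congr1 (mulmx^~ (F k))); rewrite -mulmxA (SpVK SF) mulmx1 mul1mx.
apply: hx; first exact: (GM SK (KF j) (GV SK (KF k))).
rewrite -(SpKV SF) -mulmxBl; apply: le_lt_trans (nrmM _ _) _.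
have hd : nrm (F j - F k) <= d + d.
  have -> : F j - F k = (F j - L) - (F k - L) by rewrite opprB addrA subrK.
  by apply: le_trans (nrmB _ _) _; rewrite lerD // ltW.
have hV : nrm (mxinv (F k)) <= B.
  by apply: le_trans (nrm_SpV HJ SF) _; rewrite ler_wpM2l ?sqr_ge0.
apply: (@le_lt_trans _ _ ((d + d) * B)); first by apply: ler_pM => //; exact: nrm_ge0.
have -> : d + d = x / (B + 1) by rewrite /d; field; rewrite gt_eqF // ltr_wpDl.
by rewrite mulrAC ltr_pdivrMr ?ltr_wpDl // ltr_pM2l // ltrDl.
Qed.

Variable n : nat.
Let J := J1 R n.
Local Notation form := (Defs.form J).
Local Notation e0 := (delta_mx ord0 0 : 'cV[H]_n.+2).
Let HJ := lorentz_J1 R n.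
Let Jh := lorentz_adj HJ.

Lemma formJ1E (z w : 'cV[H]_n.+2) :
  form z w = \sum_(i < n.+1) qconj (z (lift ord0 i) 0) * w (lift ord0 i) 0
     - qconj (z ord0 0) * w ord0 0.
Proof.
rewrite form_def -mulmxA mxE big_ord_recl addrC.
have JE (i : 'I_n.+2) : (J *m w) i 0 = if i == ord0 then - w i 0 else w i 0.
  rewrite mxE (bigD1 i) //= big1 => [|k ki]; last by rewrite J1E eq_sym (negPf ki) mul0r.
  by rewrite J1E eqxx addr0; case: eqP => _; rewrite ?mulN1r ?mul1r.
congr (_ + _); last by rewrite adjmxE JE eqxx mulrN.
by apply: eq_bigr => i _; rewrite adjmxE JE.
Qed.

Lemma form_e0 (z : 'cV[H]_n.+2) : form e0 z = - z ord0 0.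
Proof.
rewrite formJ1E big1 => [|i _]; first by rewrite !mxE !eqxx qconj1 mul1r sub0r.
by rewrite !mxE /= raddf0 mul0r.
Qed.

Lemma qre_formJ1 (z : 'cV[H]_n.+2) : qre (form z z) = vn2 z - 2 * qnorm2 (z ord0 0).
Proof.
rewrite formJ1E raddfB /= qCmul /= raddf_sum /=.
have -> : vn2 z = qnorm2 (z ord0 0) + \sum_(i < n.+1) qnorm2 (z (lift ord0 i) 0).
  by rewrite /vn2 big_ord_recl.
rewrite (eq_bigr (fun i => qnorm2 (z (lift ord0 i) 0))) => [|i _]; last by rewrite qCmul.
by move: (\sum_(_ < _) _) (qnorm2 _) => a b; lra.
Qed.

Lemma negative_e0 : negative J e0.
Proof. by rewrite /negative form_delta J1E /= ltrN10. Qed.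

(** The corner entry tells how far the base point moves. It bounds the first row through
    [mxinv F *m e0], of Euclidean square at most [2 * 2 - 1 = 3], and then every column, of
    Euclidean square at most [2 * 3 + 1 = 7]. *)
Lemma Sp_J1_bounded F : Sp J F -> qnorm2 (F ord0 ord0) <= 2 -> nrm F <= n.+2%:R * (n.+2%:R * 7).
Proof.
move=> SF a2; have xx := form_Sp e0 e0 (SpV SF).
pose x := mxinv F *m e0.
have x0 : qnorm2 (x ord0 0) = qnorm2 (F ord0 ord0).
  have := congr1 (@qnorm2 R) (form_SpVr e0 e0 SF); rewrite -/x form_e0 qnorm2N => <-.
  by rewrite (formC Jh e0) qnorm2_conj form_e0 qnorm2N -colE mxE.
have vx : vn2 x <= 3.
  have := qre_formJ1 x; rewrite x0 [form x x]xx form_delta J1E /=; lra.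
have row j : qnorm2 (F ord0 j) <= 3.
  have := congr1 (@qnorm2 R) (form_SpV e0 (delta_mx j 0) SF); rewrite -/x form_e0 qnorm2N -colE mxE => <-.
  apply: le_trans vx; rewrite /vn2 (bigD1 j) //=.
  have -> : qnorm2 (form x (delta_mx j 0)) = qnorm2 (x j 0).
    rewrite form_def -colE mxE mxE (bigD1 j) //= big1 => [|k kj]; last by rewrite J1E (negPf kj) mulr0.
    rewrite J1E eqxx adjmxE addr0; case: eqP => _; by rewrite ?mulrN1 ?mulr1 ?qnorm2N qnorm2_conj.
  by rewrite lerDl sumr_ge0 // => ? _; exact: qnorm2_ge0.
have ent i j : qabs (F i j) <= 7.
  have : qnorm2 (F i j) <= 7.
    apply: (@le_trans _ _ (vn2 (F *m delta_mx j 0))).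
      rewrite /vn2 -colE (bigD1 i) //= mxE lerDl sumr_ge0 // => ? _; exact: qnorm2_ge0.
    have := qre_formJ1 (F *m delta_mx j 0); rewrite (form_Sp _ _ SF) form_delta J1E eqxx -colE.
    have := row j; rewrite mxE; case: eqP => _ /=; lra.
  by rewrite -sqr_qabs; have := qabs_ge0 (F i j); nra.
rewrite /nrm; apply: (@le_trans _ _ (\sum_(i < n.+2) \sum_(j < n.+2) 7)).
  by do 2![apply: ler_sum => ? _].
by rewrite sumr_const card_ord sumr_const card_ord !mulr_natl.
Qed.

Variable lam : 'rV[H]_n.+2.
Hypotheses (lam1 : forall i, qabs (lam 0 i) = 1) (reg : regular lam).
Hypothesis d1 : delta lam < 1.
Let T := diag_mx lam.

(** A nonzero entry [z i 0] makes [lam 0 i] similar to the eigenvalue [a]. The first entry of a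
    negative vector is nonzero, so regularity leaves no other. *)
Lemma regular_fixed z : negative J z -> onl z (T *m z) -> onl e0 z.
Proof.
move=> nz [a hz]; have entry i : lam 0 i * z i 0 = z i 0 * a.
  have /matrixP/(_ i 0) := hz; rewrite mul_diag_mx mxE smulE //.
have z0 : z ord0 0 != 0.
  apply: contraTneq nz => z0; rewrite /negative qre_formJ1 z0 -leNgt.
  by rewrite [qnorm2 0](_ : _ = 0) ?mulr0 ?subr0 ?vn2_ge0 //; apply/eqP; rewrite qnorm2_eq0.
exists (z ord0 0); apply/matrixP => i j; rewrite ord1 smulE !mxE eqxx andbT.
have [->|i0] := eqVneq i ord0; first by rewrite mul1r.
rewrite mul0r; apply/eqP/negPn/negP => zi.
have : ord0 = i.
  apply: (reg I I); exists (lam 0 ord0); split.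
    by exists 1; rewrite /= ?oner_neq0 // invr1 mul1r mulr1.
  have := entry ord0; have := entry i => ei e0_.
  exists (z ord0 0 * (z i 0)^-1).
    by rewrite /= qmul_eq0 negb_or z0 qinv_neq0.
  have -> : lam 0 i = z i 0 * a * (z i 0)^-1 by rewrite -ei -mulrA qmulxV // mulr1.
  have -> : lam 0 ord0 = z ord0 0 * a * (z ord0 0)^-1 by rewrite -e0_ -mulrA qmulxV // mulr1.
  exact: qconj_trans.
by move=> E; rewrite -E eqxx in i0.
Qed.

Lemma delta_ge i : qabs (lam 0 ord0 - 1) + qabs (lam 0 (lift ord0 i) - 1) <= delta lam.
Proof. exact: (le_bigmax _ (fun i => qabs (lam 0 ord0 - 1) + qabs (lam 0 (lift ord0 i) - 1))). Qed.

(** For [y = T *m x - x], equality of the squares of [x] and [T *m x] gives |<x, T x>|^2 - 1 = |<x,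
    y>|^2 + <y, y>. With [u], [v] bounding |lam - 1| on the negative and the positive coordinates
    and [S] the square of the positive part, this is at most (v S + u (1 + S))^2 + v^2 S - u^2 (1 +
    S) = (u + v)^2 S (1 + S), where [u + v = delta lam]. *)
Lemma elliptic_step x : form x x = -1 ->
  qnorm2 (form x (T *m x)) - 1 <= delta lam ^+ 2 * (qnorm2 (x ord0 0) - 1) * qnorm2 (x ord0 0).
Proof.
move=> xx; pose u := qabs (lam 0 ord0 - 1); pose v := delta lam - u.
have u0 : 0 <= u := qabs_ge0 _.
have vi i : qabs (lam 0 (lift ord0 i) - 1) <= v by rewrite /v lerBrDl delta_ge.
have v0 : 0 <= v by apply: le_trans (vi ord0); exact: qabs_ge0.
have duv : delta lam = u + v by rewrite /v addrC subrK.
have [y yE] : exists y, y = T *m x - x by exists (T *m x - x).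
have yi i : y i 0 = (lam 0 i - 1) * x i 0.
  have subE (A B : 'cV[H]_n.+2) : (A - B) i 0 = A i 0 - B i 0 by rewrite !mxE.
  by rewrite yE subE mul_diag_mx mxE mulrBl mul1r.
have TT : qre (form (T *m x) (T *m x)) = -1.
  have e i : qnorm2 ((T *m x) i 0) = qnorm2 (x i 0).
    by rewrite mul_diag_mx mxE qnorm2M -[qnorm2 (lam 0 i)]sqr_qabs lam1 expr1n mul1r.
  rewrite qre_formJ1 e -[RHS]/(qre (-1 : H)) -xx qre_formJ1 /vn2; congr (_ - _).
  by apply: eq_bigr => i _.
have Tx : T *m x = x + y by rewrite yE addrC subrK.
have qE : qnorm2 (form x (T *m x)) - 1 = qnorm2 (form x y) + qre (form y y).
  move: TT; rewrite Tx formDl !formDr (formC Jh x y) xx.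
  move: (form x y) => q; rewrite !qcE /=; move: (qre (form y y)) => f.
  rewrite /qnorm2 !qcE /=; lra.
set S := \sum_(i < n.+1) qnorm2 (x (lift ord0 i) 0).
have S0 : 0 <= S by apply: sumr_ge0 => i _; exact: qnorm2_ge0.
have XS : qnorm2 (x ord0 0) = 1 + S.
  by have := qre_formJ1 x; rewrite xx /vn2 big_ord_recl -/S /=; lra.
have sumy : \sum_(i < n.+1) qnorm2 (y (lift ord0 i) 0) <= v ^+ 2 * S.
  rewrite /S mulr_sumr; apply: ler_sum => i _; rewrite yi qnorm2M ler_wpM2r ?qnorm2_ge0 //.
  by rewrite -sqr_qabs lerXn2r ?nnegrE ?qabs_ge0.
have yy : qre (form y y) <= v ^+ 2 * S - u ^+ 2 * (1 + S).
  rewrite qre_formJ1 /vn2 big_ord_recl.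
  have -> : qnorm2 (y ord0 0) = u ^+ 2 * (1 + S) by rewrite yi qnorm2M XS /u sqr_qabs.
  by move: sumy; move: (\sum_(_ < _) _) => s; lra.
have xy : qabs (form x y) <= v * S + u * (1 + S).
  rewrite formJ1E; apply: le_trans (qabsB _ _) _; apply: lerD; last first.
    rewrite yi qabsM qabs_conj qabsM mulrCA -/u ler_wpM2l // -expr2 sqr_qabs XS //.
  apply: le_trans (qabs_sum _ _) _; rewrite /S mulr_sumr; apply: ler_sum => i _.
  rewrite yi qabsM qabs_conj qabsM mulrCA -expr2 sqr_qabs ler_wpM2r ?qnorm2_ge0 //.
have q2 : qnorm2 (form x y) <= (v * S + u * (1 + S)) ^+ 2.
  rewrite -sqr_qabs lerXn2r ?nnegrE ?qabs_ge0 //.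
  by apply: addr_ge0; apply: mulr_ge0 => //; exact: addr_ge0.
rewrite qE duv XS; apply: le_trans (lerD q2 yy) _; rewrite le_eqVlt; apply/orP; left; apply/eqP.
ring.
Qed.

Lemma jorgensen_elliptic_form : Sp J T -> jorgensen J T e0.
Proof.
move=> ST; have d0 : 0 <= delta lam by exact: bigmax_ge_id.
have sq (b c : R) : 0 <= b -> 0 < c -> c <= 1 -> b <= 1 + c / 3 -> b ^+ 2 <= 1 + c by nra.
(* While [a j <= 1 + k], the factor [delta lam ^+ 2 * a j] of [elliptic_step] is below 1; a corner
   entry within [k / 3] of 1 ensures this at the start. *)
pose k := (1 - delta lam ^+ 2) / 2.
have k0 : 0 < k by rewrite divr_gt0 // subr_gt0 expr_lt1.
have k1 : k <= 1 by rewrite /k; have := sqr_ge0 (delta lam); lra.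
have dk : delta lam ^+ 2 * (1 + k) < 1.
  by rewrite /k; have := sqr_ge0 (delta lam); move: k0; rewrite /k; nra.
exists (k / 3); first by rewrite divr_gt0.
move=> F0 K SF0 F0e pF0 SK KT KFT tK.
pose step F := F *m T *m mxinv F; pose F j := iter j step F0.
have ee : form e0 e0 = -1 by rewrite form_delta J1E.
have SF j : Sp J (F j).
  by elim: j => [//|j IH]; apply: (SpM HJ); [exact: (SpM HJ)|exact: SpV].
have KF j : K (F j.+1).
  elim: j => [//|j IH]; apply: (GM SK); [exact: (GM SK)|exact: (GV SK)].
have move_ j : ~ onl e0 (F j *m e0).
  elim: j => [//|j IH] h; apply: IH; apply: (onl_Sp_inv (SF j) (delta_neq0 _ _)).
  by apply: regular_fixed (fixed_conj (SF j) h); exact: (negative_Sp (SpV (SF j)) negative_e0).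
(* The squared hyperbolic cosine of half the distance from [e0] to its image under [F j]. *)
pose a j := qnorm2 (F j ord0 ord0).
have aE j : a j = qnorm2 (form e0 (F j *m e0)).
  by rewrite form_e0 qnorm2N -colE mxE.
have a1 j : 1 < a j.
  have := strict_cosh HJ ee (_ : form (F j *m e0) (F j *m e0) = -1) (move_ j).
  rewrite (form_Sp _ _ (SF j)) aE => /(_ ee) h; rewrite -sqr_qabs.
  by move: h; nra.
have aS j : a j.+1 - 1 <= delta lam ^+ 2 * (a j - 1) * a j.
  have xx : form (mxinv (F j) *m e0) (mxinv (F j) *m e0) = -1.
    by rewrite (form_Sp _ _ (SpV (SF j))).
  have := elliptic_step xx.
  have -> : qnorm2 ((mxinv (F j) *m e0) ord0 0) = a j.
    rewrite -qnorm2N -form_e0 -(form_SpVr _ _ (SF j)) (formC Jh e0) qnorm2_conj -aE //.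
  have -> : form (mxinv (F j) *m e0) (T *m (mxinv (F j) *m e0)) = form e0 (F j.+1 *m e0).
    by rewrite (form_SpV _ _ (SF j)) !mulmxA.
  by rewrite -aE.
have dec j : a j <= 1 + k /\ a j.+1 < a j.
  have lt b b' : 1 < b -> b <= 1 + k -> b' - 1 <= delta lam ^+ 2 * (b - 1) * b -> b' < b.
    move: (delta lam ^+ 2) dk (sqr_ge0 (delta lam)) => D Dk D0 h1 h2 h3.
    have : D * b < 1 by apply: le_lt_trans Dk; rewrite ler_wpM2l.
    nra.
  have le0 : a 0%N <= 1 + k.
    have : qabs (F0 ord0 ord0) <= 1 + k / 3.
      rewrite -(subrK 1 (F0 ord0 ord0)) addrC; apply: le_trans (qabsD _ _) _.
      rewrite qabs1 lerD2l; apply: le_trans (ltW F0e).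
      by have := qabs_le_nrm (F0 - 1%:M) ord0 ord0; rewrite !mxE.
    rewrite /a -sqr_qabs; exact: sq (qabs_ge0 _) k0 k1.
  elim: j => [|j [IH1 IH2]]; first by split=> //; exact: lt (a1 _) le0 (aS _).
  have h := le_trans (ltW IH2) IH1; split=> //; exact: lt (a1 _) h (aS _).
have bnd j : nrm (F j.+1) <= n.+2%:R * (n.+2%:R * 7).
  by apply: Sp_J1_bounded => //; have [h _] := dec j.+1; move: h k1; rewrite -/(a j.+1); lra.
have [i [j [ij Fij]]] := bounded_repeats HJ SK tK KF bnd.
have mono i' d : a (i' + d.+1)%N < a i'.
  elim: d => [|d IH]; first by rewrite addn1; case: (dec i').
  by rewrite addnS; apply: lt_trans IH; case: (dec (i' + d.+1)%N).
have := mono i.+1 (j - i).-1; rewrite prednK ?subn_gt0 // addSn subnKC ?(ltnW ij) //.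
by rewrite /a Fij ltxx.
Qed.

End EllipticForm.

Theorem theorem1p1 (R : realType) (n : nat) (J : 'M[quat R]_n.+2)
    (HJ : J = J1 R n \/ J = J2 R n)
    (G : set 'M[quat R]_n.+2) (HG : subgroup J G) (ZG : Zariski_dense J G) :
  [/\ forall (g : 'M[quat R]_n.+2) (lam : 'rV[quat R]_n.+2),
        Sp J g -> elliptic J g -> elliptic_form J g lam -> regular lam ->
        delta lam < 1 ->
        (forall h, G h -> loxodromic J h ->
           discrete (generated J [set g; h *m g *m mxinv h])) ->
        discrete G,
      forall (g : 'M[quat R]_n.+2) (l1 : quat R) (mu : 'rV[quat R]_n),
        Sp J g -> loxodromic J g -> loxodromic_form J g l1 mu ->
        M_lox l1 mu < 1 ->
        (forall h, G h -> loxodromic J h ->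
           discrete (generated J [set g; h *m g *m mxinv h])) ->
        discrete G
    & forall (g : 'M[quat R]_n.+2) (s : quat R) (zeta : 'cV[quat R]_n),
        Sp J g -> heisenberg_translation J g -> heisenberg_form J g s zeta ->
        vnorm zeta < 1 / 2 ->
        (forall h, G h -> loxodromic J h ->
           discrete (generated J [set g; h *m g *m mxinv h])) ->
        discrete G].
Proof.
have lJ : lorentz J by case: HJ => ->; [exact: lorentz_J1|exact: lorentz_J2].
(* The normal form may live in the other model than [G], since [conj_to] includes the change of
   basis. *)
have Sp_conj J' g T : Sp J g -> conj_to J g J' T -> Sp J' T.
  by move=> Sg [C CJ <-]; exact: (mxconj_Sp CJ).
split.
- move=> g lam Sg _ [lam1 cj] reg d1.
  apply: (jorgensen_discrete (ltn0Sn _) lJ HG ZG Sg cj (or_introl (negative_e0 R n))).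
  exact: (jorgensen_elliptic_form lam1 reg d1 (Sp_conj _ _ _ Sg cj)).
- move=> g l1 mu Sg _ [l11 mu1 cj] M1.
  apply: (jorgensen_discrete (ltn0Sn _) lJ HG ZG Sg cj (p := delta_mx ord0 0)).
    by right; split; [exact: delta_neq0|rewrite form_delta J2E].
  exact: (jorgensen_loxodromic_form l11 mu1 M1 (Sp_conj _ _ _ Sg cj)).
move=> g s zeta Sg [par _] [_ cj] _.
have [T [p [cj' np jT]]] := jorgensen_heisenberg Sg par cj.
exact: (jorgensen_discrete (ltn0Sn _) lJ HG ZG Sg cj' (or_intror np) jT).
Qed.
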